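(* With the notation of the context, suppose $\mathfrak j^2\subseteq\mathfrak i$. Given $\phi\in\widetilde N$, let $t$ be the unique element of $T\cap\mathcal P$ such that the linear character $\alpha_t$ of $\Omega(\mathfrak i)$ enters $Top(\phi)$ (i.e. is a constituent of its restriction to $\Omega(\mathfrak i)$). Then (a) $Z_t(\phi)$ remains irreducible upon restriction to $\Omega(\mathfrak j)$. (b) The stabilizer in $\mathcal U(V)$ of the $\Omega(\mathfrak j)$-module $Z_t(\phi)$ is $G_tN$, and $Top(\phi)\cong\mathrm{ind}_{G_tN}^{\mathcal U(V)}Z_t(\phi)$. (c) Let $H_t$ be the subgroup of $H(U^\perp)$ generated by $(0,U)$, $(R,0)$ and all $(0,gt-t)$ such that $g\in\Omega(\mathfrak j)$. Then the restriction of $S'$ to $H_t$ leaves $Z_t(\phi)$ invariant and $Z\cong\mathrm{ind}_{H_t}^{H(U^\perp)}Z_t(\phi)$. In particular, $Z_t(\phi)$ is an irreducible $H_t$-module whose stabilizer in $H(U^\perp)$ is $H_t$ itself, and the index of $H_t$ in $H(U^\perp)$ is precisely $|N\cap(1+\mathfrak j)/N\cap(1+\mathfrak i)|$. (d) Let $\Gamma:\Omega(\mathfrak j)\to\mathfrak jV/\mathfrak iV$ be defined by $\Gamma(g)=gt-t+\mathfrak iV$. Then $\Gamma$ is a group homomorphism and $[\mathfrak jV/\mathfrak iV:\Gamma(\Omega(\mathfrak j))]=|N\cap(1+\mathfrak j)/N\cap(1+\mathfrak i)|$.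
   Context: **Rings.** $\mathcal O$ is a discrete valuation ring with an involution (possibly trivial) and finite residue field of characteristic not 2. $A$ is a quotient of $\mathcal O$ by a nonzero power of its maximal ideal, $*$ is the involution of $A$ inherited from $\mathcal O$, $R=\{a\in A: a^*=a\}$ and $S=\{a\in A: a^*=-a\}$, so $A=R\oplus S$. $A$ is assumed not to be a field. $\mathfrak r=A\pi$ and $\mathfrak m=Rp$ are the maximal ideals of $A$ and $R$, $F_q=R/\mathfrak m$, and $\mathfrak n$ is the minimal nonzero ideal of $A$. Exactly one of the following cases occurs. Symplectic: $*$ is trivial, $A=R$, $\pi=p$. Unramified: $A=R\oplus\theta R$ with $\theta$ a unit of $A$, $\theta^*=-\theta$, $\pi=p$. Ramified: $A=R\oplus\pi R$ with $\pi^*=-\pi$, $\pi^2=p$; this case is called odd (resp. even) if the nilpotency degree of $\pi$ is odd, equal to $2\ell-1$ (resp. even, equal to $2\ell$). **Forms and groups.** $V$ is a free $A$-module of finite rank $m>1$. $h:V\times V\to A$ is a nondegenerate form, $A$-linear in the second variable and $*$-semilinear in the first; $h$ is skew hermitian ($h(v,u)=-h(u,v)^*$) in the symplectic, unramified and ramified odd cases, and hermitian ($h(v,u)=h(u,v)^*$) in the ramified even case. A vector is primitive if it belongs to an $A$-basis of $V$; $\mathcal P=V\setminus\mathfrak rV$ is the set of primitive vectors. $d:A\to R$ is the $R$-linear map which is the projection of $A=R\oplus S$ onto $R$ in the symplectic, unramified and ramified odd cases, and $d(r+s\pi)=s$ ($r,s\in R$) in the ramified even case. $f=d\circ h:V\times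 V\to R$ is a nondegenerate alternating $R$-bilinear form. $\mathcal U(V)$ is the group of $A$-linear automorphisms of $V$ preserving $h$, and $\mathrm{Sp}(V)$ the group of $R$-linear automorphisms of $V$ preserving $f$. For an ideal $\mathfrak k$ of $A$, $\Omega(\mathfrak k)=\{g\in\mathcal U(V): gv\equiv v \bmod \mathfrak kV \text{ for all }v\in V\}$. $N=\{a\in A^\times: aa^*=1\}$, viewed as a central subgroup of $\mathcal U(V)$ via $a\mapsto a\cdot 1_V$; $\widehat N$ is the group of linear characters $N\to\mathbb C^*$. **Ideals.** $\mathfrak i$ is a fixed nonzero ideal of $A$ with $\mathfrak i^2=(0)$, $\mathfrak j$ is its annihilator in $A$, and $U=\mathfrak iV$, so that $U^\perp=\mathfrak jV$ (with respect to both $h$ and $f$) and $U\subseteq U^\perp$. **Heisenberg group and Weil module.** $H(V)$ is $R\times V$ with multiplication $(r,u)(s,v)=(r+s+f(u,v),u+v)$; $\mathrm{Sp}(V)$ acts on it by ${}^g(r,u)=(r,gu)$. $H(U^\perp)$ is the subgroup $R\times U^\perp$. $\lambda:R^+\to\mathbb C^*$ is a fixed linear character that is primitive (its kernel contains no ideal of $R$ other than $(0)$), and $\mu:A^+\to\mathbb C^*$ is $\mu(a)=\lambda(d(a))$. $S':H(U^\perp)\to\mathrm{GL}(Z)$ is the unique (up to isomorphism) irreducible complex representation of $H(U^\perp)$ in which each $(r,u)\in(R,U)$ acts as the scalar $\lambda(r)$. There is a corresponding Weil representation $\mathrm{Sp}(U^\perp)\to\mathrm{GL}(Z)$ ($\mathrm{Sp}(U^\perp)$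 being the group of $R$-linear automorphisms of $U^\perp$ preserving $f$), i.e. a representation $W'$ with $W'(g)S'(k)W'(g)^{-1}=S'({}^gk)$ for all $g$ and all $k\in H(U^\perp)$; $W'$ denotes its restriction to the unitary group $\mathcal U(U^\perp)$ of $A$-linear automorphisms of $U^\perp$ preserving $h$. Via restriction $g\mapsto g|_{U^\perp}$, $Z$ is an $H(U^\perp)\rtimes\mathcal U(V)$-module. Put $X=\mathrm{ind}_{H(U^\perp)\rtimes\mathcal U(V)}^{H(V)\rtimes\mathcal U(V)}Z$. Restricted to $H(V)$, $X$ is the unique irreducible module lying over $\lambda$ (the Schrödinger module of type $\lambda$), and restricted to $\mathcal U(V)$ it is called the Weil module of type $\lambda$. $Bot$ is the $\mathcal U(V)$-submodule of $X$ of all fixed points of $(0,\mathfrak nV)$, and $Top=X/Bot$. For $\phi\in\widehat N$, $Top(\phi)$ is the $\phi$-eigenspace of $N$ in $Top$. **Orbits.** $T\subseteq V$ is a system of representatives for the $\mathcal U(V)$-orbits of $V/U^\perp$. For $t\in V$, $G_t=\{g\in\mathcal U(V): gt\equiv t\bmod U^\perp\}$, and $Z_t=Z$ as a vector space, affording the representation $W_t:G_t\to\mathrm{GL}(Z_t)$, $W_t(g)=S'(f(gt,t),gt-t)\,W'(g|_{U^\perp})$. The group $\Omega(\mathfrak i)$ acts on $Z_t$ through the linear character $\alpha_t:\Omega(\mathfrak i)\to\mathbb C^*$, $\alpha_t(g)=\lambda(f(gt,t))=\mu(h(gt,t))$. $\widetilde N$ is the set of all $\phi\in\widehat N$ that extend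 $\alpha_t|_{N\cap(1+\mathfrak i)}$ for some $t\in T\cap\mathcal P$. For $\phi\in\widetilde N$ there is exactly one $t\in T\cap\mathcal P$ such that $\alpha_t$ enters $Top(\phi)$. For this $t$, $Z_t(\phi)$ is the eigenspace of $Z_t$ for the subgroup $N\cap G_t=N\cap(1+\mathfrak j)$ of $G_t$ corresponding to $\phi|_{N\cap(1+\mathfrak j)}$; it is a $G_tN$-module with $G_t$ (which contains $\Omega(\mathfrak j)$) acting through $W_t$ and $N$ acting through $\phi$. The stabilizer of a module of a normal subgroup is the group of elements whose conjugation action preserves the isomorphism class of that module. *)

(* Defs.v *)
From HB Require Import structures.
From mathcomp Require Import all_boot all_order all_algebra all_fingroup.
From mathcomp Require Import sesquilinear.

Set Implicit Arguments.
Unset Strict Implicit.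
Unset Printing Implicit Defensive.

Import GRing.Theory.
Local Open Scope ring_scope.

(* A module of a finite group is a subspace M of a vector space E together    *)
(* with a map rho : gT -> 'End(E) whose restriction to M is an action; the    *)
(* values of rho outside M, or at group elements outside G, are irrelevant.   *)
Section Modules.

Variable F : fieldType.

Definition is_module (gT : finGroupType) (G : {set gT}) (E : vectType F)
    (M : {vspace E}) (rho : gT -> 'End(E)) : Prop :=
  [/\ {in G, forall g, (rho g @: M <= M)%VS},
      {in M, forall v, rho 1%g v = v} &
      {in G & G, forall g k, {in M, forall v, rho (g * k)%g v = rho g (rho k v)}}].

Definition is_irreducible (gT : finGroupType) (G : {set gT}) (E : vectType F)
    (M : {vspace E}) (rho : gT -> 'End(E)) : Prop :=
  [/\ is_module G M rho, M <> 0%VS &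
      forall W : {vspace E}, (W <= M)%VS ->
        {in G, forall g, (rho g @: W <= W)%VS} -> W = 0%VS \/ W = M].

Definition module_iso (gT : finGroupType) (G : {set gT}) (E1 E2 : vectType F)
    (M1 : {vspace E1}) (rho1 : gT -> 'End(E1))
    (M2 : {vspace E2}) (rho2 : gT -> 'End(E2)) : Prop :=
  exists T : 'Hom(E1, E2),
    [/\ (T @: M1)%VS = M2, (M1 :&: lker T)%VS = 0%VS &
        {in G & M1, forall g v, T (rho1 g v) = rho2 g (T v)}].

(* (Q, rhoQ), with projection q, is the quotient of (M, rho) by B.            *)
Definition is_quotient_module (gT : finGroupType) (G : {set gT})
    (E Q : vectType F) (M : {vspace E}) (rho : gT -> 'End(E)) (B : {vspace E})
    (rhoQ : gT -> 'End(Q)) (q : 'Hom(E, Q)) : Prop :=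
  [/\ (q @: M)%VS = fullv, (M :&: lker q)%VS = B &
      {in G & M, forall g v, rhoQ g (q v) = q (rho g v)}].

(* St is the stabilizer in G of the module (M, rho) of the normal subgroup K; *)
(* in MathComp k ^ g is g^-1 * k * g.                                         *)
Definition is_stabilizer (gT : finGroupType) (G K : {set gT}) (E : vectType F)
    (M : {vspace E}) (rho : gT -> 'End(E)) (St : {set gT}) : Prop :=
  St \subset G /\
  {in G, forall g,
    g \in St <-> module_iso K M (fun k => rho (k ^ g)%g) M rho}.

Definition leigen (E : vectType F) (u : 'End(E)) (c : F) : {vspace E} :=
  lker (u - c *: \1%VF).

(* ind_H^G (M, rho) is the space of all functions x |-> F x from G to M such  *)
(* that F (h x) = rho h (F x) for h in H, with G acting by right translation. *)
(* Functions on G are extended by 0 to gT.  See ind_spaceP and ind_actE.      *)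
Section Induction.

Variables (gT : finGroupType) (E : vectType F).

Definition ev_at (x : gT) : 'Hom({ffun gT -> E}, E) :=
  linfun (fun phi : {ffun gT -> E} => phi x).

Definition ind_space (G H : {set gT}) (M : {vspace E}) (rho : gT -> 'End(E)) :
    {vspace {ffun gT -> E}} :=
  ((\bigcap_(x in G) (ev_at x @^-1: M)) :&:
   (\bigcap_(x in ~: G) lker (ev_at x)) :&:
   (\bigcap_(h in H) \bigcap_(x in G)
      lker (ev_at (h * x)%g - (rho h \o ev_at x)%VF)))%VS.

Definition ind_act (g : gT) : 'End({ffun gT -> E}) :=
  linfun (fun phi : {ffun gT -> E} => [ffun x => phi (x * g)%g]).

Lemma ev_atE x (phi : {ffun gT -> E}) : ev_at x phi = phi x.
Proof.
pose e (phi : {ffun gT -> E}) := phi x.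
have lin_e : linear e by move=> a u v; rewrite /e !ffunE.
pose L := GRing.isLinear.Build _ _ _ _ e lin_e.
pose le : {linear {ffun gT -> E} -> E} := HB.pack e L.
exact: (lfunE le).
Qed.

Lemma ind_actE g (phi : {ffun gT -> E}) x : ind_act g phi x = phi (x * g)%g.
Proof.
pose e (phi : {ffun gT -> E}) := [ffun x => phi (x * g)%g].
have lin_e : linear e by move=> a u v; apply/ffunP=> y; rewrite !ffunE.
pose L := GRing.isLinear.Build _ _ _ _ e lin_e.
pose le : {linear {ffun gT -> E} -> {ffun gT -> E}} := HB.pack e L.
by rewrite [ind_act g phi](lfunE le) ffunE.
Qed.

Lemma ind_spaceP (G H : {set gT}) (M : {vspace E}) (rho : gT -> 'End(E))
    (phi : {ffun gT -> E}) :
  phi \in ind_space G H M rho <->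
  [/\ {in G, forall x, phi x \in M}, {in ~: G, forall x, phi x = 0} &
      {in H & G, forall h x, phi (h * x)%g = rho h (phi x)}].
Proof.
rewrite !memv_cap; split=> [/andP[/andP[/subv_bigcapP h1 /subv_bigcapP h2]]|].
  move/subv_bigcapP=> h3; split.
  - by move=> x xG; have:= h1 x xG; rewrite -memvE -memv_preim ev_atE.
  - by move=> x xG; have:= h2 x xG; rewrite -memvE memv_ker ev_atE => /eqP.
  - move=> h x hH xG; have:= h3 h hH; move/subv_bigcapP=> /(_ x xG).
    by rewrite -memvE memv_ker !lfun_simp !ev_atE subr_eq0 => /eqP.
case=> h1 h2 h3; apply/andP; split; first (apply/andP; split).
- by apply/subv_bigcapP=> x xG; rewrite -memvE -memv_preim ev_atE h1.
- by apply/subv_bigcapP=> x xG; rewrite -memvE memv_ker ev_atE h2.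
- apply/subv_bigcapP=> h hH; apply/subv_bigcapP=> x xG.
  by rewrite -memvE memv_ker !lfun_simp !ev_atE h3 // subrr.
Qed.

End Induction.

End Modules.

(* Permutations of T, multiplied as functions: (g * k) x = g (k x), whereas   *)
(* the product of {perm T} satisfies (g * k) x = k (g x).                     *)
Definition fperm (T : finType) := {perm T}.
Identity Coercion fperm_perm : fperm >-> perm_of.

Section FPerm.

Variable T : finType.

Definition fperm_mul (g k : fperm T) : fperm T := ((k : {perm T}) * g)%g.
Definition fperm_one : fperm T := (1 : {perm T})%g.
Definition fperm_inv (g : fperm T) : fperm T := ((g : {perm T})^-1)%g.

Lemma fperm_mulA : associative fperm_mul.
Proof. by move=> g k l; rewrite /fperm_mul mulgA. Qed.
Lemma fperm_mul1 : left_id fperm_one fperm_mul.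
Proof. by move=> g; rewrite /fperm_mul mulg1. Qed.
Lemma fperm_mulV : left_inverse fperm_one fperm_inv fperm_mul.
Proof. by move=> g; rewrite /fperm_mul mulgV. Qed.

HB.instance Definition _ := Finite.copy (fperm T) {perm T}.
HB.instance Definition _ :=
  Finite_isGroup.Build (fperm T) fperm_mulA fperm_mul1 fperm_mulV.

Lemma fpermM (g k : fperm T) x : (g * k)%g x = g (k x).
Proof. exact: permM. Qed.
Lemma fperm1 x : (1%g : fperm T) x = x.
Proof. exact: perm1. Qed.

End FPerm.

Definition is_ideal (B : finComNzRingType) (I : {set B}) : Prop :=
  0 \in I /\ (forall a x y, x \in I -> y \in I -> a * x + y \in I).

Definition is_min_nonzero_ideal (B : finComNzRingType) (I : {set B}) : Prop :=
  [/\ is_ideal I, I <> [set 0] &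
      forall J : {set B}, is_ideal J -> J <> [set 0] -> J \subset I -> J = I].

Definition annihilator (B : finComNzRingType) (I : {set B}) : {set B} :=
  [set a | [forall x in I, a * x == 0]].

Definition generates_max_ideal (B : comUnitRingType) (x : B) : Prop :=
  forall a : B, a \isn't a GRing.unit <-> exists b, a = b * x.

Definition is_uniformizer (O : idomainType) (w : O) : Prop :=
  [/\ w != 0, w \isn't a GRing.unit &
      forall x : O, x != 0 -> exists u n, u \is a GRing.unit /\ x = u * w ^+ n].

Definition is_dvr (O : idomainType) : Prop := exists w : O, is_uniformizer w.

(* The residue field is given as a surjective image of O whose kernel is the  *)
(* maximal ideal, i.e. the set of nonunits, of the local ring O.              *)
Definition residue_field_finite_not2 (O : idomainType) : Prop :=
  exists (k : finFieldType) (res : {rmorphism O -> k}),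
    [/\ forall y, exists x, res x = y,
        forall x, res x = 0 <-> x \isn't a GRing.unit &
        2 \notin [pchar k]].

(* The kernel of q is the e-th power of the maximal ideal w O.                *)
Definition is_dvr_quotient (O : idomainType)
    (starO : involutive_rmorphism O) (A : finComUnitRingType)
    (star : involutive_rmorphism A) (q : {rmorphism O -> A}) : Prop :=
  [/\ forall a, exists x, q x = a,
      forall x, q (starO x) = star (q x) &
      forall w, is_uniformizer w -> exists2 e : nat, (0 < e)%N &
        forall x, q x = 0 <-> exists y, x = y * w ^+ e].

Section SymmetricSubring.

Variables (A : finComUnitRingType) (star : involutive_rmorphism A).

Definition sym_pred : {pred A} := [pred a | star a == a].

Lemma sym_divring : divring_closed sym_pred.
Proof.
split; first by rewrite inE rmorph1.
  by move=> x y; rewrite !inE rmorphB /= => /eqP-> /eqP->.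
move=> x y; rewrite !inE rmorphM /= => /eqP-> /eqP ey.
have [uy|nuy] := boolP (y \is a GRing.unit); first by rewrite rmorphV //= ey.
by rewrite invr_out // ey.
Qed.

HB.instance Definition _ := GRing.isDivringClosed.Build A sym_pred sym_divring.

Definition symR : predArgType := {a : A | a \in sym_pred}.

HB.instance Definition _ := SubFinite.copy symR {a : A | a \in sym_pred}.
HB.instance Definition _ := [SubChoice_isSubComUnitRing of symR by <:].

End SymmetricSubring.

Inductive inv_case := Symplectic | Unramified | RamifiedOdd | RamifiedEven.

Section Cases.

Variables (A : finComUnitRingType) (star : involutive_rmorphism A).
Local Notation R := (symR star).

(* A is the direct sum of its R-submodules R and x R *)
Definition is_direct_sum (x : A) : Prop :=
  (forall a, exists r s : R, a = \val r + x * \val s) /\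
  (forall r s : R, \val r = x * \val s -> \val r = 0).

Definition nilpotency_degree (x : A) (e : nat) : Prop :=
  x ^+ e = 0 /\ forall i : nat, (i < e)%N -> x ^+ i <> 0.

Definition ramified (pi : A) (p : R) : Prop :=
  [/\ is_direct_sum pi, star pi = - pi & pi ^+ 2 = \val p].

Definition ring_case (c : inv_case) (pi : A) (p : R) : Prop :=
  match c with
  | Symplectic => (forall a, star a = a) /\ pi = \val p
  | Unramified => pi = \val p /\
      exists theta, [/\ theta \is a GRing.unit, star theta = - theta &
                        is_direct_sum theta]
  | RamifiedOdd => ramified pi p /\
      exists2 e : nat, nilpotency_degree pi e & odd e
  | RamifiedEven => ramified pi p /\
      exists2 e : nat, nilpotency_degree pi e & ~~ odd e
  end.

Definition d_case (c : inv_case) (pi : A) (d : {additive A -> R}) : Prop :=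
  match c with
  | RamifiedEven => forall r s : R, d (\val r + \val s * pi) = s
  | _ => forall (r : R) (s : A), star s = - s -> d (\val r + s) = r
  end.

Definition herm_case (c : inv_case) (V : Type) (h : V -> V -> A) : Prop :=
  match c with
  | RamifiedEven => forall u v, h v u = star (h u v)
  | _ => forall u v, h v u = - star (h u v)
  end.

End Cases.

Definition nondegenerate_form (V W : zmodType) (h : V -> V -> W) : Prop :=
  (forall u, (forall v, h u v = 0) -> u = 0) /\
  (forall v, (forall u, h u v = 0) -> v = 0).

Definition is_add_char (C : fieldType) (B : zmodType) (lam : B -> C) : Prop :=
  lam 0 = 1 /\ forall x y, lam (x + y) = lam x * lam y.

Definition is_primitive_char (C : fieldType) (B : finComNzRingType)
    (lam : B -> C) : Prop :=
  is_add_char lam /\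
  forall J : {set B}, is_ideal J -> {in J, forall x, lam x = 1} -> J = [set 0].

Definition is_lin_char (C : fieldType) (gT : finGroupType) (G : {set gT})
    (phi : gT -> C) : Prop :=
  phi 1%g = 1 /\ {in G &, forall x y, phi (x * y)%g = phi x * phi y}.

Section UnitaryGroup.

Variables (A : finComUnitRingType) (star : involutive_rmorphism A) (m : nat).
Local Notation R := (symR star).
Local Notation V := 'rV[A]_m.
(* star-semilinear in the first variable, linear in the second one *)
Variable h : {bilinear V -> V -> A | (star \; *%R) & *%R}.
Variable d : {additive A -> R}.

Definition alt_form (u v : V) : R := d (h u v).
Local Notation f := alt_form.

Definition ideal_mul (k : {set A}) : {set V} :=
  [set v : V | [forall i, v ord0 i \in k]].

Definition primitive_vectors (pi : A) : {set V} :=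
  ~: ideal_mul [set a * pi | a : A].

Definition unitary_set : {set fperm V} :=
  [set g : fperm V |
    [forall a : A, forall u : V, forall v : V,
       g (a *: u + v) == a *: g u + g v] &&
    [forall u : V, forall v : V, h (g u) (g v) == h u v]].

Lemma unitaryP (g : fperm V) :
  reflect ((forall a u v, g (a *: u + v) = a *: g u + g v) /\
           (forall u v, h (g u) (g v) = h u v))
          (g \in unitary_set).
Proof.
rewrite inE; apply: (iffP andP) => [[/forallP lg /forallP hg]|[lg hg]].
  split=> [a u v|u v]; last by have /forallP/(_ v)/eqP := hg u.
  by have /forallP/(_ u)/forallP/(_ v)/eqP := lg a.
split; first by do 3!apply/forallP=> ?; rewrite lg.
by do 2!apply/forallP=> ?; rewrite hg.
Qed.

Lemma unitary_group_set : group_set unitary_set.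
Proof.
apply/group_setP; split; first by apply/unitaryP; split=> *; rewrite !fperm1.
move=> x y /unitaryP[lx hx] /unitaryP[ly hy].
by apply/unitaryP; split=> *; rewrite !fpermM ?ly ?lx ?hx ?hy.
Qed.

Canonical unitary : {group fperm V} := group unitary_group_set.

Definition Omega (k : {set A}) : {set fperm V} :=
  [set g in unitary | [forall v : V, g v - v \in ideal_mul k]].

Definition norm_one : {set {unit A}} :=
  [set a : {unit A} | \val a * star (\val a) == 1].

Definition norm_one_cong (k : {set A}) : {set {unit A}} :=
  [set a in norm_one | \val a - 1 \in k].

Lemma scalar_inj (a : {unit A}) : injective (fun v : V => \val a *: v).
Proof.
move=> u v /(congr1 ( *:%R (\val a)^-1)).
by rewrite !scalerA mulVr ?scale1r //; exact: valP a.
Qed.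

Definition scalar_aut (a : {unit A}) : fperm V := perm (@scalar_inj a).

Definition orthogonal_set (W : {set V}) : {set V} :=
  [set v : V | [forall u in W, h u v == 0]].

(* R-linear automorphisms of the submodule W that preserve f, extended by the *)
(* identity to V; the restriction of g to W is thus restr_perm W g.           *)
Definition Sp_of (W : {set V}) : {set fperm V} :=
  [set g : fperm V |
    [&& perm_on W g,
        [forall r : R, forall u in W, forall v in W,
           g (\val r *: u + v) == \val r *: g u + g v] &
        [forall u in W, forall v in W, f (g u) (g v) == f u v]]].

(* H(V); the parameters h and d only serve to determine the group law *)
Definition heis (_ : {bilinear V -> V -> A | (star \; *%R) & *%R})
  (_ : {additive A -> R}) : Type := (R * V)%type.
Local Notation H := (heis h d).

Definition heis_mul (x y : H) : H :=
  (x.1 + y.1 + f x.2 y.2, x.2 + y.2).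
Definition heis_one : H := (0, 0).
Definition heis_inv (x : H) : H := (f x.2 x.2 - x.1, - x.2).

Lemma alt_formDl u v w : f (u + v) w = f u w + f v w.
Proof. by rewrite /f linearDl raddfD. Qed.
Lemma alt_formDr u v w : f w (u + v) = f w u + f w v.
Proof. by rewrite /f linearDr raddfD. Qed.
Lemma alt_form0l w : f 0 w = 0.
Proof. by rewrite /f linear0l raddf0. Qed.
Lemma alt_formNl u w : f (- u) w = - f u w.
Proof. by rewrite /f linearNl raddfN. Qed.

Lemma heis_mulA : associative heis_mul.
Proof.
move=> [r u] [s v] [t w]; rewrite /heis_mul /= alt_formDl alt_formDr !addrA.
by rewrite (addrAC _ (f v w) (f u v)) (addrAC _ (f v w) (f u w)) (addrAC _ t).
Qed.
Lemma heis_mul1 : left_id heis_one heis_mul.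
Proof. by move=> [r u]; rewrite /heis_mul /= alt_form0l addr0 !add0r. Qed.
Lemma heis_mulV : left_inverse heis_one heis_inv heis_mul.
Proof.
move=> [r u]; rewrite /heis_mul /= alt_formNl subrK addrN addNr.
by [].
Qed.

HB.instance Definition _ := Finite.copy H (R * V)%type.
HB.instance Definition _ :=
  Finite_isGroup.Build H heis_mulA heis_mul1 heis_mulV.

Definition heis_of (W : {set V}) : {set H} := [set x : H | x.2 \in W].

Definition heis_act (g : fperm V) (x : H) : H := (x.1, g x.2).

(* the semidirect product of H(V) by U(V): the pair (k, g) stands for k g      *)
Definition jacobi : Type := (H * subg_of unitary)%type.

Definition jacobi_mul (x y : jacobi) : jacobi :=
  (x.1 * heis_act (sgval x.2) y.1, x.2 * y.2)%g.
Definition jacobi_one : jacobi := (1, 1)%g.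
Definition jacobi_inv (x : jacobi) : jacobi :=
  (heis_act (sgval x.2^-1) x.1^-1, x.2^-1)%g.

Lemma heis_actM (g k : fperm V) x : heis_act (g * k)%g x = heis_act g (heis_act k x).
Proof. by rewrite /heis_act /= fpermM. Qed.
Lemma heis_act1 x : heis_act 1%g x = x.
Proof. by case: x => r u; rewrite /heis_act /= fperm1. Qed.
Lemma heis_act_mul (g : fperm V) x y : g \in unitary ->
  heis_act g (x * y)%g = (heis_act g x * heis_act g y)%g.
Proof.
case/unitaryP=> lg hg; congr (_, _); first by rewrite /= /f hg.
by have := lg 1 x.2 y.2; rewrite !scale1r.
Qed.

Lemma jacobi_mulA : associative jacobi_mul.
Proof.
move=> [x g] [y k] [z l]; rewrite /jacobi_mul /= heis_act_mul ?subgP // !mulgA.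
by rewrite heis_actM.
Qed.
Lemma jacobi_mul1 : left_id jacobi_one jacobi_mul.
Proof. by move=> [x g]; rewrite /jacobi_mul /= heis_act1 !mul1g. Qed.
Lemma jacobi_mulV : left_inverse jacobi_one jacobi_inv jacobi_mul.
Proof.
move=> [x g]; rewrite /jacobi_mul /jacobi_inv -heis_act_mul ?subgP // !mulVg.
case/unitaryP: (subgP g^-1%g) => lg _; congr (_, _); congr (_, _).
by have := lg (-1) 0 0; rewrite scaler0 addr0 scaleN1r addNr.
Qed.

HB.instance Definition _ := Finite.copy jacobi (H * subg_of unitary)%type.
HB.instance Definition _ :=
  Finite_isGroup.Build jacobi jacobi_mulA jacobi_mul1 jacobi_mulV.

End UnitaryGroup.

Section WeilModule.

Variables (A : finComUnitRingType) (star : involutive_rmorphism A) (m : nat).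
Local Notation R := (symR star).
Local Notation V := 'rV[A]_m.
Variable h : {bilinear V -> V -> A | (star \; *%R) & *%R}.
Variable d : {additive A -> R}.
Local Notation f := (alt_form h d).
Local Notation H := (heis h d).
Local Notation G := (unitary_set h).
Local Notation N := (norm_one star).

(* U = i V for an ideal i with annihilator j; Uperp is then j V               *)
Variable i : {set A}.
Local Notation j := (annihilator i).
Local Notation U := (ideal_mul m i).

Definition Uperp : {set V} := orthogonal_set h U.

Definition heis_vec (v : V) : H := (0, v).
Definition heis_scal (r : R) : H := (r, 0).

Variables (C : fieldType) (lam : R -> C).
Variables (Z : vectType C) (S' : H -> 'End(Z)) (W' : fperm V -> 'End(Z)).

Definition is_schrodinger : Prop :=
  is_irreducible (heis_of h d Uperp) fullv S' /\
  forall (r : R) (u : V), u \in U -> S' (r, u) = lam r *: \1%VF.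

Definition is_weil : Prop :=
  is_module (Sp_of h d Uperp) fullv W' /\
  {in Sp_of h d Uperp & heis_of h d Uperp, forall g k,
     (W' g \o S' k \o W' g^-1%g)%VF = S' (heis_act g k)}.

Definition semidirect_act (x : jacobi h d) : 'End(Z) :=
  (S' x.1 \o W' (restr_perm Uperp (sgval x.2)))%VF.

Definition jac_heis (k : H) : jacobi h d := (k, 1%g).
Definition jac_unitary (g : fperm V) : jacobi h d := (1%g, subg (unitary h) g).

(* weil_act restricts the action on the induced module to U(V), which         *)
(* jac_unitary embeds in the semidirect product (subg g is 1 outside U(V)).   *)
Definition weil_space : {vspace {ffun jacobi h d -> Z}} :=
  ind_space [set: jacobi h d] [set x | x.1 \in heis_of h d Uperp]
    fullv semidirect_act.

Definition weil_act (g : fperm V) : 'End({ffun jacobi h d -> Z}) :=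
  ind_act Z (jac_unitary g).

Definition weil_bot (n : {set A}) : {vspace {ffun jacobi h d -> Z}} :=
  (weil_space :&: \bigcap_(v in ideal_mul m n)
     fixedSpace (ind_act Z (jac_heis (heis_vec v))))%VS.

Definition eigen_N (Q : vectType C) (rho : fperm V -> 'End(Q))
    (phi : {unit A} -> C) : {vspace Q} :=
  (\bigcap_(a in N) leigen (rho (scalar_aut m a)) (phi a))%VS.

Definition is_orbit_repr (T : {set V}) : Prop :=
  forall v : V, exists! t : V,
    t \in T /\ exists2 g : fperm V, g \in G & g v - t \in Uperp.

Definition alpha (t : V) (g : fperm V) : C := lam (f (g t) t).

Definition char_enters (gT : finGroupType) (K : {set gT}) (Q : vectType C)
    (M : {vspace Q}) (rho : gT -> 'End(Q)) (c : gT -> C) : Prop :=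
  exists v : Q, [/\ v \in M, v != 0 & {in K, forall g, rho g v = c g *: v}].

Definition in_Ntilde (pi : A) (T : {set V}) (phi : {unit A} -> C) : Prop :=
  is_lin_char N phi /\
  exists t : V, [/\ t \in T, t \in primitive_vectors m pi &
    {in norm_one_cong star i, forall a, phi a = alpha t (scalar_aut m a)}].

Variable t : V.

Definition G_t : {set fperm V} := [set g in G | g t - t \in Uperp].

Definition W_t (g : fperm V) : 'End(Z) :=
  (S' (f (g t) t, g t - t) \o W' (restr_perm Uperp g))%VF.

Definition GtN : {set fperm V} := (G_t * (@scalar_aut A m) @: N)%g.

Definition Z_t (phi : {unit A} -> C) : {vspace Z} :=
  (\bigcap_(a in norm_one_cong star j) leigen (W_t (scalar_aut m a)) (phi a))%VS.

(* the action of G_t N on Z_t(phi), where G_t acts via W_t and N via phi: an  *)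
(* element x is written as a product of some a in N and an element of G_t     *)
Definition GtN_act (phi : {unit A} -> C) (x : fperm V) : 'End(Z) :=
  if [pick a in N | ((scalar_aut m a)^-1 * x)%g \in G_t] is Some a
  then phi a *: W_t ((scalar_aut m a)^-1 * x)%g else 0.

Definition H_t : {set H} :=
  <<(heis_vec @: U) :|: (heis_scal @: [set: R]) :|:
    ((fun g : fperm V => heis_vec (g t - t)) @: Omega h j)>>%g.

Definition Gamma (g : fperm V) : coset_of U := coset U (g t - t).

End WeilModule.

(* Main.v *)
Require Import Defs.
From HB Require Import structures.
From mathcomp Require Import all_boot all_order all_algebra all_fingroup.
From mathcomp Require Import sesquilinear.
From mathcomp Require Import reals complex.
From mathcomp Require Import ring.

(** The four cases of the theorem have a common form: [h v u = eps (h u v)^*]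
    with [eps = -1] or [eps = 1], and the character [mu = lam \o d] of [A] is
    trivial on the [eps]-symmetric elements and on no nonzero ideal. So [mu]
    detects ideals, and an [eps]-symmetric element annihilates an ideal as soon
    as [mu] is trivial on its products with the skew elements of the ideal
    ([annihilator_mu_skew]).

    The geometric input is a Witt theorem ([witt_transitive]): primitive vectors
    of equal length that are congruent modulo an ideal [k] are exchanged by an
    element of [Omega k], namely a product of at most two quasi-reflections.
    Together with explicit elements of [Omega i], it shows that [alpha_v] on
    [N_i] determines the orbit of [v] modulo [jV] ([length_of_scalars],
    [length_congr]), and that [alpha_v = alpha_t] on [Omega i] only if
    [v = a t] modulo [jV] with [a] of norm one ([alpha_determines]).

    On [Omega j] the Weil operators are scalars, by Schur's lemma and
    [j^2 <= i], so [W_t g] is a scalar multiple of the Heisenberg operator of the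
    displacement [g t - t] ([Wt_Omega]). Parts (a), (c) and (d) are then
    statements about the Heisenberg group. The displacements by norm-one scalars
    [a] in [1 + j] act on [Z] by commuting operators, whose simultaneous
    eigenspace for [phi] is [Z_t(phi)]. The vectors of [jV] orthogonal to
    these displacements are, modulo [iV], exactly the displacements by
    [Omega j] ([Omega_disp_perp], [disp_perp_Omega]), so that [H_t] is the
    stabilizer of the eigenspace. Irreducibility and induction follow from the
    irreducibility of [Z], since every Heisenberg operator outside [H_t] moves
    the eigenspace to a different one ([Zt_proj_S'_out]), and both
    indices come from the perfect pairing of [jV / disp_perp] with [N_j / N_i]
    ([card_disp_perp]), where [disp_perp] is the group of displacements.

    For (b), an element of [Top] is a function on the primitive vectors modulo
    [jV]. One in [Top(phi)] is supported on the orbit of [-t] under the unitary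
    group, because [phi] determines [h v v] modulo [j], and restricting it to
    this orbit identifies [Top(phi)] with the induced module ([Top_induced]). *)

Set Implicit Arguments.
Unset Strict Implicit.
Unset Printing Implicit Defensive.

Import GRing.Theory.
Local Open Scope ring_scope.

(** * Finite chain rings *)

Lemma finite_inj_onto (T : finType) (B : {set T}) (g : T -> T) :
  {in B, forall x, g x \in B} -> {in B &, injective g} ->
  {in B, forall y, exists2 x, x \in B & g x = y}.
Proof.
move=> gB g_inj y yB.
have sgB : g @: B \subset B by apply/subsetP=> _ /imsetP[x xB ->]; exact: gB.
have := eqEcard (g @: B) B; rewrite sgB card_in_imset // leqnn => /eqP eB.
by move: yB; rewrite -{1}eB => /imsetP[x xB ->]; exists x.
Qed.

Section Ideals.

Variables (B : finComNzRingType) (I : {set B}).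
Hypothesis I_ideal : is_ideal I.

Lemma mem_ideal0 : 0 \in I. Proof. by case: I_ideal. Qed.

Lemma mem_idealD x y : x \in I -> y \in I -> x + y \in I.
Proof. by move=> xI yI; have := I_ideal.2 1 x y xI yI; rewrite mul1r. Qed.

Lemma mem_idealMl a x : x \in I -> a * x \in I.
Proof. by move=> xI; have := I_ideal.2 a x 0 xI mem_ideal0; rewrite addr0. Qed.

Lemma mem_idealMr a x : x \in I -> x * a \in I.
Proof. by move=> xI; rewrite mulrC mem_idealMl. Qed.

Lemma mem_idealN x : x \in I -> - x \in I.
Proof. by move=> xI; rewrite -mulN1r mem_idealMl. Qed.

Lemma mem_idealB x y : x \in I -> y \in I -> x - y \in I.
Proof. by move=> xI yI; rewrite mem_idealD ?mem_idealN. Qed.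

Lemma annihilatorP (J : {set B}) a :
  reflect {in J, forall x, a * x = 0} (a \in annihilator J).
Proof.
rewrite inE; apply: (iffP forall_inP) => [aJ x /aJ /eqP //|aJ x /aJ ->].
exact: eqxx.
Qed.

Lemma annihilator_ideal (J : {set B}) : is_ideal (annihilator J).
Proof.
split=> [|a x y /annihilatorP xJ /annihilatorP yJ]; apply/annihilatorP=> z zJ.
  by rewrite mul0r.
by rewrite mulrDl -mulrA xJ // yJ // mulr0 addr0.
Qed.

End Ideals.

Lemma setT_ideal (B : finComNzRingType) : is_ideal [set: B].
Proof. by split=> *; rewrite inE. Qed.

Lemma principal_ideal (B : finComNzRingType) (x : B) :
  is_ideal [set a * x | a : B].
Proof.
split; first by apply/imsetP; exists 0; rewrite ?mul0r.
move=> a _ _ /imsetP[b _ ->] /imsetP[c _ ->].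
by apply/imsetP; exists (a * b + c) => //; rewrite mulrDl mulrA.
Qed.

(** A finite commutative ring whose nonunits are the multiples of one element
    [pi] is a chain ring: [pi] is nilpotent and every element is a unit times a
    power of [pi]. *)
Section ChainRing.

Variables (A : finComUnitRingType) (pi : A).
Hypothesis pi_gen : generates_max_ideal pi.

Lemma nonunitD (a b : A) :
  a \isn't a GRing.unit -> b \isn't a GRing.unit -> a + b \isn't a GRing.unit.
Proof.
move=> /pi_gen[x ->] /pi_gen[y ->]; apply/pi_gen; exists (x + y).
by rewrite mulrDl.
Qed.

Lemma nonunitMl (a b : A) :
  b \isn't a GRing.unit -> a * b \isn't a GRing.unit.
Proof. by rewrite unitrM negb_and orbC => ->. Qed.

Lemma nonunitN (a : A) : a \isn't a GRing.unit -> - a \isn't a GRing.unit.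
Proof. by rewrite unitrN. Qed.

Lemma unitD_nonunit (a b : A) :
  a \is a GRing.unit -> b \isn't a GRing.unit -> a + b \is a GRing.unit.
Proof.
move=> ua nb; apply: contraLR ua => nab.
by rewrite -[a](addrK b) nonunitD ?nonunitN.
Qed.

Lemma unitB_nonunit (a b : A) :
  a \is a GRing.unit -> b \isn't a GRing.unit -> a - b \is a GRing.unit.
Proof. by move=> ua nb; rewrite unitD_nonunit ?nonunitN. Qed.

Lemma ideal_nonunit (I : {set A}) : is_ideal I -> 1 \notin I ->
  {in I, forall x, x \isn't a GRing.unit}.
Proof.
move=> I_ideal I1 x xI; apply: contra I1 => ux.
by rewrite -(mulVr ux) mem_idealMl.
Qed.

Lemma pi_nonunit : pi \isn't a GRing.unit.
Proof. by apply/pi_gen; exists 1; rewrite mul1r. Qed.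

Lemma fixed_nonunit (a x : A) : a \isn't a GRing.unit -> a * x = x -> x = 0.
Proof.
move=> na ax; have u1 : 1 - a \is a GRing.unit by rewrite unitB_nonunit ?unitr1.
by apply: (mulrI u1); rewrite mulrBl ax mul1r subrr mulr0.
Qed.

Lemma pi_nilpotent : exists e, nilpotency_degree pi e.
Proof.
have [e0 pe0] : exists e, pi ^+ e == 0.
  have /injectivePn[k [l nkl ekl]] :
      ~~ injectiveb (fun k : 'I_#|A|.+1 => pi ^+ k).
    by apply/injectiveP=> inj; have := leq_card _ inj; rewrite card_ord ltnn.
  wlog ltkl : k l nkl ekl / (k < l)%N.
    move=> wl; have [] := ltngtP k l; [exact: wl| |].
      by apply: wl; rewrite 1?eq_sym.
    by move=> /val_inj ekl'; rewrite ekl' eqxx in nkl.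
  exists k; apply/eqP; apply: (@fixed_nonunit (pi ^+ (l - k))).
    by rewrite unitrX_pos ?subn_gt0 // pi_nonunit.
  by rewrite -exprD subnK ?(ltnW ltkl).
have exP : exists e, pi ^+ e == 0 by exists e0.
case: (ex_minnP exP) => e /eqP pe0' emin; exists e; split=> // k ltke pk0.
by have := emin k; rewrite pk0 eqxx leqNgt ltke => /(_ isT).
Qed.

Lemma chain_form (x : A) :
  exists u k, u \is a GRing.unit /\ x = u * pi ^+ k.
Proof.
have [e [pe0 _]] := pi_nilpotent.
have : forall k, (exists u k, u \is a GRing.unit /\ x = u * pi ^+ k) \/
                 exists y, x = y * pi ^+ k.
  elim=> [|k [IH|[y xy]]]; [by right; exists x; rewrite mulr1|by left|].
  have [uy|/pi_gen[z yz]] := boolP (y \is a GRing.unit).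
    by left; exists y, k.
  by right; exists z; rewrite xy yz -mulrA -exprS.
case/(_ e)=> // -[y]; rewrite pe0 mulr0 => x0.
by exists 1, e; rewrite unitr1 mul1r pe0.
Qed.

Lemma chain_total (x y : A) : (exists a, x = a * y) \/ (exists a, y = a * x).
Proof.
have [u [k [uu ->]]] := chain_form x; have [v [l [uv ->]]] := chain_form y.
have aux : forall u v k l, v \is a GRing.unit -> (l <= k)%N ->
    exists a : A, u * pi ^+ k = a * (v * pi ^+ l).
  move=> {}u {}v {}k {}l {uu}uv lekl; exists (u * v^-1 * pi ^+ (k - l)).
  by rewrite mulrACA divrK // -exprD subnK.
have [lekl|/ltnW lekl] := leqP l k; [left|right]; exact: aux.
Qed.

(** If [c] is outside [I] then [I] lies in [pi c A], and a power of [pi] kills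
    [pi c] without killing [c]. *)
Lemma double_annihilator (I : {set A}) : is_ideal I ->
  annihilator (annihilator I) \subset I.
Proof.
move=> I_ideal; apply/subsetP=> c /annihilatorP cI; apply/negPn/negP=> ncI.
have Isub : forall x, x \in I -> exists b, x = b * pi * c.
  move=> x xI; have [[b xb]|[b cb]] := chain_total x c; last first.
    by rewrite cb mem_idealMl in ncI.
  have [ub|/pi_gen[b' bb']] := boolP (b \is a GRing.unit).
    by case/negP: ncI; rewrite -[c](mulKr ub) -xb mem_idealMl.
  by exists b'; rewrite xb bb'.
have [e [pe0 pmin]] := pi_nilpotent.
have [u [k [uu ck]]] := chain_form c.
have ltke : (k < e)%N.
  rewrite ltnNge; apply: contra ncI => leek.
  by rewrite ck -(subnK leek) exprD pe0 !mulr0 mem_ideal0.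
have zI : pi ^+ (e - k.+1) \in annihilator I.
  apply/annihilatorP=> x /Isub[b ->].
  have := congr1 (fun y => b * u * y) pe0; rewrite -{1}(subnK ltke) mulr0 => <-.
  by rewrite ck exprD [_ ^+ k.+1]exprS; ring.
have := cI _ zI; rewrite ck -mulrA -exprD subnS -subn1 addnBA ?subn_gt0 //.
rewrite subnKC ?(ltnW ltke) // subn1 => /(canRL (mulKr uu)); rewrite mulr0.
by apply: pmin; rewrite prednK ?(leq_ltn_trans _ ltke).
Qed.

Lemma pi_min_ideal (n : {set A}) : is_min_nonzero_ideal n ->
  {in n, forall x, pi * x = 0}.
Proof.
case=> n_ideal _ n_min x xn; apply/eqP/negPn/negP=> px.
have J0 : [set a * (pi * x) | a : A] <> [set 0].
  move/setP=> /(_ (pi * x)); rewrite in_set1 (negPf px) => /imsetP[]; exists 1 => //.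
  by rewrite mul1r.
have Jn : [set a * (pi * x) | a : A] \subset n.
  by apply/subsetP=> _ /imsetP[a _ ->]; rewrite mulrA mem_idealMl.
have := n_min _ (principal_ideal _) J0 Jn => /setP/(_ x); rewrite xn.
case/imsetP=> a _ xa; case/eqP: px.
by rewrite (@fixed_nonunit (a * pi) x) ?mulr0 ?nonunitMl ?pi_nonunit // -mulrA.
Qed.

Lemma min_ideal_sub (n I : {set A}) : is_min_nonzero_ideal n ->
  is_ideal I -> I <> [set 0] -> n \subset I.
Proof.
case=> n_ideal n0 n_min I_ideal I0.
have ex0 (J : {set A}) : is_ideal J -> J <> [set 0] -> exists2 x, x \in J & x != 0.
  move=> J_ideal J0; have [/exists_inP[x xJ x0]|] := boolP [exists x in J, x != 0].
    by exists x.
  rewrite negb_exists_in => /forall_inP J1; case: J0; apply/setP=> x.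
  rewrite in_set1; apply/idP/eqP=> [/J1|->]; last exact: mem_ideal0.
  by rewrite negbK => /eqP.
have [x xn x0] := ex0 _ n_ideal n0; have [y yI y0] := ex0 _ I_ideal I0.
have J_ideal : is_ideal (n :&: I).
  split=> [|a b c]; first by rewrite inE !mem_ideal0.
  rewrite !inE => /andP[bn bI] /andP[cn cI].
  by rewrite !mem_idealD ?mem_idealMl.
suff [z znI z0] : exists2 z, z \in n :&: I & z != 0.
  apply/setIidPl; apply: n_min => //; last exact: subsetIl.
  by move/setP/(_ z); rewrite znI in_set1 (negPf z0).
have [[a xa]|[a ya]] := chain_total x y.
  by exists x; rewrite // inE xn xa mem_idealMl.
by exists y; rewrite // inE yI ya mem_idealMl.
Qed.

End ChainRing.

(** * Hermitian geometry over a finite chain ring *)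

Lemma ideal_mulP (A : finComUnitRingType) m (I : {set A}) (v : 'rV[A]_m) :
  reflect (forall l, v ord0 l \in I) (v \in ideal_mul m I).
Proof. by rewrite inE; exact: forallP. Qed.

Lemma ideal_mul_setT (A : finComUnitRingType) m (v : 'rV[A]_m) :
  v \in ideal_mul m [set: A].
Proof. by apply/ideal_mulP=> l; rewrite inE. Qed.

Section IdealMul.

Variables (A : finComUnitRingType) (m : nat) (I : {set A}).
Hypothesis I_ideal : is_ideal I.
Local Notation V := 'rV[A]_m.

Lemma imul0 : (0 : V) \in ideal_mul m I.
Proof. by apply/ideal_mulP=> l; rewrite mxE mem_ideal0. Qed.

Lemma imulD (u v : V) :
  u \in ideal_mul m I -> v \in ideal_mul m I -> u + v \in ideal_mul m I.
Proof.
by move=> /ideal_mulP uI /ideal_mulP vI; apply/ideal_mulP=> l; rewrite mxE mem_idealD.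
Qed.

Lemma imulZ a (v : V) : v \in ideal_mul m I -> a *: v \in ideal_mul m I.
Proof.
by move=> /ideal_mulP vI; apply/ideal_mulP=> l; rewrite mxE mem_idealMl.
Qed.

Lemma imulZl a (v : V) : a \in I -> a *: v \in ideal_mul m I.
Proof. by move=> aI; apply/ideal_mulP=> l; rewrite mxE mem_idealMr. Qed.

Lemma imulN (v : V) : (- v \in ideal_mul m I) = (v \in ideal_mul m I).
Proof.
suff aux (w : V) : w \in ideal_mul m I -> - w \in ideal_mul m I.
  by apply/idP/idP=> /aux //; rewrite opprK.
by rewrite -scaleN1r; exact: imulZ.
Qed.

Lemma imulB (u v : V) :
  u \in ideal_mul m I -> v \in ideal_mul m I -> u - v \in ideal_mul m I.
Proof. by move=> uI vI; rewrite imulD ?imulN. Qed.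

End IdealMul.

(** The three skew hermitian cases and the hermitian case are treated at once
    through the sign [eps]; that every ideal is stable under the involution is
    used in the form that the conjugate of an element is a multiple of it. *)
Record hermitian_space (A : finComUnitRingType) (star : involutive_rmorphism A)
    (pi eps : A) (m : nat)
    (h : {bilinear 'rV[A]_m -> 'rV[A]_m -> A | (star \; *%R) & *%R}) : Prop :=
  HermitianSpace {
    herm_gen : generates_max_ideal pi;
    herm_unit2 : (2%:R : A) \is a GRing.unit;
    herm_star : forall x, exists u, star x = u * x;
    herm_eps : eps = 1 \/ eps = -1;
    herm_nondeg : nondegenerate_form h;
    herm_sym : forall u v, h v u = eps * star (h u v) }.

Section Hermitian.

Variables (A : finComUnitRingType) (star : involutive_rmorphism A) (pi eps : A).
Variables (m : nat).
Local Notation V := 'rV[A]_m.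
Variable h : {bilinear V -> V -> A | (star \; *%R) & *%R}.
Hypothesis hH : hermitian_space pi eps h.

Let unit2 := herm_unit2 hH.

Lemma starK : involutive star. Proof. exact: rmorphK. Qed.

Lemma eps2 : eps * eps = 1.
Proof. by case: (herm_eps hH) => ->; rewrite ?mulrNN mulr1. Qed.

Lemma star_eps : star eps = eps.
Proof. by case: (herm_eps hH) => ->; rewrite ?rmorphN rmorph1. Qed.

Lemma star_ideal (I : {set A}) : is_ideal I -> {in I, forall x, star x \in I}.
Proof.
by move=> I_ideal x xI; have [u ->] := herm_star hH x; rewrite mem_idealMl.
Qed.

Lemma half_add (x : A) : x / 2%:R + x / 2%:R = x.
Proof. by rewrite -mulrDl -mulr2n -[x *+ 2]mulr_natr mulrK. Qed.

Lemma hZl a u v : h (a *: u) v = star a * h u v.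
Proof. by rewrite linearZl_LR. Qed.

Lemma hZr a u v : h u (a *: v) = a * h u v.
Proof. by rewrite linearZr_LR. Qed.

Lemma h_sumr u v : h u v = \sum_l v ord0 l * h u (delta_mx ord0 l).
Proof.
by rewrite {1}[v]row_sum_delta linear_sumr; apply: eq_bigr => l _; rewrite hZr.
Qed.

Lemma h_self_sym u : star (h u u) = eps * h u u.
Proof. by rewrite [in RHS](herm_sym hH u u) mulrA eps2 mul1r. Qed.

(** Injectivity of [u |-> h u] suffices for duality, since [V] and its dual
    have the same finite cardinality. *)
Lemma h_dual (c : 'I_m -> A) : exists u, forall l, h u (delta_mx ord0 l) = c l.
Proof.
pose D (u : V) : V := \row_l h u (delta_mx ord0 l).
have D_inj : {in [set: V] &, injective D}.
  move=> u v _ _ /rowP Duv; apply/eqP; rewrite -subr_eq0; apply/eqP.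
  apply: (herm_nondeg hH).1 => w; rewrite h_sumr big1 // => l _.
  by have := Duv l; rewrite !mxE linearBl => ->; rewrite subrr mulr0.
have [u _ Du] :=
  finite_inj_onto (fun x _ => in_setT (D x)) D_inj (in_setT (\row_l c l)).
by exists u => l; have /rowP/(_ l) := Du; rewrite !mxE.
Qed.

Lemma h_coord (l : 'I_m) : exists u, forall v, h u v = v ord0 l.
Proof.
have [u ul] := h_dual (fun k => (k == l)%:R); exists u => v.
rewrite h_sumr (bigD1 l) //= ul eqxx mulr1 big1 ?addr0 // => k /negPf kl.
by rewrite ul kl mulr0.
Qed.

Lemma h_ideal_r (I : {set A}) u v :
  is_ideal I -> v \in ideal_mul m I -> h u v \in I.
Proof.
move=> I_ideal /ideal_mulP vI; rewrite h_sumr.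
elim/big_ind: _ => [|x y|l _]; first exact: mem_ideal0.
  exact: mem_idealD.
by rewrite mem_idealMr.
Qed.

Lemma h_ideal_l (I : {set A}) u v :
  is_ideal I -> u \in ideal_mul m I -> h u v \in I.
Proof.
move=> I_ideal uI; rewrite (herm_sym hH) mem_idealMl // star_ideal //.
exact: h_ideal_r.
Qed.

Lemma h_ideal2 (I J K : {set A}) (u v : V) :
  is_ideal I -> is_ideal K -> {in I & J, forall x y, x * y \in K} ->
  u \in ideal_mul m I -> v \in ideal_mul m J -> h u v \in K.
Proof.
move=> I_ideal K_ideal IJK uI /ideal_mulP vJ; rewrite h_sumr.
elim/big_ind: _ => [|x y|l _]; [exact: mem_ideal0|exact: mem_idealD|].
by rewrite mulrC IJK ?h_ideal_l.
Qed.

Lemma mem_ideal_mul_h (I : {set A}) v :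
  (forall u, h u v \in I) -> v \in ideal_mul m I.
Proof.
by move=> hI; apply/ideal_mulP=> l; have [u <-] := h_coord l; exact: hI.
Qed.

Lemma Uperp_ideal_mul (i : {set A}) : is_ideal i ->
  Uperp h i = ideal_mul m (annihilator i).
Proof.
move=> i_ideal; apply/setP=> v; rewrite inE.
apply/forall_inP/idP=> [vU|vj u uU].
  apply: mem_ideal_mul_h => u; apply/annihilatorP=> x xi.
  have xU : star x *: u \in ideal_mul m i by rewrite imulZl ?star_ideal.
  by rewrite mulrC; have /eqP := vU _ xU; rewrite hZl starK.
rewrite h_sumr big1 // => l _.
apply/annihilatorP: (h_ideal_l (delta_mx ord0 l) i_ideal uU).
exact: (ideal_mulP _ _ vj l).
Qed.

Lemma primitiveP (v : V) :
  reflect (exists l, v ord0 l \is a GRing.unit) (v \in primitive_vectors m pi).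
Proof.
apply: (iffP idP); rewrite inE.
  move=> nv; apply/existsP; apply: contraNT nv; rewrite negb_exists => /forallP nu.
  apply/ideal_mulP=> l; apply/imsetP.
  by have /(herm_gen hH)[b ->] := nu l; exists b.
case=> l ul; apply/negP=> /ideal_mulP/(_ l)/imsetP[a _ va].
have /negP : v ord0 l \isn't a GRing.unit by apply/(herm_gen hH); exists a.
by apply.
Qed.

Lemma primitive_dual_l (v : V) : v \in primitive_vectors m pi -> exists y, h y v = 1.
Proof.
case/primitiveP=> l ul; have [u uE] := h_coord l.
exists (star (v ord0 l)^-1 *: u); rewrite hZl uE starK mulVr //.
Qed.

Lemma primitive_dual_r (v : V) : v \in primitive_vectors m pi -> exists y, h v y = 1.
Proof.
case/primitive_dual_l=> y hy; exists (eps *: y).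
by rewrite hZr (herm_sym hH) hy rmorph1 mulr1 eps2.
Qed.

Lemma unit_pairing_primitive (u v : V) :
  h u v \is a GRing.unit -> v \in primitive_vectors m pi.
Proof.
rewrite inE; apply: contraL => vr.
have /imsetP[a _ ->] := h_ideal_r u (principal_ideal pi) vr.
by apply/(herm_gen hH); exists a.
Qed.

(** ** Transitivity on primitive vectors of given length *)

Lemma isometry_unitary (F : V -> V) :
  (forall a u v, F (a *: u + v) = a *: F u + F v) ->
  (forall u v, h (F u) (F v) = h u v) ->
  exists2 g : fperm V, g \in unitary h & g =1 F.
Proof.
move=> F_lin F_h.
have F_inj : injective F.
  move=> u v Fuv; apply/eqP; rewrite -subr_eq0; apply/eqP.
  apply: (herm_nondeg hH).1 => w; rewrite -F_h -scaleN1r addrC F_lin Fuv.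
  by rewrite scaleN1r addNr linear0l.
exists (perm F_inj : fperm V); last exact: permE.
by apply/unitaryP; split=> *; rewrite !permE.
Qed.

Definition quasi_refl (a : A) (w x : V) : V := x - (a * h w x) *: w.

Lemma quasi_refl_unitary a w :
  star a + eps * a = a * star a * h w w ->
  exists2 g : fperm V, g \in unitary h & g =1 quasi_refl a w.
Proof.
move=> aw; apply: isometry_unitary => [b u v|u v]; rewrite /quasi_refl.
  rewrite linearDr /= hZr scalerBr !scalerA mulrDr scalerDl opprD addrACA.
  by rewrite mulrCA.
rewrite linearBl !linearBr /= !hZl !hZr !rmorphM /= (herm_sym hH w u).
set x := star (h w u); set y := h w v.
transitivity (h u v - x * y * (star a + eps * a - a * star a * h w w)).
  by rewrite /x /y; ring.
by rewrite aw subrr mulr0 subr0.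
Qed.

(** For equal lengths and [w = u - v] one has [h w w = h w u + eps (h w u)^*],
    which makes the quasi-reflection of coefficient [(h w u)^-1] unitary. *)
Lemma quasi_refl_swap u v :
  h u u = h v v -> h (u - v) u \is a GRing.unit ->
  exists2 g : fperm V, g \in unitary h &
    g u = v /\ forall x, g x = x - ((h (u - v) u)^-1 * h (u - v) x) *: (u - v).
Proof.
move=> huv; set c := h (u - v) u => uc.
have cE : c + eps * star c = h (u - v) (u - v).
  rewrite /c !linearBr !linearBl /= rmorphB mulrBr.
  by rewrite -(herm_sym hH u u) -(herm_sym hH v u) -huv; ring.
have usc : star c \is a GRing.unit by rewrite rmorph_unit.
have [|g gU gE] := @quasi_refl_unitary c^-1 (u - v).
  rewrite -cE rmorphV //= mulrDr mulrAC mulVr // mul1r; congr (_ + _).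
  by rewrite [eps * star c]mulrC mulrA divrK // mulrC.
exists g => //; split; last exact: gE.
by rewrite gE /quasi_refl mulVr // scale1r opprB addrC subrK.
Qed.

(** The map [x |-> 2x + e x^2] is injective on the elements [x] of [k] such that
    [star x = s x], hence onto: a finite substitute for Hensel's lemma. *)
Lemma sign_symmetric_quadratic (k : {set A}) (s e y : A) :
  is_ideal k -> s * s = 1 -> {in k, forall x, e * x \isn't a GRing.unit} ->
  star e = s * e -> y \in k -> star y = s * y ->
  exists x, [/\ x \in k, star x = s * x & x + x + e * x ^+ 2 = y].
Proof.
move=> k_ideal ss ek se yk sy.
pose B := [set x in k | star x == s * x].
have BP x : reflect (x \in k /\ star x = s * x) (x \in B).
  by rewrite inE; apply: (iffP andP) => -[xk /eqP].
have [|||x /BP[xk sx] xy] := @finite_inj_onto A B (fun x => x + x + e * x ^+ 2) _ _ y.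
- move=> x /BP[xk sx]; apply/BP; split.
    by rewrite !mem_idealD // expr2 mulrA mem_idealMl.
  by rewrite !rmorphD rmorphM rmorphXn /= se sx; ring: ss.
- move=> x z /BP[xk _] /BP[zk _] /= /eqP; rewrite -subr_eq0.
  rewrite (_ : _ - _ = (2%:R + e * (x + z)) * (x - z)); last by ring.
  have u : 2%:R + e * (x + z) \is a GRing.unit.
    by rewrite (unitD_nonunit (herm_gen hH)) // ek // mem_idealD.
  move/eqP=> xz; apply/eqP; rewrite -subr_eq0; apply/eqP/(mulrI u).
  by rewrite xz mulr0.
- by apply/BP.
by exists x.
Qed.

Lemma common_dual (u v : V) :
  u \in primitive_vectors m pi -> v \in primitive_vectors m pi ->
  exists y, h y u \is a GRing.unit /\ h y v \is a GRing.unit.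
Proof.
move=> /primitive_dual_l[x hx] /primitive_dual_l[y hy].
have [xv|nxv] := boolP (h x v \is a GRing.unit).
  by exists x; rewrite hx unitr1.
have [yu|nyu] := boolP (h y u \is a GRing.unit).
  by exists y; rewrite hy unitr1.
exists (x + y); rewrite !linearDl hx hy; split.
  by rewrite (unitD_nonunit (herm_gen hH)) ?unitr1.
by rewrite addrC (unitD_nonunit (herm_gen hH)) ?unitr1.
Qed.

Lemma star_unit x : (star x \is a GRing.unit) = (x \is a GRing.unit).
Proof. by apply/idP/idP=> /(rmorph_unit star) //=; rewrite starK. Qed.

(** When [h (u - v) u] is not a unit, one passes through a third vector of the
    same length: [- u] if [h u u] is a unit, and otherwise a vector that pairs
    to a unit with both [u] and [v]. *)
Lemma same_length_link (u v : V) :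
  h u u = h v v -> u \in primitive_vectors m pi -> v \in primitive_vectors m pi ->
  h (u - v) u \isn't a GRing.unit ->
  exists w, [/\ h w w = h u u, h (u - w) u \is a GRing.unit &
                h (w - v) w \is a GRing.unit].
Proof.
move=> huv pu pv nuv; have gen := herm_gen hH.
have [uu|nu] := boolP (h u u \is a GRing.unit).
  have u2 : h u u + h u u \is a GRing.unit.
    by rewrite -mulr2n -mulr_natl unitrM unit2.
  exists (- u); split; first by rewrite linearNl linearNr opprK.
    by rewrite opprK linearDl.
  rewrite -opprD linearNl linearNr opprK linearDl.
  have -> : h u u + h v u = h u u + h u u - h (u - v) u by rewrite linearBl /=; ring.
  by rewrite (unitB_nonunit gen).
have nvu : h v u \isn't a GRing.unit.
  have -> : h v u = h u u - h (u - v) u by rewrite linearBl /=; ring.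
  by rewrite (nonunitD gen) ?nonunitN.
have nuv' : h u v \isn't a GRing.unit.
  by rewrite (herm_sym hH) nonunitMl // star_unit.
have [y [yu yv]] := common_dual pu pv; set c := h y u in yu.
have usc : star c \is a GRing.unit by rewrite star_unit.
(* with b = x / c, the length of y + b u is h y y + 2 x + e x^2 *)
pose e := eps * h u u / (c * star c).
have [|||||x [_ sx xE]] :=
  @sign_symmetric_quadratic [set: A] eps e (h u u - h y y) (setT_ideal A).
- exact: eps2.
- by move=> x _; rewrite /e !unitrM (negPf nu) andbF.
- rewrite /e rmorphM rmorphV ?unitrM ?yu //= !rmorphM /= starK star_eps h_self_sym.
  by rewrite [star c * c]mulrC mulrA.
- by rewrite inE.
- by rewrite rmorphB /= !h_self_sym mulrBr.
pose b := x / c; have bc : b * c = x by rewrite divrK.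
have wu : h (y + b *: u) (y + b *: u) = h u u.
  rewrite linearDl !linearDr /= !hZl !hZr (herm_sym hH y u) -/c.
  have huuE : h u u = h y y + (x + x + e * x ^+ 2) by rewrite xE addrC subrK.
  have sbE : star b = eps * x / star c by rewrite /b rmorphM rmorphV //= sx.
  have -> : star b * (eps * star c) = x.
    by rewrite sbE mulrCA divrK // mulrA eps2 mul1r.
  by rewrite [RHS]huuE bc sbE /e /b invrM //; ring.
exists (y + b *: u); split=> //.
  have -> : h (u - (y + b *: u)) u = h u u * (1 - star b) - c.
    by rewrite linearBl linearDl /= hZl -/c; ring.
  by rewrite -opprB unitrN (unitB_nonunit gen) // mulrC nonunitMl.
rewrite linearBl wu -opprB unitrN linearDr /= hZr.
rewrite -addrA (unitD_nonunit gen) ?(nonunitD gen) ?nonunitN ?nonunitMl //.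
rewrite (herm_sym hH) unitrM star_unit yv andbT.
by case: (herm_eps hH) => ->; rewrite ?unitrN unitr1.
Qed.

Lemma OmegaP (k : {set A}) (g : fperm V) :
  reflect (g \in unitary h /\ forall v, g v - v \in ideal_mul m k) (g \in Omega h k).
Proof.
by apply: (iffP setIdP) => -[gU /forallP gk].
Qed.

Lemma unitary_add (g : fperm V) u v : g \in unitary h -> g (u + v) = g u + g v.
Proof. by case/unitaryP=> lg _; have := lg 1 u v; rewrite !scale1r. Qed.

Lemma unitary_0 (g : fperm V) : g \in unitary h -> g 0 = 0.
Proof. by move=> gU; apply: (addrI (g 0)); rewrite -unitary_add // !addr0. Qed.

Lemma unitary_scale (g : fperm V) a u : g \in unitary h -> g (a *: u) = a *: g u.
Proof.
move=> gU; have /unitaryP[lg _] := gU.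
by have := lg a u 0; rewrite !addr0 unitary_0 // addr0.
Qed.

Lemma unitary_opp (g : fperm V) u : g \in unitary h -> g (- u) = - g u.
Proof. by move=> gU; rewrite -scaleN1r unitary_scale // scaleN1r. Qed.

Lemma unitary_sub (g : fperm V) u v : g \in unitary h -> g (u - v) = g u - g v.
Proof. by move=> gU; rewrite unitary_add // unitary_opp. Qed.

Lemma unitary_h (g : fperm V) u v : g \in unitary h -> h (g u) (g v) = h u v.
Proof. by case/unitaryP. Qed.

Lemma unitary_imul (g : fperm V) (k : {set A}) v :
  is_ideal k -> g \in unitary h -> (g v \in ideal_mul m k) = (v \in ideal_mul m k).
Proof.
move=> k_ideal gU.
have aux (x : fperm V) w : x \in unitary h ->
    w \in ideal_mul m k -> x w \in ideal_mul m k.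
  move=> xU wk; apply: mem_ideal_mul_h => u.
  rewrite -(unitary_h _ _ (groupVr xU)) -fpermM mulVg fperm1.
  exact: h_ideal_r.
apply/idP/idP; last exact: aux.
by move/(aux _ _ (groupVr gU)); rewrite -fpermM mulVg fperm1.
Qed.

(** The composite of the two reflections [u |-> w] and [w |-> v] is congruent
    to the identity modulo [k] because, modulo [k], the second one is the
    inverse of the first. *)
Lemma witt_transitive (k : {set A}) (u v : V) :
  is_ideal k -> u \in primitive_vectors m pi -> v \in primitive_vectors m pi ->
  h u u = h v v -> u - v \in ideal_mul m k ->
  exists2 g : fperm V, g \in Omega h k & g u = v.
Proof.
move=> k_ideal pu pv huv uvk.
have [uuv|nuv] := boolP (h (u - v) u \is a GRing.unit).
  have [g gU [guv _]] := quasi_refl_swap huv uuv; exists g => //.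
  apply/OmegaP; split=> // x; apply/ideal_mulP=> l.
  by rewrite -[_ ord0 l]mulr1 -(mulVr uuv) mulrA mem_idealMl ?h_ideal_l.
have [w [ww uw1 uw2]] := same_length_link huv pu pv nuv.
have uw3 : h (w - u) w \is a GRing.unit.
  have -> : h (w - u) w = eps * star (h (u - w) u).
    rewrite -(herm_sym hH) linearBl linearBr /= ww; ring.
  rewrite unitrM star_unit uw1 andbT.
  by case: (herm_eps hH) => ->; rewrite ?unitrN unitr1.
have [g1 g1U [g1u g1E]] := quasi_refl_swap (esym ww) uw1.
have [g2 g2U [g2w g2E]] := quasi_refl_swap (etrans ww huv) uw2.
have [g3 g3U [g3w g3E]] := quasi_refl_swap ww uw3.
have g31 x : g3 (g1 x) = x.
  rewrite g3E; set a3 := (h (w - u) w)^-1; rewrite -[w - u]opprB linearNl mulrN.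
  rewrite scalerN scaleNr opprK g1E; set a1 := (h (u - w) u)^-1.
  rewrite linearBr /= hZr -addrA -opprD -scalerDl.
  have -> : h (u - w) (u - w) = h (u - w) u + h (w - u) w.
    by rewrite linearBr /= -[w - u]opprB linearNl.
  set H := h (u - w) x.
  rewrite (_ : _ + _ = H * a1 * (1 - a3 * h (w - u) w) +
                       H * a3 * (1 - a1 * h (u - w) u)); last by ring.
  by rewrite /a1 /a3 !mulVr // subrr !mulr0 addr0 scale0r subr0.
exists (g2 * g1)%g; last by rewrite fpermM g1u.
apply/OmegaP; split=> [|x]; first by rewrite groupM.
rewrite fpermM -{2}[x]g31; move: (g1 x) => {}x; rewrite g2E g3E.
set a2 := (h (w - v) w)^-1; set a3 := (h (w - u) w)^-1.
have wvE : w - v = w - u + (u - v) by rewrite addrA subrK.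
have a23 : a2 - a3 \in k.
  have -> : a2 - a3 = a2 * a3 * - h (u - v) w.
    have -> : - h (u - v) w = h (w - u) w - h (w - v) w.
      by rewrite wvE [h (w - u + _) w]linearDl /=; ring.
    rewrite mulrBr [a2 * a3 * h (w - v) w]mulrAC /a2 /a3 mulVr // mul1r.
    by rewrite -mulrA mulVr // mulr1.
  by rewrite mem_idealMl // mem_idealN // h_ideal_l.
rewrite opprB addrC addrA addrNK.
have -> : (a3 * h (w - u) x) *: (w - u) - (a2 * h (w - v) x) *: (w - v) =
    - ((a2 - a3) * h (w - v) x) *: (w - v) - (a3 * h (u - v) x) *: (w - v)
    - (a3 * h (w - u) x) *: (u - v).
  rewrite [in LHS]wvE [in RHS]wvE !linearDl; move: (h (w - u) x) (h (u - v) x) => b c.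
  by apply/rowP=> l; rewrite !mxE; ring.
apply: imulB => //; last exact: imulZ.
apply: imulB => //; apply: imulZl => //.
  by rewrite mem_idealN // mem_idealMr.
by rewrite mem_idealMl // h_ideal_l.
Qed.

Lemma primitive_congr (k : {set A}) (u v : V) :
  is_ideal k -> 1 \notin k -> u - v \in ideal_mul m k ->
  u \in primitive_vectors m pi -> v \in primitive_vectors m pi.
Proof.
move=> k_ideal k1 /ideal_mulP uvk /primitiveP[l ul]; apply/primitiveP; exists l.
have -> : v ord0 l = u ord0 l - (u - v) ord0 l by rewrite !mxE; ring.
by rewrite (unitB_nonunit (herm_gen hH)) // (ideal_nonunit k_ideal k1).
Qed.

(** Congruent lengths can be made equal by moving one vector within its class
    modulo [k], which again is a quadratic equation. *)
Lemma length_congr (k : {set A}) (u v : V) :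
  is_ideal k -> 1 \notin k ->
  u \in primitive_vectors m pi -> v \in primitive_vectors m pi ->
  h u u - h v v \in k ->
  exists2 g : fperm V, g \in unitary h & g u - v \in ideal_mul m k.
Proof.
move=> k_ideal k1 pu pv uvk; have [y vy] := primitive_dual_r pv.
have yv : h y v = eps by rewrite (herm_sym hH) vy rmorph1 mulr1.
have [|||||x [xk sx xE]] :=
  @sign_symmetric_quadratic k eps (eps * h y y) (h u u - h v v) k_ideal.
- exact: eps2.
- by move=> x xk; rewrite nonunitMl // (ideal_nonunit k_ideal k1).
- by rewrite rmorphM /= star_eps h_self_sym mulrA.
- by [].
- by rewrite rmorphB /= !h_self_sym mulrBr.
have vx : v - (v + x *: y) \in ideal_mul m k.
  by rewrite opprD addrA subrr add0r imulN // imulZl.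
have pvx := primitive_congr k_ideal k1 vx pv.
have uvx : h u u = h (v + x *: y) (v + x *: y).
  rewrite linearDl !linearDr /= !hZl !hZr vy yv sx.
  rewrite -[LHS](subrK (h v v)) -xE; by ring: eps2.
have [g /OmegaP[gU _] guv] :=
  witt_transitive (setT_ideal A) pu pvx uvx (ideal_mul_setT _).
by exists g; rewrite // guv -(imulN k_ideal) opprB.
Qed.

End Hermitian.

(** * The character of [A] attached to the form *)

(** [lam \o d] is trivial on [x + eps x^*] and on no nonzero ideal; this is all
    that the arguments use of [d] and [lam]. *)
Record trace_character (A : finComUnitRingType) (star : involutive_rmorphism A)
    (eps : A) (C : fieldType) (d : {additive A -> symR star})
    (lam : symR star -> C) : Prop := TraceCharacter {
  trace_add : is_add_char lam;
  trace_sym : forall x, d (x + eps * star x) = 0;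
  trace_prim : forall x, (forall a, lam (d (a * x)) = 1) -> x = 0 }.

Section TraceCharacter.

Variables (A : finComUnitRingType) (star : involutive_rmorphism A) (pi eps : A).
Variables (m : nat).
Local Notation V := 'rV[A]_m.
Local Notation R := (symR star).
Variable h : {bilinear V -> V -> A | (star \; *%R) & *%R}.
Hypothesis hH : hermitian_space pi eps h.
Variables (C : fieldType) (d : {additive A -> R}) (lam : R -> C).
Hypothesis lamH : trace_character eps d lam.
Local Notation f := (alt_form h d).

Definition mu (x : A) : C := lam (d x).

Lemma lam0 : lam 0 = 1. Proof. by case: (trace_add lamH). Qed.
Lemma lamD r s : lam (r + s) = lam r * lam s.
Proof. by case: (trace_add lamH). Qed.
Lemma lam_neq0 r : lam r != 0.
Proof.
have := lamD r (- r); rewrite subrr lam0 => /esym E; apply/eqP=> r0.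
by move: E; rewrite r0 mul0r => /esym/eqP; rewrite oner_eq0.
Qed.
Lemma lamN r : lam (- r) = (lam r)^-1.
Proof. by apply: (mulfI (lam_neq0 r)); rewrite -lamD subrr lam0 divff ?lam_neq0. Qed.

Lemma muD x y : mu (x + y) = mu x * mu y.
Proof. by rewrite /mu raddfD lamD. Qed.
Lemma muN x : mu (- x) = (mu x)^-1.
Proof. by rewrite /mu raddfN lamN. Qed.
Lemma mu_neq0 x : mu x != 0. Proof. exact: lam_neq0. Qed.

Lemma mu_star x : mu (eps * star x) = (mu x)^-1.
Proof.
apply: (mulfI (mu_neq0 x)); rewrite -muD divff ?mu_neq0 //.
by rewrite /mu (trace_sym lamH) lam0.
Qed.

Lemma d_sym x : star x = eps * x -> d x = 0.
Proof.
move=> sx; rewrite -(trace_sym lamH (x / 2%:R)) rmorphM rmorphV ?(herm_unit2 hH) //=.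
by rewrite rmorph_nat sx !mulrA (eps2 hH) mul1r (half_add hH).
Qed.

Lemma mu_sym x : star x = eps * x -> mu x = 1.
Proof. by move=> sx; rewrite /mu d_sym // lam0. Qed.

Lemma lam_f u v : lam (f u v) = mu (h u v). Proof. by []. Qed.

Lemma f_self u : f u u = 0.
Proof. by apply: d_sym; rewrite (h_self_sym hH). Qed.

Lemma f_anti u v : f v u = - f u v.
Proof.
apply/eqP; rewrite -addr_eq0 addrC /alt_form -raddfD (herm_sym hH u v).
by rewrite (trace_sym lamH).
Qed.

Lemma annihilator_mu (I : {set A}) x :
  is_ideal I -> {in I, forall a, mu (a * x) = 1} -> x \in annihilator I.
Proof.
move=> I_ideal Ix; apply/annihilatorP=> a aI; apply: (trace_prim lamH) => b.
by have -> : b * (x * a) = b * a * x; [ring|apply: Ix; rewrite mem_idealMl].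
Qed.

(** [d] kills the [eps]-symmetric elements, so that an [eps]-symmetric element
    only has to be tested against the skew part of [I]. *)
Lemma annihilator_mu_skew (I : {set A}) x :
  is_ideal I -> star x = eps * x ->
  {in I, forall s, star s = - s -> mu (s * x) = 1} -> x \in annihilator I.
Proof.
move=> I_ideal sx Ix; apply: annihilator_mu => // a aI.
have u2 := herm_unit2 hH; have saI := star_ideal hH I_ideal aI.
pose b := a / 2%:R.
have sb : star b = star a / 2%:R by rewrite rmorphM rmorphV //= rmorph_nat.
have bI : b \in I by rewrite mem_idealMr.
have -> : a * x = (b - star b) * x + (b + star b) * x.
  by rewrite -(half_add hH a) -/b; ring.
rewrite muD Ix ?mem_idealB ?(star_ideal hH) ?mul1r ?mu_sym //.
  by rewrite rmorphM rmorphD /= (starK star) sx; ring.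
by rewrite rmorphB /= (starK star) opprB.
Qed.

(** The Cayley transform [(1 + s/2) / (1 - s/2)] produces norm-one elements with
    a prescribed skew first-order term. *)
Lemma cayley (k : {set A}) s :
  is_ideal k -> 1 \notin k -> s \in k -> star s = - s ->
  exists2 a : {unit A}, a \in norm_one_cong star k &
    exists c, \val a = 1 + s + c * s ^+ 2.
Proof.
move=> k_ideal k1 sk ss; have u2 := herm_unit2 hH; pose b := s / 2%:R.
have sb : star b = - b by rewrite rmorphM rmorphV //= rmorph_nat ss mulNr.
have sbb : s = b + b by rewrite (half_add hH).
have nb : b \isn't a GRing.unit by rewrite (ideal_nonunit k_ideal k1) // mem_idealMr.
have up : 1 + b \is a GRing.unit by rewrite (unitD_nonunit (herm_gen hH)) ?unitr1.
have um : 1 - b \is a GRing.unit by rewrite (unitB_nonunit (herm_gen hH)) ?unitr1.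
have ua : (1 + b) / (1 - b) \is a GRing.unit by rewrite unitrM up unitrV.
have aE : (1 + b) / (1 - b) = 1 + s / (1 - b).
  by apply: (mulIr um); rewrite /= divrK // mulrDl divrK // mul1r sbb; ring.
exists (FinRing.unit A ua); rewrite ?inE /=.
  apply/andP; split; last first.
    by rewrite aE addrC addKr mem_idealMr.
  rewrite rmorphM rmorphV //= rmorphD rmorphB rmorph1 /= sb opprK.
  by rewrite mulrA divrK // divrr.
exists (2%:R^-1 / (1 - b)); rewrite aE -addrA; congr (1 + _); apply: (mulIr um).
rewrite /= divrK // mulrDl [_ * s ^+ 2 * _]mulrAC divrK //.
by rewrite /b; ring.
Qed.

(** On a norm-one scalar [1 - s + ...] with [s] skew in [i] the character
    [alpha_v] takes the value [mu (s h v v)], and the Cayley transform provides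
    such a scalar for every [s]. *)
Lemma length_of_scalars (i : {set A}) (t v : V) :
  is_ideal i -> 1 \notin i -> {in i &, forall x y, x * y = 0} ->
  {in norm_one_cong star i, forall a,
     alpha h d lam v (scalar_aut m a) = alpha h d lam t (scalar_aut m a)} ->
  h v v - h t t \in annihilator i.
Proof.
move=> i_ideal i1 i2 vt; apply: annihilator_mu_skew => //.
  by rewrite rmorphB /= !(h_self_sym hH) mulrBr.
move=> s si ss; have sNi : - s \in i by rewrite mem_idealN.
have [|a aN [c ac]] := cayley i_ideal i1 sNi; first by rewrite rmorphN /= ss.
have aE : star (\val a) = 1 + s.
  rewrite ac expr2 (i2 _ _ sNi sNi) mulr0 addr0 rmorphD rmorphN /= rmorph1.
  by rewrite ss opprK.
have alE w : alpha h d lam w (scalar_aut m a) = mu (s * h w w).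
  rewrite /alpha permE lam_f (hZl h) aE mulrDl mul1r muD mu_sym ?mul1r //.
  exact: (h_self_sym hH).
by rewrite mulrBr muD muN -!alE vt // divff // alE mu_neq0.
Qed.

(** The rank-two elements [1 + a h(w',-) w - eps a^* h(w,-) w'] of [Omega i]
    determine [h w v] modulo [j] up to a norm-one scalar, because the value of
    [alpha_v] on them is [mu] of [2 a^* h(w',v)^* h(w,v)]. *)
Lemma alpha_determines (i : {set A}) (t v : V) :
  is_ideal i -> 1 \notin i -> 1 \notin annihilator i ->
  {in i &, forall x y, x * y = 0} ->
  t \in primitive_vectors m pi ->
  {in Omega h i, forall g, alpha h d lam v g = alpha h d lam t g} ->
  exists2 a : {unit A}, a \in norm_one star &
    v - \val a *: t \in ideal_mul m (annihilator i).
Proof.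
move=> i_ideal i1 j1 i2 pt vt; set j := annihilator i.
have j_ideal : is_ideal j by exact: annihilator_ideal.
have gen := herm_gen hH.
have j_nonunit := ideal_nonunit j_ideal j1.
have Q w w' : star (h w' v) * h w v - star (h w' t) * h w t \in j.
  apply: annihilator_mu => // a0 a0i.
  pose a := star (a0 / 2%:R).
  have ai : a \in i by rewrite (star_ideal hH) // mem_idealMr.
  have sai : star a \in i by rewrite (star_ideal hH).
  have a0E : a0 = star a + star a by rewrite /a (starK star) (half_add hH).
  pose X (u : V) := (a * h w' u) *: w - (eps * star a * h w u) *: w'.
  pose F (u : V) := u + X u.
  have xi u : X u \in ideal_mul m i.
    by apply: imulB => //; apply: imulZl => //; rewrite mem_idealMr // mem_idealMl.
  have [b u u'|u u'|g gU gF] := isometry_unitary hH (F := F).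
  - rewrite /F /X !linearDr /= !(hZr h) !mulrDr.
    by apply/rowP=> l; rewrite !mxE; ring.
  - have -> : h (F u) (F u') = h u u' + h u (X u') + h (X u) u' + h (X u) (X u').
      by rewrite /F linearDl !linearDr /= !addrA.
    have -> : h (X u) (X u') = 0.
      apply/set1P; apply: (h_ideal2 hH (I := i) (J := i)) => //.
        by split=> [|? x y /set1P-> /set1P->]; apply/set1P; rewrite // mulr0 addr0.
      by move=> x y xi' yi'; apply/set1P; exact: i2.
    rewrite /X !linearBl !linearBr /= !(hZl h) !(hZr h) !rmorphM /= (star_eps hH).
    rewrite (starK star) (herm_sym hH w u) (herm_sym hH w' u).
    by ring: (eps2 hH).
  have gO : g \in Omega h i.
    by apply/OmegaP; split=> // u; rewrite gF /F addrC addKr.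
  have alE u : alpha h d lam u g = mu (a0 * (star (h w' u) * h w u)).
    rewrite /alpha lam_f gF /F linearDl muD mu_sym ?mul1r ?(h_self_sym hH) //.
    rewrite /X linearBl /= !(hZl h) !rmorphM /= (star_eps hH) (starK star).
    set Y := star a * star (h w' u) * h w u.
    have -> : eps * a * star (h w u) * h w' u = eps * star Y.
      by rewrite /Y !rmorphM /= !(starK star); ring.
    rewrite muD muN mu_star invrK -muD a0E; congr mu; rewrite /Y; ring.
  by rewrite mulrBr muD muN -!alE vt // divff // alE mu_neq0.
have [y yt] := primitive_dual_l hH pt; set c := h y v.
have cw w : star c * h w v - h w t \in j.
  by have := Q w y; rewrite yt rmorph1 mul1r.
have cc : star c * c - 1 \in j by have := cw y; rewrite yt.
have ucc : star c * c \is a GRing.unit.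
  by rewrite -[_ * _](subrK 1) addrC (unitD_nonunit gen) ?unitr1 // j_nonunit.
have /andP[usc uc] : (star c \is a GRing.unit) && (c \is a GRing.unit).
  by rewrite -unitrM.
have vct : v - c *: t \in ideal_mul m j.
  apply: (mem_ideal_mul_h hH) => w; rewrite linearBr /= (hZr h).
  rewrite -(mulKr usc (_ - _)) mem_idealMl //.
  have -> : star c * (h w v - c * h w t) =
      star c * h w v - h w t - (star c * c - 1) * h w t by ring.
  by rewrite mem_idealB // mem_idealMr.
have [|||||x [xj sx xE]] :=
  @sign_symmetric_quadratic _ _ _ _ _ _ hH j 1 1 (star c * c - 1) j_ideal.
- exact: mulr1.
- by move=> x xj; rewrite mul1r j_nonunit.
- by rewrite rmorph1 mulr1.
- by [].
- by rewrite mul1r rmorphB rmorphM /= (starK star) rmorph1 mulrC.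
rewrite mul1r in sx.
have u1x : 1 + x \is a GRing.unit by rewrite (unitD_nonunit gen) ?unitr1 ?j_nonunit.
have ua : c / (1 + x) \is a GRing.unit by rewrite unitrM uc unitrV.
exists (FinRing.unit A ua).
  rewrite inE /= rmorphM rmorphV //= rmorphD rmorph1 /= sx; apply/eqP.
  apply: (mulIr u1x); apply: (mulIr u1x).
  have -> : c / (1 + x) * (star c / (1 + x)) * (1 + x) * (1 + x) =
      (c / (1 + x) * (1 + x)) * (star c / (1 + x) * (1 + x)) by ring.
  rewrite !divrK // mul1r mulrC -[LHS](subrK 1) -xE; ring.
have -> : v - (c / (1 + x)) *: t = (v - c *: t) + (x * (c / (1 + x))) *: t.
  rewrite -[in c *: t](divrK u1x c); apply/rowP=> l; rewrite !mxE.
  by move: (c / (1 + x)) => b; ring.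
by apply: imulD => //; apply: imulZl => //; rewrite mem_idealMr.
Qed.

(** By the Cayley transform the orthogonality of [v] to the displacements of [t]
    by norm-one scalars says that [h v t + h t v] lies in [i]. Then the length of
    [t + v] differs from that of [t] by an element of [i], which a correction of
    [v] in [iV] removes, and the Witt theorem applies. *)
Lemma displacement_exists (i : {set A}) (t v : V) :
  is_ideal i -> 1 \notin annihilator i ->
  {in i & annihilator i, forall x y, x * y = 0} -> i \subset annihilator i ->
  {in annihilator i &, forall x y, x * y \in i} ->
  t \in primitive_vectors m pi -> v \in ideal_mul m (annihilator i) ->
  {in norm_one_cong star (annihilator i), forall a,
     lam (f v (\val a *: t - t) + f v (\val a *: t - t)) = 1} ->
  exists2 g, g \in Omega h (annihilator i) & g t - t - v \in ideal_mul m i.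
Proof.
move=> i_ideal; set j := annihilator i => j1 ij sij jj pt vj vN.
have j_ideal : is_ideal j by exact: annihilator_ideal.
pose c := h v t; have cj : c \in j by apply: (h_ideal_l hH).
pose E := c + eps * star c.
have EE : star E = eps * E.
  by rewrite /E rmorphD rmorphM /= (starK star) (star_eps hH); ring: (eps2 hH).
have Ei : E \in i.
  apply: (subsetP (double_annihilator (herm_gen hH) i_ideal)).
  apply: annihilator_mu_skew => // s sj ss.
  have [a aN [b ab]] := cayley j_ideal j1 sj ss.
  have := vN a aN; rewrite lamD !lam_f.
  have -> : h v (\val a *: t - t) = s * c.
    have -> : \val a *: t - t = (s + b * s ^+ 2) *: t.
      by rewrite ab; apply/rowP=> l; rewrite !mxE; ring.
    rewrite (hZr h) -/c mulrDl expr2 -!mulrA [s * (s * c)]mulrA ij ?mulr0 ?addr0 //.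
    exact: jj.
  have sE : s * E = s * c + - (eps * star (s * c)).
    by rewrite /E rmorphM /= ss; ring.
  by rewrite sE muD muN mu_star invrK.
have [y ty] := primitive_dual_r hH pt.
pose E' := E + h v v.
have E'i : E' \in i by rewrite mem_idealD // (h_ideal2 hH (I := j) (J := j)).
have E'E : star E' = eps * E'.
  by rewrite /E' rmorphD /= EE (h_self_sym hH) -mulrDr.
pose x := - (E' / 2%:R).
have xi : x \in i by rewrite mem_idealN // mem_idealMr.
have sxE : star x = eps * x.
  rewrite /x rmorphN rmorphM rmorphV ?(herm_unit2 hH) //= rmorph_nat E'E.
  by rewrite mulrN mulrA.
have sxi : star x \in i by rewrite (star_ideal hH).
pose v' := v + x *: y.
have v'j : v' \in ideal_mul m j.
  by apply: imulD => //; apply: imulZl => //; rewrite (subsetP sij).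
have len : h t t = h (t + v') (t + v').
  rewrite /v' !linearDl /= !linearDr /= !(hZr h) !(hZl h).
  have -> : x * h v y = 0 by rewrite ij // (h_ideal_l hH).
  have -> : star x * h y v = 0 by rewrite ij // h_ideal_r.
  have -> : x * (star x * h y y) = 0.
    by rewrite mulrA [x * star x]ij ?mul0r // (subsetP sij).
  rewrite ty (herm_sym hH t y) ty rmorph1 (herm_sym hH v t) -/c.
  have xx : x + x = - (c + eps * star c + h v v).
    by rewrite /x -opprD (half_add hH).
  rewrite sxE -[LHS]addr0 -(subrr (x + x)) {2}xx; ring: (eps2 hH).
have tv'j : t - (t + v') \in ideal_mul m j.
  by rewrite opprD addrA subrr add0r imulN.
have [g gO gt] := witt_transitive hH j_ideal pt
  (primitive_congr hH j_ideal j1 tv'j pt) len tv'j.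
exists g => //; rewrite gt [t + v']addrC addrK /v' [v + _]addrC addrK.
exact: imulZl.
Qed.

Lemma norm_scalar_unitary (a : {unit A}) :
  a \in norm_one star -> (scalar_aut m a : fperm V) \in unitary h.
Proof.
rewrite inE => /eqP aN; apply/unitaryP; split=> [b u v|u v]; rewrite !permE.
  by rewrite scalerDr !scalerA mulrC.
by rewrite (hZl h) (hZr h) mulrA [star _ * _]mulrC aN mul1r.
Qed.

Lemma norm_scalar_comm (a : {unit A}) (g : fperm V) :
  g \in unitary h -> ((scalar_aut m a : fperm V) * g = g * scalar_aut m a)%g.
Proof.
by move=> gU; apply/permP=> v; rewrite !fpermM !permE -(unitary_scale _ _ gU).
Qed.

Lemma norm_scalar_Omega (k : {set A}) (a : {unit A}) :
  is_ideal k -> a \in norm_one_cong star k ->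
  (scalar_aut m a : fperm V) \in Omega h k.
Proof.
move=> k_ideal /setIdP[aN ak]; apply/OmegaP; split; first exact: norm_scalar_unitary.
by move=> v; rewrite permE -{2}[v]scale1r -scalerBl imulZl.
Qed.

End TraceCharacter.

(** * Finite group pairings and Schur's lemma *)

(** Both sides are the value of the double sum of [chi g k] over [G] and [K]: the
    inner sum over [G], or over [K], vanishes unless the character is trivial. *)
Lemma card_pairing_kernels (C : numFieldType) (gT kT : finGroupType)
    (G : {group gT}) (K : {group kT}) (chi : gT -> kT -> C) :
  {in G & G & K, forall g g' k, chi (g * g')%g k = chi g k * chi g' k} ->
  {in G & K & K, forall g k k', chi g (k * k')%g = chi g k * chi g k'} ->
  (#|G| * #|[set k in K | [forall g in G, chi g k == 1%R]]| =
   #|[set g in G | [forall k in K, chi g k == 1%R]]| * #|K|)%N.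
Proof.
move=> chiMl chiMr.
have sum_char (hT : finGroupType) (H : {group hT}) (c : hT -> C) :
    {in H &, forall x y, c (x * y)%g = c x * c y} ->
    \sum_(x in H) c x = (if [forall x in H, c x == 1] then #|H|%:R else 0).
  move=> cM; case: ifPn => [/forall_inP c1|].
    by rewrite -sum1_card natr_sum; apply: eq_bigr => x /c1/eqP.
  rewrite negb_forall_in => /exists_inP[y yH cy].
  have E : \sum_(x in H) c x = c y * \sum_(x in H) c x.
    rewrite big_distrr /= (reindex_inj (mulgI y)) /=.
    by apply: eq_big => [x|x xH]; rewrite ?groupMl // cM // -(groupMl _ yH).
  apply/eqP; have := congr1 (fun z => z - c y * \sum_(x in H) c x) E.
  rewrite subrr -{1}[\sum_(_ in _) _]mul1r -mulrBl => /eqP.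
  by rewrite mulf_eq0 subr_eq0 eq_sym (negPf cy).
apply/eqP; rewrite -(Num.Theory.eqr_nat C) !natrM; apply/eqP.
transitivity (\sum_(g in G) \sum_(k in K) chi g k).
  rewrite exchange_big /= (eq_bigr (fun k => if [forall g in G, chi g k == 1]
    then #|G|%:R else 0)) => [|k kK]; last first.
    by rewrite (sum_char _ G (chi^~ k)) // => g g' gG g'G; exact: chiMl.
  rewrite -big_mkcondr /= sumr_const -[RHS]mulr_natr; congr (_ * _%:R).
  by apply: eq_card => k; rewrite !inE.
rewrite (eq_bigr (fun g => if [forall k in K, chi g k == 1]
  then #|K|%:R else 0)) => [|g gG]; last first.
  by rewrite (sum_char _ K (chi g)) // => k k' kK k'K; exact: chiMr.
rewrite -big_mkcondr /= sumr_const -[LHS]mulr_natr mulrC;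
  congr (_%:R * _).
by apply: eq_card => g; rewrite !inE.
Qed.

Section Schur.

Variables (C : numClosedFieldType) (E : vectType C).

Lemma eigenvector_exists (T : 'End(E)) : (fullv : {vspace E}) <> 0%VS ->
  exists a v, v != 0 /\ T v = a *: v.
Proof.
move=> E0; pose n := \dim (fullv : {vspace E}).
have n0 : (n > 0)%N by rewrite lt0n dimv_eq0; apply/eqP.
have eb := vbasisP (fullv : {vspace E}).
have [a /eigenvalueP[v vA v0]] :=
  eigenvalue_closed (passmx.mxof (vbasis fullv) (vbasis fullv) T) n0.
exists a, (passmx.vecof (vbasis fullv) v); split.
  by rewrite (passmx.vecof_eq0 eb).
rewrite (passmx.hom_vecof (vbasis fullv) eb) vA /passmx.vecof.
by rewrite scaler_sumr; apply: eq_bigr => k _; rewrite mxE scalerA.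
Qed.

Lemma schur_scalar (gT : finGroupType) (G : {set gT}) (rho : gT -> 'End(E))
    (T : 'End(E)) :
  is_irreducible G fullv rho ->
  {in G, forall g v, T (rho g v) = rho g (T v)} ->
  exists c, forall v, T v = c *: v.
Proof.
move=> [_ E0 irr] Trho; have [a [v [v0 Tv]]] := eigenvector_exists T E0.
exists a => w; have mem u : (u \in leigen T a) = (T u == a *: u).
  by rewrite memv_ker !lfun_simp subr_eq0.
have [g gG|W0|W1] := irr (leigen T a) (subvf _).
- apply/subvP=> _ /memv_imgP[u uT ->]; move: uT; rewrite !mem => /eqP Tu.
  by rewrite Trho // Tu linearZ.
- by have := mem v; rewrite W0 memv0 Tv eqxx (negPf v0).
- by apply/eqP; rewrite -mem W1 memvf.
Qed.

End Schur.

(** * The Heisenberg and Weil representations on [Z] *)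

Record weil_setting (A : finComUnitRingType) (star : involutive_rmorphism A)
    (pi eps : A) (m : nat)
    (h : {bilinear 'rV[A]_m -> 'rV[A]_m -> A | (star \; *%R) & *%R})
    (d : {additive A -> symR star}) (i : {set A}) (C : fieldType)
    (lam : symR star -> C) (Z : vectType C) (S' : heis h d -> 'End(Z))
    (W' : fperm 'rV[A]_m -> 'End(Z)) : Prop := WeilSetting {
  weil_herm : hermitian_space pi eps h;
  weil_char : trace_character eps d lam;
  weil_ideal : is_ideal i;
  weil_neq0 : i <> [set 0];
  weil_sqr0 : {in i &, forall x y, x * y = 0};
  weil_annsqr : {in annihilator i &, forall x y, x * y \in i};
  weil_schrodinger : is_schrodinger i lam S';
  weil_weil : is_weil i S' W' }.

Section Weil.

Variables (A : finComUnitRingType) (star : involutive_rmorphism A) (pi eps : A).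
Variables (m : nat).
Local Notation V := 'rV[A]_m.
Local Notation R := (symR star).
Variable h : {bilinear V -> V -> A | (star \; *%R) & *%R}.
Variables (d : {additive A -> R}) (i : {set A}) (C : numClosedFieldType).
Variables (lam : R -> C) (Z : vectType C).
Variables (S' : heis h d -> 'End(Z)) (W' : fperm V -> 'End(Z)).
Hypothesis wH : weil_setting pi eps i lam S' W'.

Local Notation f := (alt_form h d).
Local Notation H := (heis h d).
Local Notation j := (annihilator i).
Local Notation HU := (heis_of h d (Uperp h i)).
Local Notation N_ := (norm_one_cong star).

Let hH := weil_herm wH.
Let lamH := weil_char wH.
Let i_ideal := weil_ideal wH.

Lemma j_ideal : is_ideal j. Proof. exact: annihilator_ideal. Qed.

Local Hint Resolve j_ideal : core.

Lemma ij0 : {in i & j, forall x y, x * y = 0}.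
Proof. by move=> x y xi /annihilatorP yj; rewrite mulrC yj. Qed.

Lemma sub_ij : i \subset j.
Proof.
by apply/subsetP=> x xi; apply/annihilatorP=> y yi; exact: (weil_sqr0 wH).
Qed.

Lemma one_notin_j : 1 \notin j.
Proof.
apply/negP=> /annihilatorP j1; apply: (weil_neq0 wH); apply/setP=> x.
rewrite in_set1; apply/idP/eqP => [/j1|->]; last exact: mem_ideal0.
by rewrite mul1r.
Qed.

Lemma one_notin_i : 1 \notin i.
Proof. by apply: contra one_notin_j; apply: (subsetP sub_ij). Qed.

Lemma UperpE : Uperp h i = ideal_mul m j.
Proof. exact: (Uperp_ideal_mul hH). Qed.

Lemma sub_ijV : ideal_mul m i \subset ideal_mul m j.
Proof.
by apply/subsetP=> v /ideal_mulP vi; apply/ideal_mulP=> l; rewrite (subsetP sub_ij).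
Qed.

Lemma h_ij u v : u \in ideal_mul m i -> v \in ideal_mul m j -> h u v = 0.
Proof.
move=> ui vj; apply/set1P; apply: (h_ideal2 hH (I := i) (J := j)) => //.
  by split=> [|? x y /set1P-> /set1P->]; apply/set1P; rewrite // mulr0 addr0.
by move=> x y xi yj; apply/set1P; exact: ij0.
Qed.

Lemma f_ij u v : u \in ideal_mul m i -> v \in ideal_mul m j -> f u v = 0.
Proof. by move=> ui vj; rewrite /alt_form h_ij // raddf0. Qed.

Lemma f_ji u v : u \in ideal_mul m j -> v \in ideal_mul m i -> f u v = 0.
Proof. by move=> uj vi; rewrite (f_anti hH lamH) f_ij ?oppr0. Qed.

Lemma unitary_f g u v : g \in unitary h -> f (g u) (g v) = f u v.
Proof. by move=> gU; rewrite /alt_form (unitary_h _ _ gU). Qed.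

(** ** The Heisenberg group *)

Lemma heisM (r s : R) (u v : V) :
  (((r, u) : H) * ((s, v) : H))%g = (r + s + f u v, u + v).
Proof. by []. Qed.

Lemma mem_HU (k : H) : (k \in HU) = (k.2 \in ideal_mul m j).
Proof. by rewrite inE UperpE. Qed.

Lemma HU_group_set : group_set HU.
Proof.
apply/group_setP; split; first by rewrite mem_HU imul0.
by move=> x y; rewrite !mem_HU; apply: imulD; exact: j_ideal.
Qed.

Definition HU_group := Group HU_group_set.

Lemma S'_irreducible : is_irreducible HU fullv S'.
Proof. by case: (weil_schrodinger wH). Qed.

Lemma S'1 z : S' 1%g z = z.
Proof. by have [[_ S1 _] _ _] := S'_irreducible; rewrite S1 ?memvf. Qed.

Lemma S'M k l z : k \in HU -> l \in HU -> S' (k * l)%g z = S' k (S' l z).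
Proof. by have [[_ _ SM] _ _] := S'_irreducible => kH lH; rewrite SM ?memvf. Qed.

Lemma S'_scal r u z : u \in ideal_mul m i -> S' (r, u) z = lam r *: z.
Proof.
by have [_ SU] := weil_schrodinger wH => ui; rewrite SU // !lfun_simp.
Qed.

Lemma S'K k z : k \in HU -> S' k^-1%g (S' k z) = z.
Proof.
move=> kH; have kVH : k^-1%g \in HU by rewrite (groupV HU_group).
by rewrite -S'M // mulVg S'1.
Qed.

Lemma S'VK k z : k \in HU -> S' k (S' k^-1%g z) = z.
Proof.
move=> kH; have kVH : k^-1%g \in HU by rewrite (groupV HU_group).
by rewrite -S'M // mulgV S'1.
Qed.

Lemma S'_eq0 k z : k \in HU -> (S' k z == 0) = (z == 0).
Proof.
move=> kH; apply/eqP/eqP=> [Sz|->]; last by rewrite linear0.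
by rewrite -(S'K z kH) Sz linear0.
Qed.

Lemma S'_pair r v z : v \in ideal_mul m j -> S' (r, v) z = lam r *: S' (0, v) z.
Proof.
move=> vj; have -> : ((r, v) : H) = (((r, 0) : H) * ((0, v) : H))%g.
  by rewrite heisM (alt_form0l h d) !addr0 add0r.
by rewrite S'M ?mem_HU /= ?imul0 // S'_scal ?imul0.
Qed.

Lemma S'_comm r s u v z : u \in ideal_mul m j -> v \in ideal_mul m j ->
  S' (r, u) (S' (s, v) z) = lam (f u v + f u v) *: S' (s, v) (S' (r, u) z).
Proof.
move=> uj vj; have [uH vH] : (r, u) \in HU /\ (s, v) \in HU by rewrite !mem_HU.
rewrite -!S'M // !heisM !(S'_pair (_ + _)) ?imulD //; try exact: j_ideal.
rewrite [v + u]addrC scalerA -(lamD lamH); congr (lam _ *: _).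
by rewrite (f_anti hH lamH u v); ring.
Qed.

(** ** The unitary group acting through its restriction to [jV] *)

Definition res_jV (g : fperm V) : fperm V := restr_perm (Uperp h i) g.

Lemma res_jVE g v : g \in unitary h -> v \in ideal_mul m j -> res_jV g v = g v.
Proof.
move=> gU vj; rewrite /res_jV restr_permE ?UperpE //.
by apply/astabsP=> x /=; rewrite apermE (unitary_imul hH).
Qed.

Lemma res_jV_out g v : v \notin ideal_mul m j -> res_jV g v = v.
Proof. by move=> vj; rewrite (out_perm (restr_perm_on _ _)) // UperpE. Qed.

Lemma res_jVM g k : g \in unitary h -> k \in unitary h ->
  res_jV (g * k)%g = (res_jV g * res_jV k)%g.
Proof.
move=> gU kU; apply/permP=> v; rewrite fpermM.
have [vj|nvj] := boolP (v \in ideal_mul m j); last by rewrite !res_jV_out.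
rewrite !res_jVE ?groupM ?fpermM // (unitary_imul hH) //; exact: j_ideal.
Qed.

Lemma res_jVV g : g \in unitary h -> (res_jV g)^-1%g = res_jV g^-1%g.
Proof.
move=> gU; apply: (mulgI (res_jV g)); rewrite mulgV -res_jVM ?groupV // mulgV.
apply/permP=> v; rewrite fperm1.
have [vj|nvj] := boolP (v \in ideal_mul m j); last by rewrite res_jV_out.
by rewrite res_jVE ?group1 ?fperm1.
Qed.

Lemma res_jV_Sp g : g \in unitary h -> res_jV g \in Sp_of h d (Uperp h i).
Proof.
move=> gU; rewrite inE restr_perm_on UperpE /=; apply/andP; split.
  apply/forallP=> r; apply/forall_inP=> u uj; apply/forall_inP=> v vj.
  rewrite !res_jVE ?(unitary_add _ _ gU) ?(unitary_scale _ _ gU) //.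
  by rewrite imulD ?imulZ //; exact: j_ideal.
apply/forall_inP=> u uj; apply/forall_inP=> v vj.
by rewrite !res_jVE // /alt_form (unitary_h _ _ gU).
Qed.

Definition Wr (g : fperm V) : 'End(Z) := W' (res_jV g).

Lemma Wr1 z : Wr 1%g z = z.
Proof.
have -> : Wr 1%g = W' 1%g.
  rewrite /Wr; congr W'; apply/permP=> v.
  have [vj|nvj] := boolP (v \in ideal_mul m j); last by rewrite res_jV_out ?fperm1.
  by rewrite res_jVE ?group1.
by have [[_ W1 _] _] := weil_weil wH; rewrite W1 ?memvf.
Qed.

Lemma WrM g k z : g \in unitary h -> k \in unitary h ->
  Wr (g * k)%g z = Wr g (Wr k z).
Proof.
move=> gU kU; have [[_ _ WM] _] := weil_weil wH.
by rewrite /Wr res_jVM // WM ?res_jV_Sp ?memvf.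
Qed.

Lemma Wr_S' g k z : g \in unitary h -> k \in HU ->
  Wr g (S' k z) = S' (heis_act g k) (Wr g z).
Proof.
move=> gU kH; have [_ WS] := weil_weil wH.
have -> : S' (heis_act g k) = S' (heis_act (res_jV g) k).
  by rewrite /heis_act res_jVE // -mem_HU.
rewrite -(WS _ _ (res_jV_Sp gU) kH) !lfun_simp res_jVV //.
rewrite -/(Wr g^-1%g) -/(Wr g) -(WrM _ (groupVr gU)) // mulVg Wr1.
by [].
Qed.

Lemma Omega_unitary (k : {set A}) g : g \in Omega h k -> g \in unitary h.
Proof. by case/OmegaP. Qed.

Lemma Omega_imul (I K L : {set A}) g v :
  is_ideal K -> is_ideal L -> {in I & K, forall x y, x * y \in L} ->
  g \in Omega h K -> v \in ideal_mul m I -> g v - v \in ideal_mul m L.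
Proof.
move=> K_ideal L_ideal IKL /OmegaP[gU gK] /ideal_mulP vI.
have -> : g v - v = \sum_l v ord0 l *: (g (delta_mx ord0 l) - delta_mx ord0 l).
  rewrite {1 2}[v]row_sum_delta.
  rewrite (big_morph g (fun x y => unitary_add x y gU) (unitary_0 gU)) -sumrB.
  by apply: eq_bigr => l _; rewrite (unitary_scale _ _ gU) scalerBr.
elim/big_ind: _ => [|x y|l _]; [exact: imul0|exact: imulD|].
have /ideal_mulP glK := gK (delta_mx ord0 l).
by apply/ideal_mulP=> l'; rewrite mxE IKL.
Qed.

(** For [g] in [Omega j] the restriction of [g] to [jV] moves vectors only
    within [iV], so [Wr g] commutes with the Heisenberg group. *)
Lemma Wr_Omega_scalar g : g \in Omega h j ->
  exists2 c, c != 0 & forall z, Wr g z = c *: z.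
Proof.
move=> gO; have gU := Omega_unitary gO.
have [k kH z|c cE] := schur_scalar (T := Wr g) S'_irreducible.
  rewrite Wr_S' //; case: k kH => r v; rewrite mem_HU /heis_act /= => vj.
  have gvi : g v - v \in ideal_mul m i.
    by apply: (Omega_imul _ _ (weil_annsqr wH)).
  have -> : ((r, g v) : H) = (((r, v) : H) * ((0, g v - v) : H))%g.
    by rewrite heisM f_ji // !addr0 [v + _]addrC subrK.
  rewrite S'M ?mem_HU //= ?(subsetP sub_ijV) //.
  by rewrite (S'_scal 0) // (lam0 lamH) scale1r.
exists c => //; apply/eqP=> c0.
have [_ Z0 _] := S'_irreducible; apply: Z0; apply/eqP; rewrite -subv0.
apply/subvP=> z _; rewrite memv0 -(Wr1 z) -(mulVg g) WrM ?groupV //.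
by rewrite cE c0 scale0r linear0.
Qed.

Lemma Wr_Omega_i g z : g \in Omega h i -> Wr g z = z.
Proof.
move=> gO; rewrite -[RHS]Wr1; congr (W' _ _); apply/permP=> v.
have [vj|nvj] := boolP (v \in ideal_mul m j); last by rewrite !res_jV_out.
rewrite !res_jVE ?group1 ?(Omega_unitary gO) // fperm1.
apply/eqP; rewrite -subr_eq0; apply/eqP/rowP=> l; rewrite [RHS]mxE.
have z_ideal : is_ideal [set (0 : A)].
  by split=> [|? x y /set1P-> /set1P->]; apply/set1P; rewrite // mulr0 addr0.
have ji0 : {in j & i, forall x y, x * y \in [set 0]}.
  by move=> x y xj yi; apply/set1P; rewrite mulrC ij0.
by have /ideal_mulP/(_ l)/set1P := Omega_imul i_ideal z_ideal ji0 gO vj.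
Qed.

(** ** The representation [W_t] of [G_t] *)

Section Point.

Variable t : V.
Local Notation Gt := (G_t h i t).
Local Notation Wt := (W_t i S' W' t).

Lemma WtE g z : Wt g z = S' (f (g t) t, g t - t) (Wr g z).
Proof. by rewrite /W_t !lfun_simp. Qed.

Lemma GtP g : reflect (g \in unitary h /\ g t - t \in ideal_mul m j) (g \in Gt).
Proof. by rewrite -UperpE; exact: setIdP. Qed.

Lemma Gt_group_set : group_set Gt.
Proof.
apply/group_setP; split; first by apply/GtP; rewrite group1 fperm1 subrr imul0.
move=> x y /GtP[xU xt] /GtP[yU yt]; apply/GtP; rewrite groupM // fpermM; split=> //.
rewrite -(subrK (x t) (x (y t))) -(unitary_sub _ _ xU) -addrA imulD //.
by rewrite (unitary_imul hH).
Qed.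

Definition Gt_group := Group Gt_group_set.

Lemma Omega_Gt : Omega h j \subset Gt.
Proof. by apply/subsetP=> g /OmegaP[gU gj]; apply/GtP. Qed.

Lemma Omega_ij : Omega h i \subset Omega h j.
Proof.
apply/subsetP=> g /OmegaP[gU gi]; apply/OmegaP; split=> // v.
exact: (subsetP sub_ijV).
Qed.

Lemma Wt1 z : Wt 1%g z = z.
Proof.
rewrite WtE Wr1 fperm1 subrr S'_scal ?imul0 // (f_self hH lamH) (lam0 lamH).
by rewrite scale1r.
Qed.

Lemma WtM g k z : g \in Gt -> k \in Gt -> Wt (g * k)%g z = Wt g (Wt k z).
Proof.
move=> /GtP[gU gt] /GtP[kU kt]; rewrite !WtE WrM // Wr_S' ?mem_HU //.
rewrite -S'M ?mem_HU ?(unitary_imul hH) //= fpermM; congr (S' _ _).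
rewrite /heis_act /= (unitary_sub _ _ gU) heisM; congr (_, _).
  rewrite (alt_formDl h d) !(alt_formDr h d) !(alt_formNl h d).
  have fN u v : f u (- v) = - f u v by rewrite /alt_form linearNr raddfN.
  rewrite !fN /= (f_anti hH lamH (g (k t)) t) (f_anti hH lamH (g t) t).
  rewrite (f_self hH lamH) (unitary_f _ _ gU).
  by rewrite (f_anti hH lamH (k t) t); ring.
by rewrite [RHS]addrC addrA subrK.
Qed.

Lemma Wt_Omega_i g z : g \in Omega h i -> Wt g z = alpha h d lam t g *: z.
Proof.
by move=> gO; rewrite WtE Wr_Omega_i // S'_scal //; case/OmegaP: gO.
Qed.

(** The Weil factor of [W_t] is a scalar on [Omega j], which leaves the
    Heisenberg factor. *)
Lemma Wt_Omega g : g \in Omega h j ->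
  exists2 c, c != 0 & forall z, Wt g z = c *: S' (0, g t - t) z.
Proof.
move=> gO; have [c c0 cE] := Wr_Omega_scalar gO.
have /OmegaP[_ gj] := gO.
exists (c * lam (f (g t) t)); first by rewrite mulf_neq0 // (lam_neq0 lamH).
by move=> z; rewrite WtE cE linearZ /= S'_pair // scalerA.
Qed.

End Point.

End Weil.

(** * Clifford theory on [Z] *)

Lemma lfun_exists (F : fieldType) (E1 E2 : vectType F) (phi : E1 -> E2) :
  linear phi -> exists T : 'Hom(E1, E2), forall v, T v = phi v.
Proof.
move=> lin_phi; pose L := GRing.isLinear.Build _ _ _ _ phi lin_phi.
pose T : {linear E1 -> E2} := HB.pack phi L.
by exists (linfun T) => v; rewrite lfunE.
Qed.

Section NormGroups.

Variables (A : finComUnitRingType) (star : involutive_rmorphism A) (m : nat).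
Local Notation N_ := (norm_one_cong star).

Lemma scalar_autM (a b : {unit A}) :
  scalar_aut m (a * b)%g = (scalar_aut m a * scalar_aut m b)%g.
Proof. by apply/permP=> v; rewrite fpermM !permE scalerA. Qed.

Lemma scalar_aut1 : scalar_aut m (1%g : {unit A}) = 1%g.
Proof. by apply/permP=> v; rewrite fperm1 permE scale1r. Qed.

Lemma norm_one_group_set : group_set (norm_one star).
Proof.
apply/group_setP; split; first by rewrite inE /= rmorph1 mulr1.
move=> a b; rewrite !inE /= => /eqP aN /eqP bN; rewrite rmorphM /=.
by rewrite mulrACA aN bN mulr1.
Qed.

Definition norm_one_group := Group norm_one_group_set.

Lemma norm_one_cong_group_set (k : {set A}) : is_ideal k -> group_set (N_ k).
Proof.
move=> k_ideal; apply/group_setP; split.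
  by rewrite inE (group1 norm_one_group) subrr mem_ideal0.
move=> a b /setIdP[aN ak] /setIdP[bN bk].
rewrite inE (groupM (G := norm_one_group)) //=.
have -> : val a * val b - 1 = val a * (val b - 1) + (val a - 1) by ring.
by rewrite mem_idealD ?mem_idealMl.
Qed.

End NormGroups.

Section Clifford.

Variables (A : finComUnitRingType) (star : involutive_rmorphism A) (pi eps : A).
Variables (m : nat).
Local Notation V := 'rV[A]_m.
Local Notation R := (symR star).
Variable h : {bilinear V -> V -> A | (star \; *%R) & *%R}.
Variables (d : {additive A -> R}) (i : {set A}) (C : numClosedFieldType).
Variables (lam : R -> C) (Z : vectType C).
Variables (S' : heis h d -> 'End(Z)) (W' : fperm V -> 'End(Z)).
Hypothesis wH : weil_setting pi eps i lam S' W'.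

Local Notation f := (alt_form h d).
Local Notation H := (heis h d).
Local Notation j := (annihilator i).
Local Notation HU := (heis_of h d (Uperp h i)).
Local Notation N_ := (norm_one_cong star).
Local Notation iV := (ideal_mul m i).
Local Notation jV := (ideal_mul m j).

Let hH := weil_herm wH.
Let lamH := weil_char wH.
Let i_ideal := weil_ideal wH.
Let j_ideal : is_ideal j := j_ideal i.

Variables (t : V) (phi : {unit A} -> C).
Hypothesis t_prim : t \in primitive_vectors m pi.
Hypothesis phi_char : is_lin_char (norm_one star) phi.

Local Notation Gt := (G_t h i t).
Local Notation Wt := (W_t i S' W' t).
Local Notation Zt := (Z_t i S' W' t phi).
Local Notation Ht := (H_t h d i t).

Lemma phi1 : phi 1%g = 1. Proof. by case: phi_char. Qed.
Lemma phiM : {in norm_one star &, forall a b, phi (a * b)%g = phi a * phi b}.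
Proof. by case: phi_char. Qed.
Lemma phi_neq0 a : a \in norm_one star -> phi a != 0.
Proof.
move=> aN; have aVN : a^-1%g \in norm_one star.
  by rewrite (groupV (norm_one_group star)).
have := phiM aN aVN; rewrite mulgV phi1 => /esym/eqP.
by apply: contraTneq => ->; rewrite mul0r eq_sym oner_eq0.
Qed.

Definition Nj_group := Group (norm_one_cong_group_set star j_ideal).
Definition Ni_group := Group (norm_one_cong_group_set star i_ideal).

Definition disp (a : {unit A}) : V := \val a *: t - t.

Lemma disp_jV a : a \in N_ j -> disp a \in jV.
Proof.
by move=> /setIdP[_ aj]; rewrite /disp -{2}[t]scale1r -scalerBl imulZl.
Qed.

Lemma scalar_Omega_j a : a \in N_ j -> (scalar_aut m a : fperm V) \in Omega h j.
Proof. by move=> aN; apply: norm_scalar_Omega. Qed.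

Definition scalar_Wt (a : {unit A}) : 'End(Z) := Wt (scalar_aut m a).

Lemma scalar_Wt_disp a : a \in N_ j ->
  exists2 c, c != 0 & forall z, scalar_Wt a z = c *: S' (0, disp a) z.
Proof.
move=> aN; have [c c0 cE] := Wt_Omega wH t (scalar_Omega_j aN).
by exists c => // z; rewrite /scalar_Wt cE permE.
Qed.

Lemma scalar_WtM a b z : a \in N_ j -> b \in N_ j ->
  scalar_Wt (a * b)%g z = scalar_Wt a (scalar_Wt b z).
Proof.
move=> aN bN; rewrite /scalar_Wt scalar_autM (WtM wH) //;
  by rewrite (subsetP (Omega_Gt wH t)) // scalar_Omega_j.
Qed.

Lemma ZtP z :
  reflect {in N_ j, forall a, scalar_Wt a z = phi a *: z} (z \in Zt).
Proof.
have E a : (z \in leigen (scalar_Wt a) (phi a)) = (scalar_Wt a z == phi a *: z).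
  by rewrite memv_ker add_lfunE opp_lfunE scale_lfunE id_lfunE subr_eq0.
apply: (iffP idP) => [/subv_bigcapP zZ a aN|zZ].
  by apply/eqP; rewrite -E memvE zZ.
by apply/subv_bigcapP=> a aN; rewrite -memvE E zZ.
Qed.

(** ** The displacement group of [t] *)

(** The commutator of the Heisenberg elements [(0, v)] and [(0, disp a)]. *)
Definition disp_pairing (v : V) (a : {unit A}) : C :=
  lam (f v (disp a) + f v (disp a)).

(** This is [iV] plus the displacements of [t] by [Omega j]; the description by
    orthogonality gives the index in [jV]. *)
Definition disp_perp : {set V} :=
  [set v in jV | [forall a in N_ j, disp_pairing v a == 1]].

Lemma disp_pairingDl u v a :
  disp_pairing (u + v) a = disp_pairing u a * disp_pairing v a.
Proof. by rewrite /disp_pairing (alt_formDl h d) -(lamD lamH); congr lam; ring. Qed.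

Lemma disp_pairingMr v a b : v \in jV -> a \in N_ j -> b \in N_ j ->
  disp_pairing v (a * b)%g = disp_pairing v a * disp_pairing v b.
Proof.
move=> vj aN bN; have /setIdP[_ aj] := aN; have /setIdP[_ bj] := bN.
have fE : f v (disp (a * b)%g) = f v (disp a) + f v (disp b).
  have -> : disp (a * b)%g =
      disp a + disp b + ((\val a - 1) * (\val b - 1)) *: t.
    by apply/rowP=> l; rewrite !mxE /=; ring.
  move: (disp a) (disp b) => x y.
  rewrite !(alt_formDr h d) (f_ji wH vj (v := _ *: t)) ?addr0 //.
  by rewrite imulZl // (weil_annsqr wH).
by rewrite /disp_pairing fE -(lamD lamH); congr lam; ring.
Qed.

Lemma disp_perpP v :
  reflect (v \in jV /\ {in N_ j, forall a, disp_pairing v a = 1})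
    (v \in disp_perp).
Proof.
apply: (iffP setIdP) => -[vj va]; split=> //.
  by move=> a aN; apply/eqP/(forall_inP va).
by apply/forall_inP=> a /va ->.
Qed.

Lemma jV_group_set : group_set jV.
Proof. by apply/group_setP; split=> [|u v]; [exact: imul0|exact: imulD]. Qed.
Lemma iV_group_set : group_set iV.
Proof. by apply/group_setP; split=> [|u v]; [exact: imul0|exact: imulD]. Qed.
Definition jV_group := Group jV_group_set.
Definition iV_group := Group iV_group_set.

Lemma disp_perp_group_set : group_set disp_perp.
Proof.
apply/group_setP; split.
  apply/disp_perpP; split=> [|a aN]; first exact: imul0.
  by rewrite /disp_pairing (alt_form0l h d) addr0 (lam0 lamH).
move=> u v /disp_perpP[uj ua] /disp_perpP[vj va]; apply/disp_perpP.
split=> [|a aN]; first exact: imulD.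
by rewrite [disp_pairing _ _]disp_pairingDl ua // va // mulr1.
Qed.
Definition disp_perp_group := Group disp_perp_group_set.

Lemma sub_iV_disp_perp : iV \subset disp_perp.
Proof.
apply/subsetP=> v vi; apply/disp_perpP; split=> [|a aN].
  exact: (subsetP (sub_ijV wH)).
by rewrite /disp_pairing (f_ij wH) ?disp_jV // addr0 (lam0 lamH).
Qed.

Lemma disp_perp_sub_jV : disp_perp \subset jV.
Proof. by apply/subsetP=> v /disp_perpP[]. Qed.

(** [disp_pairing] pairs [jV / disp_perp] perfectly with [N_j / N_i]; the right
    kernel is [N_i] because [i] is the annihilator of [j]. *)
Lemma card_disp_perp : (#|jV| * #|N_ i| = #|disp_perp| * #|N_ j|)%N.
Proof.
have <- : [set a in Nj_group | [forall v in jV_group, disp_pairing v a == 1]] = N_ i.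
  apply/setP=> a; rewrite inE; apply/andP/idP=> [[aN /forall_inP aV]|aN].
    have /setIdP[aN1 _] := aN; rewrite inE aN1 /=.
    apply: (subsetP (double_annihilator (herm_gen hH) i_ideal)).
    apply: (annihilator_mu lamH) => // x xj.
    have [y yt] := primitive_dual_l hH t_prim.
    have u2 := herm_unit2 hH.
    have vj : star (x / 2%:R) *: y \in jV.
      by rewrite imulZl // (star_ideal hH) // mem_idealMr.
    have /eqP := aV _ vj; rewrite /disp_pairing (lamD lamH) /alt_form.
    have -> : h (star (x / 2%:R) *: y) (disp a) = x / 2%:R * (\val a - 1).
      have -> : disp a = (\val a - 1) *: t by rewrite scalerBl scale1r.
      by rewrite (hZl h) (hZr h) (starK star) yt mulr1.
    by rewrite -(lamD lamH) -raddfD -mulrDl (half_add hH).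
  have aNj : a \in N_ j.
    by have /setIdP[aN1 ai] := aN; rewrite inE aN1 (subsetP (sub_ij wH)).
  split=> //; apply/forall_inP=> v vj; have /setIdP[_ ai] := aN.
  have -> : disp_pairing v a = 1; last exact: eqxx.
  have dai : disp a \in iV by rewrite /disp -{2}[t]scale1r -scalerBl imulZl.
  by rewrite /disp_pairing (f_ji wH) // addr0 (lam0 lamH).
rewrite (card_pairing_kernels (G := jV_group) (K := Nj_group)
  (chi := disp_pairing)).
- by [].
- by move=> u v a _ _ _; exact: disp_pairingDl.
- by move=> v a b; exact: disp_pairingMr.
Qed.

Hypothesis Zt0 : Zt <> 0%VS.

Lemma fullv_neq0 : exists z : Z, z != 0.
Proof.
have [_ Z0 _] := S'_irreducible wH; exists (vpick (fullv : {vspace Z})).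
by rewrite vpick0; apply/eqP.
Qed.

(** Scalars are central, so [W_t] of the norm-one scalars commutes with [W_t]
    of [Omega j], and hence the Heisenberg operators of their displacements
    commute as well. *)
Lemma Omega_disp_perp g : g \in Omega h j -> g t - t \in disp_perp.
Proof.
move=> gO; have /OmegaP[gU gj] := gO; apply/disp_perpP; split=> // a aN.
have [b b0 bE] := Wt_Omega wH t gO; have [c c0 cE] := scalar_Wt_disp aN.
have gGt := subsetP (Omega_Gt wH t) _ gO.
have aGt := subsetP (Omega_Gt wH t) _ (scalar_Omega_j aN).
have comm z : Wt g (scalar_Wt a z) = scalar_Wt a (Wt g z).
  by rewrite /scalar_Wt -!(WtM wH) // (norm_scalar_comm a gU).
have [z z0] := fullv_neq0; have := comm z; rewrite !bE !cE !linearZ /= !scalerA.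
rewrite (S'_comm wH) ?disp_jV // scalerA -/(disp_pairing (g t - t) a).
set w := S' _ (S' _ z); have w0 : w != 0.
  by rewrite !(S'_eq0 wH) ?(mem_HU wH) //= ?disp_jV ?gj.
move/eqP; rewrite -subr_eq0 -scalerBl scaler_eq0 (negPf w0) orbF [b * c]mulrC.
rewrite -{2}[c * b]mulr1 -mulrBr !mulf_eq0 (negPf c0) (negPf b0) /=.
by rewrite subr_eq0 => /eqP.
Qed.

Lemma disp_perp_Omega v :
  v \in disp_perp -> exists2 g, g \in Omega h j & g t - t - v \in iV.
Proof.
move=> /disp_perpP[vj va]; apply: (displacement_exists hH lamH) => //.
- exact: (one_notin_j wH).
- exact: ij0.
- exact: (sub_ij wH).
- exact: (weil_annsqr wH).
Qed.

(** This is [H_t], see [H_tE]. *)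
Definition heis_perp : {set H} := [set k : H | k.2 \in disp_perp].

Lemma mem_heis_perp (r : R) v : (((r, v) : H) \in heis_perp) = (v \in disp_perp).
Proof. by rewrite in_set. Qed.

Lemma heis_perp_group_set : group_set heis_perp.
Proof.
apply/group_setP; split; first by rewrite inE (group1 disp_perp_group).
by move=> [r u] [s v]; rewrite heisM !mem_heis_perp;
  exact: (groupM (G := disp_perp_group)).
Qed.
Definition heis_perp_group := Group heis_perp_group_set.

Lemma H_tE : Ht = heis_perp.
Proof.
apply/eqP; rewrite eqEsubset (gen_subG _ heis_perp_group) !subUset /=.
apply/andP; split.
  apply/andP; split; [apply/andP; split|]; apply/subsetP=> _ /imsetP[x xX ->].
  - by rewrite inE (subsetP sub_iV_disp_perp).
  - by rewrite inE (group1 disp_perp_group).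
  - by rewrite inE Omega_disp_perp.
apply/subsetP=> -[r v]; rewrite inE => vD; have [g gO gv] := disp_perp_Omega vD.
set u := g t - t - v in gv; have uN : - u \in iV by rewrite imulN.
have gtj : g t - t \in jV by case/OmegaP: gO.
have -> : ((r, v) : H) =
    (heis_scal h d r * heis_vec h d (g t - t) * heis_vec h d (- u))%g.
  rewrite /heis_scal /heis_vec !heisM (alt_form0l h d) !addr0 add0r.
  by rewrite (f_ji wH) // addr0 /u opprB addrC subrK.
apply: groupM; [apply: groupM|]; apply: mem_gen; apply/setUP.
- by left; apply/setUP; right; exact: imset_f.
- by right; apply/imsetP; exists g.
- by left; apply/setUP; left; exact: imset_f.
Qed.

Lemma heis_perp_sub : heis_perp \subset HU.
Proof. by apply/subsetP=> k; rewrite (mem_HU wH) inE => /disp_perpP[]. Qed.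

Lemma heis_perp_Wt k : k \in heis_perp ->
  exists g c, [/\ g \in Omega h j, c != 0 & forall z, S' k z = c *: Wt g z].
Proof.
case: k => r v; rewrite inE /= => vD; have /disp_perpP[vj _] := vD.
have [g gO gv] := disp_perp_Omega vD; have [c c0 cE] := Wt_Omega wH t gO.
exists g, (lam r * c^-1); split=> // [|z].
  by rewrite mulf_neq0 ?invr_neq0 // (lam_neq0 lamH).
rewrite cE scalerA divfK // (S'_pair wH) //; congr (_ *: _).
have -> : ((0, g t - t) : H) = (((0, v) : H) * ((0, g t - t - v) : H))%g.
  by rewrite heisM (f_ji wH) // !addr0 [v + _]addrC subrK.
rewrite (S'M wH) ?(mem_HU wH) //= ?(subsetP (sub_ijV wH)) //.
by rewrite (S'_scal wH 0 z gv) (lam0 lamH) scale1r.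
Qed.

(** ** The projection of [Z] onto the eigenspace *)

Definition Zt_proj : 'End(Z) :=
  #|N_ j|%:R^-1 *: \sum_(a in N_ j) (phi a)^-1 *: scalar_Wt a.

Lemma Zt_projE z :
  Zt_proj z = #|N_ j|%:R^-1 *: \sum_(a in N_ j) (phi a)^-1 *: scalar_Wt a z.
Proof.
rewrite /Zt_proj scale_lfunE sum_lfunE; congr (_ *: _).
by apply: eq_bigr => a _; rewrite scale_lfunE.
Qed.

Lemma Nj_norm a : a \in N_ j -> a \in norm_one star. Proof. by case/setIdP. Qed.

Lemma card_Nj_neq0 : #|N_ j|%:R != 0 :> C.
Proof. by rewrite Num.Theory.pnatr_eq0 -lt0n (cardG_gt0 Nj_group). Qed.

Lemma Zt_proj_id z : z \in Zt -> Zt_proj z = z.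
Proof.
move=> /ZtP zZ; rewrite Zt_projE (eq_bigr (fun=> z)) => [|a aN]; last first.
  by rewrite zZ // scalerA mulVf ?scale1r // phi_neq0 ?Nj_norm.
by rewrite sumr_const -scaler_nat scalerA mulVf ?scale1r // card_Nj_neq0.
Qed.

Lemma Zt_proj_scalar b z : b \in N_ j -> Zt_proj (scalar_Wt b z) = phi b *: Zt_proj z.
Proof.
move=> bN; rewrite !Zt_projE scalerA mulrC -scalerA; congr (_ *: _).
rewrite scaler_sumr [RHS](reindex_inj (mulIg b)) /=.
apply: eq_big => [a|a aN]; first by rewrite (groupMr a (G := Nj_group) bN).
rewrite (scalar_WtM _ aN bN) scalerA (phiM (Nj_norm aN) (Nj_norm bN)).
rewrite invfM mulrCA mulfV; first by rewrite mulr1.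
by rewrite phi_neq0 ?Nj_norm.
Qed.

Lemma scalar_Zt_proj b z : b \in N_ j -> scalar_Wt b (Zt_proj z) = phi b *: Zt_proj z.
Proof.
move=> bN; rewrite !Zt_projE linearZ /= scalerA mulrC -scalerA; congr (_ *: _).
rewrite linear_sum /= scaler_sumr [RHS](reindex_inj (mulgI b)) /=.
apply: eq_big => [a|a aN]; first by rewrite (groupMl (G := Nj_group) a bN).
rewrite linearZ /= -(scalar_WtM _ bN aN) scalerA (phiM (Nj_norm bN) (Nj_norm aN)).
by rewrite invfM mulrA mulfV ?mul1r // phi_neq0 ?Nj_norm.
Qed.

Lemma Zt_proj_mem z : Zt_proj z \in Zt.
Proof. by apply/ZtP=> b bN; rewrite scalar_Zt_proj. Qed.

Lemma scalar_Wt_S' a r v z : a \in N_ j -> v \in jV ->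
  scalar_Wt a (S' (r, v) z) = (disp_pairing v a)^-1 *: S' (r, v) (scalar_Wt a z).
Proof.
move=> aN vj; have [c c0 cE] := scalar_Wt_disp aN.
have -> : (disp_pairing v a)^-1 = lam (f (disp a) v + f (disp a) v).
  by rewrite /disp_pairing (f_anti hH lamH (disp a) v) -opprD (lamN lamH) invrK.
rewrite cE (S'_comm wH) ?disp_jV // cE.
by rewrite [S' (r, v) (c *: _)]linearZ /= !scalerA mulrC.
Qed.

Lemma S'_heis_perp_Zt k z : k \in heis_perp -> z \in Zt -> S' k z \in Zt.
Proof.
case: k => r v; rewrite inE => /disp_perpP[vj va] /ZtP zZ; apply/ZtP=> a aN.
by rewrite scalar_Wt_S' // va // invr1 scale1r zZ // linearZ.
Qed.

Lemma Zt_proj_S' k z : k \in heis_perp -> Zt_proj (S' k z) = S' k (Zt_proj z).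
Proof.
case: k => r v; rewrite inE => /disp_perpP[vj va].
rewrite (Zt_projE z) linearZ linear_sum /= Zt_projE; congr (_ *: _).
apply: eq_bigr => a aN.
by rewrite linearZ /= scalar_Wt_S' // va // invr1 scale1r.
Qed.

(** Outside [H_t] the Heisenberg operators change the character of the
    norm-one scalars. *)
Lemma Zt_proj_S'_out k z :
  k \in HU -> k \notin heis_perp -> z \in Zt -> Zt_proj (S' k z) = 0.
Proof.
case: k => r v; rewrite (mem_HU wH) /= => vj.
rewrite mem_heis_perp /disp_perp in_set vj /=.
rewrite negb_forall_in => /exists_inP[a aN va] /ZtP zZ.
have := Zt_proj_scalar (S' (r, v) z) aN; rewrite scalar_Wt_S' // zZ //.
rewrite linearZ /= linearZ /= linearZ /=.
rewrite scalerA => /eqP; rewrite -subr_eq0 -scalerBl scaler_eq0 => /orP[|/eqP //].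
rewrite -{2}[phi a]mul1r -mulrBl mulf_eq0 (negPf (phi_neq0 (Nj_norm aN))) orbF.
by rewrite subr_eq0 invr_eq1 (negPf va).
Qed.

(** A nonzero submodule [W] generates [Z] under the irreducible group [HU], and
    [Zt_proj] annihilates all the translates of [W] by elements outside [H_t]. *)
Lemma Zt_generated (W : {vspace Z}) :
  (W <= Zt)%VS -> {in heis_perp, forall k, (S' k @: W <= W)%VS} -> W = 0%VS \/ W = Zt.
Proof.
move=> sWZ Wst; have [->|W0] := eqVneq W 0%VS; [by left|right].
pose M := (\sum_(k in HU) (S' k @: W))%VS.
have [_ _ irr] := S'_irreducible wH.
have [g gH|M0|M1] := irr M (subvf _).
- rewrite limg_sum; apply/subv_sumP=> k kH.
  have gkH : (g * k)%g \in HU by rewrite (groupM (G := HU_group wH)).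
  apply/subvP=> _ /memv_imgP[_ /memv_imgP[w wW ->] ->]; rewrite -(S'M wH) //.
  by apply: (subvP (sumv_sup (g * k)%g gkH (subvv _))); exact: memv_img.
- have : (W <= M)%VS.
    apply: (sumv_sup 1%g); first by rewrite (group1 (HU_group wH)).
    by apply/subvP=> w wW; apply/memv_imgP; exists w; rewrite ?(S'1 wH).
  by rewrite M0 subv0 (negPf W0).
apply/eqP; rewrite eqEsubv sWZ /=; apply/subvP=> z zZ.
have : z \in M by rewrite M1 memvf.
case/memv_sumP=> zs zsW zE; rewrite -(Zt_proj_id zZ) zE linear_sum /=.
apply: memv_suml => k kH; have /memv_imgP[w wW ->] := zsW k kH.
have wZ := subvP sWZ w wW.
have [kD|nkD] := boolP (k \in heis_perp); last by rewrite Zt_proj_S'_out ?mem0v.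
by rewrite Zt_proj_id ?S'_heis_perp_Zt // (subvP (Wst k kD)) // memv_img.
Qed.

(** ** Irreducibility, induction from [H_t], and the indices *)

Lemma Zt_is_module_heis_perp : is_module heis_perp Zt S'.
Proof.
split=> [k kD|z _|k l kD lD z _].
- by apply/subvP=> _ /memv_imgP[z zZ ->]; exact: S'_heis_perp_Zt.
- exact: (S'1 wH).
- by rewrite (S'M wH) // (subsetP heis_perp_sub).
Qed.

Lemma Zt_irreducible_heis_perp : is_irreducible heis_perp Zt S'.
Proof. by split=> //; [exact: Zt_is_module_heis_perp|exact: Zt_generated]. Qed.

Lemma Wt_Zt g z : g \in Gt -> z \in Zt -> Wt g z \in Zt.
Proof.
move=> gG /ZtP zZ; apply/ZtP=> a aN.
have aG := subsetP (Omega_Gt wH t) _ (scalar_Omega_j aN).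
have /(GtP wH)[gU _] := gG.
rewrite /scalar_Wt -(WtM wH) // (norm_scalar_comm a gU) (WtM wH) //.
by rewrite -/(scalar_Wt a) zZ // linearZ.
Qed.

Lemma Zt_irreducible_Omega : is_irreducible (Omega h j) Zt Wt.
Proof.
have sOG := subsetP (Omega_Gt wH t); split=> //.
  split=> [g gO|z _|g k gO kO z _]; last by rewrite (WtM wH) ?sOG.
    by apply/subvP=> _ /memv_imgP[z zZ ->]; rewrite Wt_Zt ?sOG.
  exact: (Wt1 wH).
move=> W sWZ Wst; apply: Zt_generated => // k kD.
have [g [c [gO c0 cE]]] := heis_perp_Wt kD.
apply/subvP=> _ /memv_imgP[z zW ->]; rewrite cE memvZ //.
by apply: (subvP (Wst g gO)); exact: memv_img.
Qed.

Lemma Zt_nonzero : exists2 z, z \in Zt & z != 0.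
Proof.
exists (vpick Zt); first exact: memv_pick.
by rewrite vpick0; apply/eqP.
Qed.

(** An intertwiner between [Zt] and its conjugate by [k] compares the
    characters by which the displacements of norm-one scalars act on both. *)
Lemma stabilizer_heis_perp : is_stabilizer HU heis_perp Zt S' heis_perp.
Proof.
split; first exact: heis_perp_sub.
move=> k kH; split=> [kD|[T [TZ T0 TE]]].
  exists (S' k); split.
  - apply/eqP; rewrite eqEsubv; apply/andP; split; apply/subvP=> z.
      by case/memv_imgP=> w wZ ->; exact: S'_heis_perp_Zt.
    move=> zZ; apply/memv_imgP; exists (S' k^-1%g z); last by rewrite (S'VK wH).
    by rewrite S'_heis_perp_Zt // (groupV heis_perp_group).
  - apply/eqP; rewrite -subv0; apply/subvP=> z; rewrite memv_cap memv_ker.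
    by rewrite (S'_eq0 wH) // memv0 => /andP[].
  - move=> l z lD _; have lH := subsetP heis_perp_sub _ lD.
    have lkH : (l ^ k)%g \in HU by rewrite (groupJ (G := HU_group wH)).
    by rewrite -!(S'M wH) // -conjgC.
case: k kH TE => r v; rewrite (mem_HU wH) mem_heis_perp => /= vj TE.
apply/disp_perpP; split=> // a aN.
have [z zZ z0] := Zt_nonzero.
have Tz0 : T z != 0.
  apply: contra z0 => Tz0; rewrite -memv0 -T0 memv_cap zZ memv_ker //.
have aD : ((0, disp a) : H) \in heis_perp.
  rewrite mem_heis_perp; have := Omega_disp_perp (scalar_Omega_j aN).
  by rewrite permE.
have [c c0 cE] := scalar_Wt_disp aN.
have TzZ : T z \in Zt by rewrite -TZ memv_img.
have SE w : w \in Zt -> S' (0, disp a) w = (c^-1 * phi a) *: w.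
  by move/ZtP=> wZ; rewrite -scalerA -wZ // cE scalerA mulVf // scale1r.
have := TE _ _ aD zZ; rewrite (SE _ TzZ).
have vH : ((r, v) : H) \in HU by rewrite (mem_HU wH).
have aH := subsetP heis_perp_sub _ aD.
have aJ : (((0, disp a) : H) ^ ((r, v) : H))%g \in HU.
  by rewrite (groupJ (G := HU_group wH)).
have -> : S' (((0, disp a) : H) ^ ((r, v) : H))%g z =
    (disp_pairing v a)^-1 *: S' (0, disp a) z.
  rewrite -[LHS](S'K wH _ vH) -(S'M wH _ vH aJ) -conjgC (S'M wH) //.
  rewrite (S'_comm wH 0 r z (disp_jV aN) vj) linearZ /= (S'K wH) //; congr (_ *: _).
  by rewrite /disp_pairing (f_anti hH lamH (disp a) v) -opprD (lamN lamH) invrK.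
rewrite (SE _ zZ) !linearZ /= scalerA => /eqP; rewrite -subr_eq0 -scalerBl.
rewrite scaler_eq0 (negPf Tz0) orbF -{2}[c^-1 * _]mul1r -mulrBl.
rewrite !mulf_eq0 invr_eq0 (negPf c0) (negPf (phi_neq0 (Nj_norm aN))) !orbF.
by rewrite subr_eq0 invr_eq1 => /eqP.
Qed.

Lemma HU_mulr x y : y \in HU -> ((x * y)%g \in HU) = (x \in HU).
Proof. exact: (groupMr (G := HU_group wH)). Qed.

(** Frobenius reciprocity for the projection onto [Zt]; the inverse map sums over
    [HU], and only the coset of [y] contributes to the value at [y], since the
    projection annihilates the other translates of [Zt]. *)
Lemma induced_from_heis_perp :
  module_iso HU fullv S' (ind_space HU heis_perp Zt S') (@ind_act _ _ Z).
Proof.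
have [|T TE] := @lfun_exists _ Z {ffun H -> Z}
  (fun z => [ffun x => if x \in HU then Zt_proj (S' x z) else 0]).
  move=> a u v; apply/ffunP=> x; rewrite !ffunE; case: ifP => _.
    by rewrite !linearP.
  by rewrite scaler0 addr0.
have Tx z x : x \in HU -> T z x = Zt_proj (S' x z) by move=> xH; rewrite TE ffunE xH.
have HU1 := group1 (HU_group wH).
have Teq : {in HU & fullv, forall g v, T (S' g v) = ind_act Z g (T v)}.
  move=> g z gH _; apply/ffunP=> x; rewrite ind_actE !TE !ffunE HU_mulr //.
  by case: ifP => // xH; rewrite (S'M wH).
exists T; split=> //.
- apply/eqP; rewrite eqEsubv; apply/andP; split; apply/subvP=> psi.
    case/memv_imgP=> z _ ->; apply/ind_spaceP; split=> [x xH|x|k x kD xH].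
    + by rewrite Tx // Zt_proj_mem.
    + by rewrite inE TE ffunE => /negPf->.
    + have kH := subsetP heis_perp_sub _ kD.
      by rewrite !Tx ?HU_mulr // (S'M wH) // Zt_proj_S'.
  case/ind_spaceP=> psiZ psi0 psiE; apply/memv_imgP.
  exists (#|heis_perp|%:R^-1 *: \sum_(x in HU) S' x^-1%g (psi x)); first exact: memvf.
  have cD : #|heis_perp|%:R != 0 :> C.
    by rewrite Num.Theory.pnatr_eq0 -lt0n (cardG_gt0 heis_perp_group).
  apply/ffunP=> y; have [yH|nyH] := boolP (y \in HU); last first.
    by rewrite psi0 ?in_setC // TE ffunE (negPf nyH).
  rewrite Tx // !linearZ !linear_sum /=.
  rewrite (bigID (fun x => (y * x^-1)%g \in heis_perp)) /= [X in _ + X]big1 ?addr0.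
    rewrite (eq_bigr (fun=> psi y)) => [|x /andP[xH yxD]]; last first.
      have xVH : x^-1%g \in HU by rewrite (groupV (HU_group wH)).
      rewrite -(S'M wH) // -{2}[y](mulgKV x) psiE // Zt_proj_id //.
      by rewrite S'_heis_perp_Zt ?psiZ.
    have cosetE x : (x \in HU) && ((y * x^-1)%g \in heis_perp) =
                    (x \in heis_perp_group :* y)%g.
      have -> : ((y * x^-1)%g \in heis_perp) = ((x * y^-1)%g \in heis_perp).
        by rewrite -(groupV heis_perp_group) invMg invgK.
      rewrite mem_rcoset.
      case: (boolP (_ \in heis_perp)) => [xyD|]; rewrite ?andbF //.
      by rewrite -(mulgKV y x) HU_mulr // (subsetP heis_perp_sub).
    rewrite (eq_bigl _ _ cosetE) sumr_const card_rcoset -scaler_nat scalerA.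
    by rewrite mulVf // scale1r.
  move=> x /andP[xH nyx]; have xVH : x^-1%g \in HU by rewrite (groupV (HU_group wH)).
  by rewrite -(S'M wH) // Zt_proj_S'_out ?psiZ // HU_mulr.
have [_ _ irr] := S'_irreducible wH; rewrite capfv.
have [g gH|//|T1] := irr (lker T) (subvf _).
  apply/subvP=> _ /memv_imgP[z zT ->]; move: zT; rewrite !memv_ker => /eqP zT.
  by rewrite Teq ?memvf // zT linear0.
have [z zZ /eqP[]] := Zt_nonzero.
have : z \in lker T by rewrite T1 memvf.
rewrite memv_ker => /eqP/ffunP/(_ 1%g); rewrite Tx // (S'1 wH) Zt_proj_id //.
by move=> ->; rewrite ffunE.
Qed.

Lemma card_NjNi : (#|N_ i| * #|(N_ j / N_ i)%g| = #|N_ j|)%N.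
Proof.
have sNij : Ni_group \subset Nj_group.
  by apply/subsetP=> a /setIdP[aN ai]; rewrite inE aN (subsetP (sub_ij wH)).
have nN : Nj_group \subset ('N(Ni_group))%g.
  apply/cents_norm/centsP=> a _ b _; apply: val_inj; exact: mulrC.
by rewrite -(Lagrange sNij) -(card_quotient nN).
Qed.

Lemma card_heis_of (B : {set V}) : #|[set k : H | k.2 \in B]| = (#|R| * #|B|)%N.
Proof.
rewrite -cardsT -cardsX; apply: eq_card => -[r v].
by rewrite !inE.
Qed.

Lemma index_disp_perp (x : nat) :
  (#|disp_perp| * x = #|jV|)%N -> x = #|(N_ j / N_ i)%g|.
Proof.
move=> xE; have D0 : (0 < #|disp_perp|)%N := cardG_gt0 disp_perp_group.
have N0 : (0 < #|N_ i|)%N := cardG_gt0 Ni_group.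
apply/eqP; rewrite -(eqn_pmul2l N0) card_NjNi -(eqn_pmul2l D0) -card_disp_perp -xE.
by rewrite mulnCA mulnC.
Qed.

Lemma index_heis_perp : #|HU : heis_perp|%g = #|(N_ j / N_ i)%g|.
Proof.
apply: index_disp_perp; have R0 : (0 < #|R|)%N by apply/card_gt0P; exists 0.
apply/eqP; rewrite -(eqn_pmul2l R0) mulnA -!card_heis_of -/heis_perp.
have := Lagrange (G := HU_group wH) (H := heis_perp_group) heis_perp_sub => /= ->.
by rewrite /heis_of (UperpE wH).
Qed.

Lemma sub_norm_iV (B : {set V}) : B \subset 'N(iV)%g.
Proof. by apply: cents_norm; apply/centsP=> u _ w _; exact: addrC. Qed.

Lemma coset_iV (u v : V) : u - v \in iV -> coset iV u = coset iV v.
Proof.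
move=> uv; have nV w : w \in 'N(iV_group)%g.
  exact: (subsetP (sub_norm_iV [set: V])) (in_setT w).
by apply/(rcoset_kercosetP (nV u) (nV v)); rewrite mem_rcoset.
Qed.

Lemma GammaE : Gamma i t @: Omega h j = (disp_perp / iV)%g.
Proof.
apply/setP=> x; apply/imsetP/morphimP => [[g gO ->]|[v _ vD ->]].
  exists (g t - t) => //; last exact: Omega_disp_perp.
  exact: (subsetP (sub_norm_iV [set: V])) (in_setT _).
have [g gO gv] := disp_perp_Omega vD; exists g => //.
by apply/esym/coset_iV.
Qed.

Lemma index_Gamma :
  #|(jV / iV)%g : Gamma i t @: Omega h j|%g = #|(N_ j / N_ i)%g|.
Proof.
rewrite GammaE; apply: index_disp_perp.
have nV (B : {group V}) : B \subset 'N(iV_group)%g := sub_norm_iV B.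
have sDj : (disp_perp_group / iV_group \subset jV_group / iV_group)%g.
  by rewrite quotientS // disp_perp_sub_jV.
have sij : iV_group \subset jV_group by exact: (sub_ijV wH).
have siD : iV_group \subset disp_perp_group by exact: sub_iV_disp_perp.
rewrite -(Lagrange siD) -(card_quotient (nV _)) -mulnA.
by rewrite (Lagrange sDj) (card_quotient (nV _)) (Lagrange sij).
Qed.

Lemma Gamma_morph :
  {in Omega h j &, {morph Gamma i t : g k / (g * k)%g}}.
Proof.
move=> g k gO kO; have /OmegaP[gU gj] := gO; have /OmegaP[kU kj] := kO.
have nV v : v \in 'N(iV)%g := subsetP (sub_norm_iV [set: V]) v (in_setT v).
rewrite /Gamma -morphM ?nV //= FinRing.zmodMgE fpermM; apply: coset_iV.
have -> : g (k t) - t - (g t - t + (k t - t)) = g (k t - t) - (k t - t).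
  by rewrite (unitary_sub _ _ gU); apply/rowP=> l; rewrite !mxE; ring.
exact: (Omega_imul j_ideal i_ideal (weil_annsqr wH) gO (kj t)).
Qed.

Lemma Gamma_sub : Gamma i t @: Omega h j \subset (jV / iV)%g.
Proof. by rewrite GammaE (quotientS (iV_group)) // disp_perp_sub_jV. Qed.

End Clifford.

(** * The top of the Weil module *)

Section Top.

Variables (A : finComUnitRingType) (star : involutive_rmorphism A) (pi eps : A).
Variables (m : nat).
Local Notation V := 'rV[A]_m.
Local Notation R := (symR star).
Variable h : {bilinear V -> V -> A | (star \; *%R) & *%R}.
Variables (d : {additive A -> R}) (i : {set A}) (C : numClosedFieldType).
Variables (lam : R -> C) (Z : vectType C).
Variables (S' : heis h d -> 'End(Z)) (W' : fperm V -> 'End(Z)).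
Hypothesis wH : weil_setting pi eps i lam S' W'.

Local Notation f := (alt_form h d).
Local Notation H := (heis h d).
Local Notation J := (jacobi h d).
Local Notation j := (annihilator i).
Local Notation HU := (heis_of h d (Uperp h i)).
Local Notation N_ := (norm_one_cong star).
Local Notation iV := (ideal_mul m i).
Local Notation jV := (ideal_mul m j).
Local Notation U := (unitary h).
Local Notation Wr := (Wr h i W').
Local Notation X := (weil_space i S' W').
Local Notation act := (@weil_act _ _ _ h d _ Z).
Local Notation prim := (primitive_vectors m pi).

Let hH := weil_herm wH.
Let lamH := weil_char wH.
Let i_ideal := weil_ideal wH.
Let j_ideal : is_ideal j := j_ideal i.

Definition jpair (k : H) (g : fperm V) : J := (k, subg U g).

Lemma jpairM k l g g' : g \in U -> g' \in U ->
  (jpair k g * jpair l g')%g = jpair (k * heis_act g l)%g (g * g')%g.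
Proof.
move=> gU g'U; rewrite /jpair; congr (_, _); first by rewrite /= subgK.
by apply: val_inj; rewrite /= !subgK ?groupM.
Qed.

Lemma jpair_eq (y : J) : y = jpair (y.1.1, y.1.2) (sgval y.2).
Proof. by case: y => -[r v] g; rewrite /jpair sgvalK. Qed.

(** An element of the induced module is determined by its values at the
    elements [(0, v)] of the Heisenberg group. *)
Definition value_at (F : {ffun J -> Z}) (v : V) : Z := F (jpair (0, v) 1%g).

Lemma weil_spaceP (F : {ffun J -> Z}) :
  F \in X <-> forall k g y, k \in HU -> g \in U ->
                F (jpair k g * y)%g = S' k (Wr g (F y)).
Proof.
split=> [/ind_spaceP[_ _ FE] k g y kH gU|FE].
  rewrite FE ?in_setT //; last by rewrite inE.
  by rewrite /semidirect_act comp_lfunE /= subgK.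
apply/ind_spaceP; split=> [x _|x|x y xB _]; first exact: memvf.
  by rewrite !inE.
have xH : ((x.1.1, x.1.2) : H) \in HU by move: xB; rewrite in_set; case: (x.1).
rewrite {1}(jpair_eq x) FE ?subgP // /semidirect_act comp_lfunE.
by case: (x.1).
Qed.

Lemma value_at_shift F v w : F \in X -> w \in jV ->
  value_at F (w + v) = S' (- f w v, w) (value_at F v).
Proof.
move=> /weil_spaceP FE wj; rewrite -[RHS]/(S' _ (F (jpair (0, v) 1%g))).
rewrite -[F (jpair _ _)](Wr1 wH) -FE ?group1 ?(mem_HU wH) // jpairM ?group1 //.
by rewrite (heis_act1) heisM addr0 addNr mulg1.
Qed.

Lemma value_atE F r v g : F \in X -> g \in U ->
  F (jpair (r, v) g) = lam r *: Wr g (value_at F (g^-1%g v)).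
Proof.
move=> /weil_spaceP FE gU.
have rH : ((r, 0) : H) \in HU by rewrite (mem_HU wH) imul0.
rewrite -(S'_scal wH r (u := 0)) ?imul0 // -FE // jpairM ?group1 // mulg1.
by rewrite /heis_act heisM /= -fpermM mulgV fperm1 (alt_form0l h d) !addr0 add0r.
Qed.

Lemma weil_actE g F y : act g F y = F (y * jpair 1%g g)%g.
Proof. by rewrite /weil_act ind_actE. Qed.

Lemma weil_act_at F g v : F \in X -> g \in U ->
  value_at (act g F) v = Wr g (value_at F (g^-1%g v)).
Proof.
move=> FX gU; rewrite /value_at weil_actE jpairM ?group1 // mul1g heis_act1 mulg1.
by rewrite value_atE // (lam0 lamH) scale1r.
Qed.

Lemma weil_act_X F g : F \in X -> g \in U -> act g F \in X.
Proof.
move=> /weil_spaceP FE gU; apply/weil_spaceP=> k u y kH uU.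
by rewrite !weil_actE -mulgA FE.
Qed.

Lemma translate_iV F r v g w : F \in X -> g \in U -> w \in iV ->
  F (jpair (r, v) g * jac_heis (heis_vec h d w))%g =
  lam (f (g^-1%g v) w + f (g^-1%g v) w) *: F (jpair (r, v) g).
Proof.
move=> FX gU wi; have wj := subsetP (sub_ijV wH) w wi; set u := g^-1%g v.
have -> : (jpair (r, v) g * jac_heis (heis_vec h d w))%g =
    jpair (r + f v (g w), v + g w) g.
  rewrite /jpair; congr (_, _); last by rewrite /= mulg1.
  by rewrite /= subgK // /heis_act heisM /= addr0.
rewrite !value_atE //.
have -> : g^-1%g (v + g w) = w + u.
  by rewrite (unitary_add _ _ (groupVr gU)) -fpermM mulVg fperm1 addrC.
rewrite value_at_shift // (S'_scal wH) // linearZ /= !scalerA -!(lamD lamH).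
congr (lam _ *: _); have -> : f v (g w) = f u w.
  by rewrite -(unitary_f d u w gU) /u -fpermM mulgV fperm1.
by rewrite (f_anti hH lamH u w); ring.
Qed.

Section Bottom.

Variable n : {set A}.
Hypothesis n_min : is_min_nonzero_ideal n.
Local Notation Bot := (weil_bot i S' W' n).

Let n_ideal : is_ideal n. Proof. by case: n_min. Qed.
Let sub_ni : n \subset i.
Proof. exact: (min_ideal_sub (herm_gen hH) n_min i_ideal (weil_neq0 wH)). Qed.

Lemma sub_niV : ideal_mul m n \subset iV.
Proof.
by apply/subsetP=> v /ideal_mulP vn; apply/ideal_mulP=> l; exact: (subsetP sub_ni).
Qed.

(** For [w] in [nV] the element [(0, w)] scales the value at [v] by the value of
    [lam] at [2 f(v, w)], and as [w] runs through [nV] this is trivial exactly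
    when the ideal [h v V] is proper. *)
Lemma weil_botP F :
  F \in Bot <-> F \in X /\ {in prim, forall v, value_at F v = 0}.
Proof.
rewrite memv_cap; split=> [/andP[FX /subv_bigcapP Ffix]|[FX F0]].
  split=> // v pv; apply/eqP/negPn/negP=> Fv0.
  have [y yv] := primitive_dual_r hH pv.
  case: n_min => _ n0 _; apply: n0; apply/setP=> x; rewrite in_set1.
  apply/idP/eqP=> [xn|->]; last exact: mem_ideal0.
  apply: (trace_prim lamH) => a.
  have axn : a * x / 2%:R \in n by rewrite mem_idealMr // mem_idealMl.
  have wn : (a * x / 2%:R) *: y \in ideal_mul m n by rewrite imulZl.
  have := Ffix _ wn; rewrite -memvE => /fixedSpaceP/ffunP/(_ (jpair (0, v) 1%g)).
  rewrite ind_actE translate_iV ?(subsetP sub_niV) ?group1 // invg1 fperm1.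
  rewrite /alt_form -raddfD (hZr h) yv mulr1 (half_add hH).
  rewrite -[RHS]scale1r => /eqP; rewrite -subr_eq0 -scalerBl scaler_eq0 subr_eq0.
  by rewrite orbC (negPf Fv0) => /eqP.
rewrite FX; apply/subv_bigcapP=> w wn; rewrite -memvE; apply/fixedSpaceP/ffunP=> y.
rewrite ind_actE (jpair_eq y) translate_iV ?subgP ?(subsetP sub_niV) //.
set u := (X in f X w); have [pu|npu] := boolP (u \in prim).
  by rewrite value_atE ?subgP // F0 // linear0 !scaler0.
have -> : f u w = 0.
  rewrite /alt_form; have -> : h u w = 0; last exact: raddf0.
  move: npu; rewrite inE negbK => upi; apply/set1P.
  apply: (h_ideal2 hH (principal_ideal pi) _ _ upi wn).
    by split=> [|? x z /set1P-> /set1P->]; apply/set1P; rewrite // mulr0 addr0.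
  move=> _ x /imsetP[a _ ->] xn; apply/set1P.
  by rewrite -mulrA (pi_min_ideal (herm_gen hH) n_min) ?mulr0.
by rewrite addr0 (lam0 lamH) scale1r.
Qed.

End Bottom.

(** ** Induction from [G_t N] *)

Variables (n : {set A}) (n_min : is_min_nonzero_ideal n).
Variables (Top : vectType C) (rhoTop : fperm V -> 'End(Top)).
Variable prTop : 'Hom({ffun J -> Z}, Top).
Local Notation Bot := (weil_bot i S' W' n).
Hypothesis Top_quo : is_quotient_module U X act Bot rhoTop prTop.
Variables (t : V) (phi : {unit A} -> C).
Hypothesis t_prim : t \in prim.
Hypothesis phi_char : is_lin_char (norm_one star) phi.
Hypothesis t_Top :
  char_enters (Omega h i) (eigen_N star rhoTop phi) rhoTop (alpha h d lam t).

Local Notation Gt := (G_t h i t).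
Local Notation Wt := (W_t i S' W' t).
Local Notation Zt := (Z_t i S' W' t phi).
Local Notation GN := (GtN h i t).
Local Notation GNact := (GtN_act i S' W' t phi).
Local Notation TopN := (eigen_N star rhoTop phi).
Local Notation sc a := (scalar_aut m a : fperm V).

Lemma prTop_section : exists s : 'Hom(Top, {ffun J -> Z}),
  forall q, s q \in X /\ prTop (s q) = q.
Proof.
have [prX _ _] := Top_quo.
pose L := (prTop \o projv X)%VF; exists (projv X \o L^-1)%VF => q.
rewrite comp_lfunE memv_proj; split=> //.
rewrite -[prTop _](comp_lfunE prTop (projv X)) limg_lfunVK //.
by rewrite limg_comp limg_proj prX memvf.
Qed.

Lemma prTop_eq0 F : F \in X -> prTop F = 0 -> F \in Bot.
Proof.
have [_ <- _] := Top_quo => FX F0.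
by rewrite memv_cap FX memv_ker F0 eqxx.
Qed.

Lemma Bot_prTop F : F \in Bot -> F \in X /\ prTop F = 0.
Proof.
have [_ <- _] := Top_quo; rewrite memv_cap memv_ker => /andP[-> /eqP].
by [].
Qed.

Lemma rhoTop_prTop g F : g \in U -> F \in X -> rhoTop g (prTop F) = prTop (act g F).
Proof. by have [_ _ E] := Top_quo => gU FX; rewrite E. Qed.

Lemma TopNP q :
  reflect {in norm_one star, forall a, rhoTop (sc a) q = phi a *: q} (q \in TopN).
Proof.
have E a : (q \in leigen (rhoTop (sc a)) (phi a)) = (rhoTop (sc a) q == phi a *: q).
  by rewrite memv_ker add_lfunE opp_lfunE scale_lfunE id_lfunE subr_eq0.
apply: (iffP idP) => [/subv_bigcapP qN a aN|qN].
  by apply/eqP; rewrite -E memvE qN.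
by apply/subv_bigcapP=> a aN; rewrite -memvE E qN.
Qed.

(** The summand [(0, t) Z] of the induced module, on which [G_t] acts through
    [W_t], is the space of functions supported on the coset of [(0, -t)]. *)
Definition orbit_value (F : {ffun J -> Z}) (x : fperm V) : Z := F (jpair (0, - t) x).

Lemma orbit_value_Bot F x : F \in Bot -> x \in U -> orbit_value F x = 0.
Proof.
move=> /(weil_botP n_min)[FX F0] xU; rewrite /orbit_value value_atE //.
rewrite F0 ?linear0 ?scaler0 //.
have [y yt] := primitive_dual_l hH t_prim.
apply: (unit_pairing_primitive hH (u := x^-1%g y)).
rewrite (unitary_h _ _ (groupVr xU)) linearNr yt unitrN unitr1 //.
Qed.

Lemma orbit_value_Gt F g x : F \in X -> g \in Gt -> x \in U ->
  orbit_value F (g * x)%g = Wt g (orbit_value F x).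
Proof.
move=> /weil_spaceP FE /(GtP wH)[gU gt] xU.
rewrite WtE /orbit_value -FE ?(mem_HU wH) //.
rewrite jpairM //; congr (F (jpair _ _)); rewrite /heis_act heisM /=.
rewrite (unitary_opp _ gU) addr0 [g t - t]addrC addrK; congr (_, _).
have fNr u v : f u (- v) = - f u v by rewrite /alt_form linearNr raddfN.
rewrite (alt_formDl h d) (alt_formNl h d) !fNr (f_self hH lamH).
by rewrite (f_anti hH lamH (g t) t); ring.
Qed.

Lemma orbit_value_act F g x : g \in U -> x \in U ->
  orbit_value (act g F) x = orbit_value F (x * g)%g.
Proof.
move=> gU xU; rewrite /orbit_value weil_actE jpairM // /heis_act /=.
by rewrite (unitary_0 xU) mulg1.
Qed.

Lemma scalar_aut_U a : a \in norm_one star -> sc a \in U.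
Proof. exact: norm_scalar_unitary. Qed.

Lemma TopN_act q F a : q \in TopN -> F \in X -> prTop F = q -> a \in norm_one star ->
  act (sc a) F - phi a *: F \in Bot.
Proof.
move=> /TopNP qN FX Fq aN; have aU := scalar_aut_U aN; apply: prTop_eq0.
  by rewrite memvB ?memvZ ?weil_act_X.
by rewrite linearB linearZ /= -rhoTop_prTop // Fq qN // subrr.
Qed.

Lemma orbit_value_N q F a x : q \in TopN -> F \in X -> prTop F = q ->
  a \in norm_one star -> x \in U ->
  orbit_value F (x * sc a)%g = phi a *: orbit_value F x.
Proof.
move=> qN FX Fq aN xU; have := orbit_value_Bot (TopN_act qN FX Fq aN) xU.
rewrite -orbit_value_act ?scalar_aut_U // /orbit_value !ffunE => /eqP.
by rewrite subr_eq0 => /eqP.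
Qed.

Lemma scalar_autV a : (sc a)^-1%g = sc a^-1%g.
Proof. by apply: (mulgI (sc a)); rewrite mulgV -scalar_autM mulgV scalar_aut1. Qed.

Lemma Gt_norm_one a : a \in norm_one star -> sc a \in Gt -> a \in N_ j.
Proof.
move=> aN /(GtP wH)[_ /ideal_mulP atj]; rewrite inE aN /=.
have [l ul] := primitiveP hH t t_prim.
rewrite -(mulrK ul (_ - 1)) mem_idealMr //; have := atj l; rewrite permE !mxE.
by rewrite mulrBl mul1r.
Qed.

Lemma GtNP x : x \in GN ->
  exists a g, [/\ a \in norm_one star, g \in Gt & x = (sc a * g)%g].
Proof.
case/mulsgP=> g _ gG /imsetP[a aN ->] ->; exists a, g; split=> //.
by have /(GtP wH)[gU _] := gG; rewrite (norm_scalar_comm a gU).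
Qed.

Lemma mem_GtN a g : a \in norm_one star -> g \in Gt -> (sc a * g)%g \in GN.
Proof.
move=> aN gG; have /(GtP wH)[gU _] := gG; rewrite (norm_scalar_comm a gU).
by apply: mem_mulg => //; exact: imset_f.
Qed.

Lemma GtN_U x : x \in GN -> x \in U.
Proof.
by case/GtNP=> a [g [aN /(GtP wH)[gU _] ->]]; rewrite groupM ?scalar_aut_U.
Qed.

(** Two factorizations of an element of [G_t N] differ by a scalar in [N_j], on
    which [phi] and [W_t] agree when acting on [Zt]. *)
Lemma GtN_actE a g z : a \in norm_one star -> g \in Gt -> z \in Zt ->
  GNact (sc a * g)%g z = phi a *: Wt g z.
Proof.
move=> aN gG zZ; rewrite /GtN_act; case: pickP => [b /andP[bN bG]|/(_ a)]; last first.
  by rewrite aN mulKg gG.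
pose c := (b^-1 * a)%g.
have scE : ((sc b)^-1 * (sc a * g) = sc c * g)%g.
  by rewrite /c scalar_autM -scalar_autV !mulgA.
have cN : c \in norm_one star.
  by rewrite (groupM (G := norm_one_group star)) // (groupV (norm_one_group star)).
have cG : sc c \in Gt.
  by rewrite -(groupMr (G := Gt_group wH t) _ gG) -scE.
have cNj := Gt_norm_one cN cG.
rewrite scale_lfunE scE (WtM wH) //.
have /ZtP/(_ c cNj) := Wt_Zt wH gG zZ; rewrite /scalar_Wt => ->.
by rewrite scalerA -(phiM phi_char) // /c mulKVg.
Qed.

Definition orbit_values (F : {ffun J -> Z}) : {ffun fperm V -> Z} :=
  [ffun x => if x \in U then orbit_value F x else 0].

Lemma orbit_values_ind q F : q \in TopN -> F \in X -> prTop F = q ->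
  orbit_values F \in ind_space U GN Zt GNact.
Proof.
move=> qN FX Fq.
have psiZ x : x \in U -> orbit_value F x \in Zt.
  move=> xU; apply/ZtP=> a aN; have aN1 : a \in norm_one star by case/setIdP: aN.
  rewrite /scalar_Wt -orbit_value_Gt //; last first.
    exact: (subsetP (Omega_Gt wH t) _ (norm_scalar_Omega h j_ideal aN)).
  by rewrite (norm_scalar_comm a xU) (orbit_value_N qN).
apply/ind_spaceP; split=> [x xU|x|y x yG xU].
- by rewrite ffunE xU psiZ.
- by rewrite in_setC ffunE => /negPf->.
have yU := GtN_U yG; rewrite !ffunE xU groupM //.
have [a [g [aN gG yE]]] := GtNP yG; have /(GtP wH)[gU _] := gG.
rewrite yE GtN_actE ?psiZ // -mulgA (norm_scalar_comm a (groupM gU xU)).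
by rewrite (orbit_value_N qN) ?groupM // orbit_value_Gt.
Qed.

Lemma alpha_t_phi a : a \in N_ i -> alpha h d lam t (sc a) = phi a.
Proof.
move=> aN; have [q [/TopNP qN q0 qE]] := t_Top.
have aN1 : a \in norm_one star by case/setIdP: aN.
have := qE _ (norm_scalar_Omega h i_ideal aN); rewrite qN // => /eqP.
by rewrite -subr_eq0 -scalerBl scaler_eq0 (negPf q0) orbF subr_eq0 => /eqP.
Qed.

(** If an element of [Top(phi)] does not vanish at [v], then [alpha_v] and
    [alpha_t] agree with [phi] on [N_i], so that [-v] lies in the orbit of [t]
    modulo [jV]; it is therefore detected by its values on this orbit. *)
Lemma orbit_values_inj q F : q \in TopN -> F \in X -> prTop F = q ->
  orbit_values F = 0 -> q = 0.
Proof.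
move=> qN FX Fq psi0; suff /Bot_prTop[_ <-] : F \in Bot by [].
apply/(weil_botP n_min); split=> // v pv; apply/eqP/negPn/negP=> Fv0.
have alv a : a \in N_ i -> alpha h d lam v (sc a) = alpha h d lam t (sc a).
  move=> aN; have /setIdP[aN1 ai] := aN; rewrite alpha_t_phi //.
  have aO := norm_scalar_Omega h i_ideal aN; have aU := scalar_aut_U aN1.
  have /(weil_botP n_min)[_ /(_ v pv)] := TopN_act qN FX Fq aN1.
  rewrite /value_at !ffunE -!/(value_at _ _) => /eqP; rewrite subr_eq0 => /eqP.
  rewrite weil_act_at // (Wr_Omega_i wH) //.
  have wi : (sc a)^-1%g v - v \in iV.
    have : sc a^-1%g \in Omega h i.
      apply: norm_scalar_Omega => //.
      by rewrite (groupV (Group (norm_one_cong_group_set star i_ideal))).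
    by rewrite -scalar_autV => /OmegaP[_].
  rewrite -{1}(subrK v ((sc a)^-1%g v)) value_at_shift ?(subsetP (sub_ijV wH)) //.
  rewrite (S'_scal wH) // => /eqP; rewrite -subr_eq0 -scalerBl scaler_eq0.
  rewrite -/(value_at F v) (negPf Fv0) orbF subr_eq0 => /eqP <-.
  rewrite /alpha; congr lam.
  rewrite (alt_formDl h d) (alt_formNl h d) (f_self hH lamH) subr0.
  rewrite -[f ((sc a)^-1%g v) v](unitary_f d _ _ aU) -fpermM mulgV fperm1.
  by rewrite (f_anti hH lamH (sc a v) v) opprK.
have len := length_of_scalars hH lamH i_ideal (one_notin_i wH) (weil_sqr0 wH) alv.
have pNv : - v \in prim.
  have [y yv] := primitive_dual_l hH pv.
  by apply: (unit_pairing_primitive hH (u := y)); rewrite linearNr yv unitrN unitr1.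
have len' : h t t - h (- v) (- v) \in j.
  by rewrite linearNl linearNr opprK -opprB mem_idealN.
have [g gU gtv] := length_congr hH j_ideal (one_notin_j wH) t_prim pNv len'.
rewrite opprK in gtv; case/negP: Fv0.
have -> : v = g t + v + - g t by rewrite addrAC subrr add0r.
rewrite value_at_shift //; have -> : value_at F (- g t) = 0; last by rewrite linear0.
have gVU := groupVr gU.
have /ffunP/(_ g^-1%g) := psi0; rewrite !ffunE gVU /orbit_value value_atE // invgK.
rewrite (lam0 lamH) scale1r (unitary_opp _ gU) => W0.
by rewrite -(Wr1 wH (value_at F _)) -(mulgV g) (WrM wH) // W0 linear0.
Qed.

Lemma Zt_neq0 : Zt <> 0%VS.
Proof.
move=> Z0; have [q [qN /eqP q0 _]] := t_Top; apply: q0.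
have [s sE] := prTop_section; have [sX sq] := sE q.
apply: (orbit_values_inj qN sX sq).
have /ind_spaceP[psZ psO _] := orbit_values_ind qN sX sq.
apply/ffunP=> x; rewrite [RHS]ffunE; have [xU|nxU] := boolP (x \in U).
  by have := psZ x xU; rewrite Z0 memv0 => /eqP.
by rewrite psO // in_setC.
Qed.

(** The inverse of [orbit_values]. The sum has one term for each way of writing
    [y] as a product of an element of [H(U^perp) x U(V)] and some [((0, -t), x)];
    these differ by elements of [G_t], so the sum is divided by [#|Gt|]. *)
Definition orbit_extension (ps : {ffun fperm V -> Z}) : {ffun J -> Z} :=
  [ffun y : J => #|Gt|%:R^-1 *:
     \sum_(g in U | y.1.2 + g t \in jV)
        S' (y.1 * heis_vec h d (g t))%g (Wr g (ps (g^-1 * sgval y.2)%g))].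

Lemma orbit_extension_X ps : orbit_extension ps \in X.
Proof.
apply/weil_spaceP=> l u y lH uU; rewrite !ffunE !linearZ /= subgK //.
rewrite [Wr u _]linear_sum /= [S' l _]linear_sum /= (reindex_inj (mulgI u)) /=.
congr (_ *: _).
have lj : l.2 \in jV by rewrite -(mem_HU wH).
have condE g : g \in U ->
    (l.2 + u y.1.2 + (u * g)%g t \in jV) = (y.1.2 + g t \in jV).
  move=> gU; have -> : l.2 + u y.1.2 + (u * g)%g t = l.2 + u (y.1.2 + g t).
    by rewrite fpermM (unitary_add _ _ uU) addrA.
  rewrite -(unitary_imul hH (y.1.2 + g t) j_ideal uU).
  apply/idP/idP=> E; last exact: imulD.
  by rewrite -(addKr l.2 (u _)) imulD // imulN.
apply: eq_big => [g|g /andP[gU gj]].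
  by rewrite groupMl //; case: (boolP (g \in U)) => //= gU; exact: condE.
rewrite groupMl // in gU; rewrite condE // in gj.
have kH : (y.1 * heis_vec h d (g t))%g \in HU by rewrite (mem_HU wH).
rewrite (Wr_S' wH _ uU kH) -(S'M wH) //; last first.
  by rewrite (mem_HU wH) /= (unitary_imul hH).
have -> : ((u * g)^-1 * (u * sgval y.2) = g^-1 * sgval y.2)%g.
  by rewrite invMg -mulgA mulKg.
rewrite heis_act_mul // (WrM wH) // mulgA; congr (S' _ _).
by rewrite /heis_act /heis_vec /= fpermM.
Qed.

Lemma orbit_values_extension ps :
  ps \in ind_space U GN Zt GNact -> orbit_values (orbit_extension ps) = ps.
Proof.
case/ind_spaceP=> psZ psO psE; apply/ffunP=> x; rewrite ffunE.
case: ifPn => xU; last by rewrite psO // in_setC.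
rewrite /orbit_value ffunE /= subgK //.
have condE g : (g \in U) && (- t + g t \in jV) = (g \in Gt).
  by rewrite addrC; apply/andP/(GtP wH).
rewrite (eq_bigl _ _ condE) (eq_bigr (fun=> ps x)) => [|g gG].
  rewrite sumr_const -scaler_nat scalerA mulVf ?scale1r //.
  by rewrite Num.Theory.pnatr_eq0 -lt0n (cardG_gt0 (Gt_group wH t)).
have /(GtP wH)[gU gt] := gG.
have N1 : 1%g \in norm_one star by rewrite (group1 (norm_one_group star)).
have gN : g \in GN by have := mem_GtN N1 gG; rewrite scalar_aut1 mul1g.
have gxU : (g^-1 * x)%g \in U by rewrite groupM ?groupV.
have := GtN_actE N1 gG (psZ _ gxU); rewrite scalar_aut1 mul1g (phi1 phi_char) scale1r.
rewrite -psE // mulKVg => ->; rewrite WtE; congr (S' _ _).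
rewrite /heis_vec heisM add0r [- t + _]addrC (alt_formNl h d); congr (_, _).
by rewrite (f_anti hH lamH (g t) t) opprK add0r.
Qed.

Lemma orbit_extension_TopN ps :
  ps \in ind_space U GN Zt GNact -> prTop (orbit_extension ps) \in TopN.
Proof.
case/ind_spaceP=> psZ psO psE; apply/TopNP=> a aN; have aU := scalar_aut_U aN.
rewrite rhoTop_prTop ?orbit_extension_X // -linearZ; congr (prTop _); apply/ffunP=> y.
rewrite weil_actE !ffunE /= subgK //.
have -> : (y.1 * heis_act (sgval y.2) 1)%g = y.1.
  by rewrite /heis_act /= (unitary_0 (subgP y.2)) mulg1.
have -> : y.1.2 + sgval y.2 0 = y.1.2 by rewrite (unitary_0 (subgP y.2)) addr0.
rewrite [RHS]scalerA [phi a * _]mulrC -scalerA [phi a *: _]scaler_sumr.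
congr (_ *: _).
apply: eq_bigr => g /andP[gU _]; rewrite -!linearZ /=; congr (S' _ (Wr _ _)).
have xU : (g^-1 * sgval y.2)%g \in U by rewrite groupM ?groupV ?subgP.
rewrite mulgA -(norm_scalar_comm a xU) psE //.
  have G1 : 1%g \in Gt by rewrite (group1 (Gt_group wH t)).
  by rewrite -[sc a]mulg1 GtN_actE ?psZ // (Wt1 wH).
by rewrite -[sc a]mulg1 mem_GtN // (group1 (Gt_group wH t)).
Qed.

Lemma orbit_values_lfun : exists T : 'Hom({ffun J -> Z}, {ffun fperm V -> Z}),
  forall F, T F = orbit_values F.
Proof.
apply: lfun_exists => a F G; apply/ffunP=> x; rewrite !ffunE.
by case: ifP => _; rewrite /orbit_value ?ffunE // scaler0 addr0.
Qed.

Lemma Top_induced :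
  module_iso U TopN rhoTop (ind_space U GN Zt GNact) (@ind_act _ _ Z).
Proof.
have [s sE] := prTop_section; have [T TE] := orbit_values_lfun.
have sX q : s q \in X by case: (sE q).
have sq q : prTop (s q) = q by case: (sE q).
have psi_s F : F \in X -> orbit_values (s (prTop F)) = orbit_values F.
  move=> FX; apply/ffunP=> x; rewrite !ffunE; case: ifP => // xU.
  have dB : s (prTop F) - F \in Bot.
    by apply: prTop_eq0; rewrite ?memvB // linearB /= sq subrr.
  have := orbit_value_Bot dB xU; rewrite /orbit_value !ffunE => /eqP.
  by rewrite subr_eq0 => /eqP.
have TsE q : (T \o s)%VF q = orbit_values (s q) by rewrite comp_lfunE TE.
exists (T \o s)%VF; split.
- apply/eqP; rewrite eqEsubv; apply/andP; split; apply/subvP=> ps.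
    by case/memv_imgP=> q qN ->; rewrite TsE; exact: (orbit_values_ind qN).
  move=> psI; apply/memv_imgP; exists (prTop (orbit_extension ps)).
    exact: orbit_extension_TopN.
  by rewrite TsE psi_s ?orbit_extension_X // orbit_values_extension.
- apply/eqP; rewrite -subv0; apply/subvP=> q; rewrite memv_cap memv_ker TsE memv0.
  by case/andP=> qN /eqP q0; rewrite (orbit_values_inj qN (sX q) (sq q) q0).
move=> g q gU qN; rewrite !TsE -{1}(sq q) rhoTop_prTop // psi_s ?weil_act_X //.
apply/ffunP=> x; rewrite ind_actE !ffunE groupMr //.
by case: ifP => // xU; rewrite orbit_value_act.
Qed.

(** ** The stabilizer of [Z_t(phi)] *)

Lemma Omega_conj (k : {set A}) g x : is_ideal k -> x \in U -> g \in Omega h k ->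
  (g ^ x)%g \in Omega h k.
Proof.
move=> k_ideal xU /OmegaP[gU gk]; apply/OmegaP; split; first by rewrite groupJ.
move=> v; rewrite conjgE !fpermM; have xVU := groupVr xU.
rewrite -{2}[v](fperm1 v) -(mulVg x) fpermM -(unitary_sub _ _ xVU).
by rewrite (unitary_imul hH).
Qed.

(** An intertwiner between [Zt] and its conjugate by [g] forces [alpha_t] and
    [alpha_(g t)] to agree on [Omega i], where both modules are isotypic. *)
Lemma Zt_stabilizer : is_stabilizer U (Omega h j) Zt Wt GN.
Proof.
have sOG := subsetP (Omega_Gt wH t).
split=> [|g gU]; first by apply/subsetP=> x; exact: GtN_U.
split=> [/GtNP[a [x [aN xG gE]]]|[T [TZ T0 TE]]].
  have /(GtP wH)[xU _] := xG.
  have xVG : x^-1%g \in Gt by rewrite (groupV (Gt_group wH t)).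
  exists (Wt x); split.
  - apply/eqP; rewrite eqEsubv; apply/andP; split; apply/subvP=> z.
      by case/memv_imgP=> w wZ ->; exact: (Wt_Zt wH).
    move=> zZ; apply/memv_imgP; exists (Wt x^-1%g z); first exact: (Wt_Zt wH).
    by rewrite -(WtM wH) // mulgV (Wt1 wH).
  - apply/eqP; rewrite -subv0; apply/subvP=> z; rewrite memv_cap memv_ker memv0.
    case/andP=> _ /eqP z0; rewrite -(Wt1 wH t z) -(mulVg x) (WtM wH) // z0.
    by rewrite linear0.
  - move=> k z kO _; have kU := Omega_unitary kO.
    have -> : (k ^ g)%g = (k ^ x)%g.
      by rewrite gE conjgM [(k ^ sc a)%g]conjgE -(norm_scalar_comm a kU) mulKg.
    have kxG : (k ^ x)%g \in Gt by rewrite sOG ?Omega_conj.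
    have <- : Wt (x * k ^ x)%g z = Wt x (Wt (k ^ x)%g z) by rewrite (WtM wH).
    have kG : k \in Gt by rewrite sOG.
    by rewrite -conjgC (WtM wH).
have gGN a : a \in norm_one star -> g t - \val a *: t \in jV -> g \in GN.
  move=> aN gat; have aU := scalar_aut_U aN; rewrite -(mulKVg (sc a) g) mem_GtN //.
  apply/(GtP wH); rewrite groupM ?groupV //; split=> //; have aVU := groupVr aU.
  have tE : (sc a)^-1%g (\val a *: t) = t.
    have -> : \val a *: t = sc a t by rewrite permE.
    by rewrite -fpermM mulVg fperm1.
  by rewrite fpermM -{2}tE -(unitary_sub _ _ aVU) (unitary_imul hH).
have [a aN gat] :
    exists2 a : {unit A}, a \in norm_one star & g t - \val a *: t \in jV.
  apply: (alpha_determines hH lamH i_ideal (one_notin_i wH) (one_notin_j wH)) => //.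
    exact: (weil_sqr0 wH).
  move=> k kO; have [z zZ z0] := Zt_nonzero Zt_neq0.
  have Tz0 : T z != 0.
    by apply: contra z0 => Tz0; rewrite -memv0 -T0 memv_cap zZ memv_ker.
  have kOj := subsetP (Omega_ij wH) _ kO.
  have := TE _ _ kOj zZ; rewrite !(Wt_Omega_i wH) ?Omega_conj // linearZ /=.
  move/eqP; rewrite -subr_eq0 -scalerBl scaler_eq0 (negPf Tz0) orbF subr_eq0.
  move/eqP=> <-; rewrite /alpha conjgE !fpermM.
  by rewrite -[f (g^-1%g _) t](unitary_f d _ _ gU) -fpermM mulgV fperm1.
exact: (gGN a).
Qed.

End Top.

(** * The rings of the theorem *)

Definition case_sign (A : pzRingType) (c : inv_case) : A :=
  if c is RamifiedEven then 1 else -1.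

Section Cases.

Variables (A : finComUnitRingType) (star : involutive_rmorphism A).
Local Notation R := (symR star).
Variables (pi : A) (p : R) (c : inv_case).
Hypothesis pi_gen : generates_max_ideal pi.
Hypothesis unit2 : (2%:R : A) \is a GRing.unit.
Hypothesis A_case : ring_case c pi p.
Local Notation eps := (case_sign A c).

Lemma sign2 : eps * eps = 1.
Proof. by case: (c); rewrite /= ?mulrNN mulr1. Qed.

Lemma star_sign : star eps = eps.
Proof. by case: (c); rewrite /= ?rmorphN rmorph1. Qed.

Lemma star_val (r : R) : star (\val r) = \val r.
Proof. by apply/eqP; have := valP r; rewrite inE. Qed.

Lemma symR_of (x : A) : star x = x -> exists r : R, \val r = x.
Proof.
move=> /eqP sx; have xS : x \in sym_pred star by rewrite inE.
by exists (Sub x xS); rewrite SubK.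
Qed.

Lemma star_pi : star pi = pi \/ star pi = - pi.
Proof.
case: c A_case => /= [[sA _]|[-> _]|[[_ sp _] _]|[[_ sp _] _]]; try by right.
  by left.
by left; exact: star_val.
Qed.

Lemma star_multiple x : exists u, star x = u * x.
Proof.
have [u [k [uu ->]]] := chain_form pi_gen x.
have [s sE] : exists s, star pi = s * pi.
  by case: star_pi => ->; [exists 1; rewrite mul1r|exists (-1); rewrite mulN1r].
exists (star u * s ^+ k / u); rewrite rmorphM rmorphXn /= sE exprMn.
by rewrite -[RHS]mulrA mulKr // mulrA.
Qed.

Lemma double_eq0 (x : A) : x = - x -> x = 0.
Proof.
move=> xN; apply: (mulrI unit2).
by rewrite mulr0 mulr_natl mulr2n {1}xN addNr.
Qed.

Lemma sym_skew_parts y : exists (r : R) (s : A), star s = - s /\ y = \val r + s.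
Proof.
have [|r rE] := @symR_of ((y + star y) / 2%:R).
  by rewrite rmorphM rmorphV //= rmorph_nat rmorphD /= rmorphK addrC.
exists r, ((y - star y) / 2%:R); rewrite rE; split.
  by rewrite rmorphM rmorphV //= rmorph_nat rmorphB /= rmorphK -mulNr opprB.
rewrite -mulrDl addrACA subrr addr0; apply: (mulIr unit2).
by rewrite divrK // mulr_natr mulr2n.
Qed.

Section Trace.

Variable d : {additive A -> R}.
Hypothesis d_def : d_case c pi d.

(** [d y] is the coordinate of [y] along the second summand of
    [A = A_eps + R w], where [w] is [1] or [pi] and [A_eps] is the module of
    [eps]-symmetric elements. *)
Lemma d_coordinate : exists w : A, forall y : A, exists s : A,
  [/\ star s = eps * s, y = s + \val (d y) * w &
      forall (r : R) (s' : A), star s' = eps * s' -> d (s' + \val r * w) = r].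
Proof.
have skew : (forall (r : R) (s : A), star s = - s -> d (\val r + s) = r) ->
    forall y, exists s : A, [/\ star s = -1 * s, y = s + \val (d y) * 1 &
      forall (r : R) (s' : A), star s' = -1 * s' -> d (s' + \val r * 1) = r].
  move=> dE y; have [r [s [ss yE]]] := sym_skew_parts y; exists s; split.
  - by rewrite mulN1r.
  - by rewrite {2}yE dE // mulr1 addrC.
  - by move=> r' s'; rewrite mulN1r mulr1 addrC => /dE.
case: c A_case d_def => /=; [by exists 1; exact: skew|by exists 1; exact: skew|
  by exists 1; exact: skew|].
move=> [[[sum _] sp _] _] dE; exists pi => y; have [r [s yE]] := sum y.
exists (\val r); rewrite mul1r star_val; split=> //.
  by rewrite {2}yE [pi * _]mulrC dE yE [pi * _]mulrC.
by move=> r' s'; rewrite mul1r => /symR_of[s0 <-]; exact: dE.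
Qed.

Lemma d_trace x : d (x + eps * star x) = 0.
Proof.
have [w wE] := d_coordinate; have [_ [_ _ dE]] := wE 0.
rewrite -[_ + _]addr0 -(mul0r w) -[0](raddf0 (val : R -> A)).
rewrite dE // rmorphD rmorphM /= (rmorphK star) star_sign mulrDr mulrA sign2.
by rewrite mul1r addrC.
Qed.

Lemma d_mul (r : R) y : d (\val r * y) = r * d y.
Proof.
have [w wE] := d_coordinate; have [s [ss yE dE]] := wE y.
rewrite {1}yE mulrDr mulrA -[\val r * \val (d y)]/(\val (r * d y)) dE //.
by rewrite rmorphM /= star_val ss mulrCA.
Qed.

Lemma d_eq0 y : d y = 0 -> star y = eps * y.
Proof.
move=> dy; have [w wE] := d_coordinate; have [s [ss yE _]] := wE y.
by rewrite yE dy mul0r addr0.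
Qed.

(** If [lam \o d] is trivial on [A x], then every multiple of [x] is
    [eps]-symmetric. This forces [2 theta x = 0] in the unramified case; in the
    ramified case it forces [pi x = 0], so that [x] is a symmetric multiple of
    the last nonzero power of [pi], whose sign is the opposite of [eps]. *)
Lemma trace_primitive (C : fieldType) (lam : R -> C) x :
  is_primitive_char lam -> (forall a, lam (d (a * x)) = 1) -> x = 0.
Proof.
move=> [_ lam_prim] lx.
have J0 : [set d (a * x) | a : A] = [set 0].
  apply: lam_prim; last by move=> _ /imsetP[a _ ->].
  split; first by apply/imsetP; exists 0; rewrite ?mul0r ?raddf0.
  move=> r _ _ /imsetP[a _ ->] /imsetP[b _ ->]; apply/imsetP.
  by exists (\val r * a + b); rewrite // mulrDl raddfD -mulrA d_mul.
have sx a : star (a * x) = eps * (a * x).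
  apply: d_eq0; apply/set1P; rewrite -J0; exact: imset_f.
have sx1 : star x = eps * x by have := sx 1; rewrite mul1r.
have comm a : star a * x = a * x.
  have := sx a; rewrite rmorphM /= sx1 => E.
  rewrite -[x](mul1r x) -sign2 -!mulrA [star a * _]mulrCA E.
  by rewrite !mulrA [a * eps]mulrC; congr (_ * _); rewrite -!mulrA [a * eps]mulrC.
have ramified_case e : is_direct_sum star pi -> star pi = - pi ->
    nilpotency_degree pi e -> eps = (if odd e then -1 else 1) -> x = 0.
  move=> [sum _] sp [pe0 pmin] epsE.
  have px : pi * x = 0.
    by apply: double_eq0; rewrite -{1}comm sp mulNr.
  have [u [k [uu xE]]] := chain_form pi_gen x.
  have pk : pi ^+ k.+1 = 0.
    by apply: (mulrI uu); rewrite mulr0 exprS mulrCA -xE.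
  have lek : (e <= k.+1)%N by rewrite leqNgt; apply/negP=> /pmin.
  have [leek|ltke] := leqP e k.
    by rewrite xE -(subnK leek) exprD pe0 !mulr0.
  have ek : e = k.+1 by apply/eqP; rewrite eqn_leq lek.
  have [r [s uE]] := sum u.
  have xE' : x = \val r * pi ^+ k.
    by rewrite xE uE mulrDl [pi * _ * _]mulrAC -exprS pk mul0r addr0.
  have := sx1; rewrite {1}xE' rmorphM rmorphXn /= sp star_val epsE ek /=.
  rewrite exprNn mulrCA -xE' -signr_odd.
  by case: (odd k) => /=; rewrite ?expr1 ?expr0 ?mul1r ?mulN1r => E;
    apply: double_eq0.
case: c A_case sx1 ramified_case => /=.
- by move=> [sA _] + _; rewrite sA mulN1r => /double_eq0.
- move=> [_ [theta [theta_unit stheta _]]] _ _.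
  apply: (mulrI theta_unit); rewrite mulr0; apply: double_eq0.
  by rewrite -{1}comm stheta mulNr.
- by move=> [[dsum sp _] [e ne oe]] _ /(_ e dsum sp ne); rewrite oe => /(_ erefl).
- move=> [[dsum sp _] [e ne oe]] _ /(_ e dsum sp ne).
  by rewrite (negPf oe) => /(_ erefl).
Qed.

End Trace.
End Cases.

Lemma dvr_quotient_unit2 (O : idomainType) (A : finComUnitRingType)
    (q : {rmorphism O -> A}) :
  residue_field_finite_not2 O -> (2%:R : A) \is a GRing.unit.
Proof.
case=> k [res [_ res0 k2]]; rewrite -(rmorph_nat q); apply: rmorph_unit.
apply/negPn/negP=> /res0; rewrite rmorph_nat => r2; case/negP: k2.
by rewrite inE /= r2 eqxx.
Qed.

Theorem theorem1p2
  (* rings *)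
  (O : idomainType) (starO : involutive_rmorphism O)
  (O_dvr : is_dvr O) (O_res : residue_field_finite_not2 O)
  (A : finComUnitRingType) (star : involutive_rmorphism A)
  (q : {rmorphism O -> A}) (A_quo : is_dvr_quotient starO star q)
  (A_not_field : exists x : A, x != 0 /\ x \isn't a GRing.unit)
  (pi : A) (p : symR star)
  (pi_gen : generates_max_ideal pi) (p_gen : generates_max_ideal p)
  (n : {set A}) (n_min : is_min_nonzero_ideal n)
  (c : inv_case) (A_case : ring_case c pi p)
  (* forms *)
  (m : nat) (m_gt1 : (1 < m)%N)
  (h : {bilinear 'rV[A]_m -> 'rV[A]_m -> A | (star \; *%R) & *%R})
  (h_nondeg : nondegenerate_form h) (h_herm : herm_case star c h)
  (d : {additive A -> symR star}) (d_def : d_case c pi d)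
  (* ideals *)
  (i : {set A}) (i_ideal : is_ideal i) (i_neq0 : i <> [set 0])
  (i_sqr0 : {in i &, forall x y, x * y = 0})
  (* Heisenberg and Weil representations over the complex numbers RR[i] *)
  (RR : realType) (lam : symR star -> RR[i]) (lam_prim : is_primitive_char lam)
  (Z : vectType RR[i])
  (S' : heis h d -> 'End(Z)) (S'_irr : is_schrodinger i lam S')
  (W' : fperm 'rV[A]_m -> 'End(Z)) (W'_weil : is_weil i S' W')
  (* Top *)
  (Top : vectType RR[i]) (rhoTop : fperm 'rV[A]_m -> 'End(Top))
  (prTop : 'Hom({ffun jacobi h d -> Z}, Top))
  (Top_quo : is_quotient_module (unitary h) (weil_space i S' W')
               (@weil_act _ _ _ h d _ Z) (weil_bot i S' W' n) rhoTop prTop)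
  (* orbits *)
  (T : {set 'rV[A]_m}) (T_repr : is_orbit_repr h i T)
  (j_sqr : {in annihilator i &, forall x y, x * y \in i})
  (phi : {unit A} -> RR[i]) (phi_N : in_Ntilde h d i lam pi T phi)
  (t : 'rV[A]_m) (t_T : t \in T) (t_prim : t \in primitive_vectors m pi)
  (t_Top : char_enters (Omega h i) (eigen_N star rhoTop phi) rhoTop
             (alpha h d lam t)) :
  let j := annihilator i in
  let HU := heis_of h d (Uperp h i) in
  let Ht := H_t h d i t in
  let Zt := Z_t i S' W' t phi in
  let Wt := W_t i S' W' t in
  let N_ k := norm_one_cong star k in
  [/\ (* (a) *)
      is_irreducible (Omega h j) Zt Wt,
      (* (b) *)
      is_stabilizer (unitary h) (Omega h j) Zt Wt (GtN h i t) /\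
      module_iso (unitary h) (eigen_N star rhoTop phi) rhoTop
        (ind_space (unitary h) (GtN h i t) Zt (GtN_act i S' W' t phi))
        (@ind_act _ _ Z),
      (* (c) *)
      [/\ {in Ht, forall k, (S' k @: Zt <= Zt)%VS},
          module_iso HU fullv S' (ind_space HU Ht Zt S') (@ind_act _ _ Z),
          is_irreducible Ht Zt S',
          is_stabilizer HU Ht Zt S' Ht &
          #|HU : Ht|%g = #|(N_ j / N_ i)%g|] &
      (* (d) *)
      [/\ Gamma i t @: Omega h j \subset (ideal_mul m j / ideal_mul m i)%g,
          {in Omega h j &, {morph Gamma i t : g k / (g * k)%g}} &
          #|(ideal_mul m j / ideal_mul m i)%g : Gamma i t @: Omega h j|%g
            = #|(N_ j / N_ i)%g|]].
Proof.
have unit2 := dvr_quotient_unit2 q O_res.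
pose eps := case_sign A c.
have hH : hermitian_space pi eps h.
  split=> //; first exact: (star_multiple pi_gen A_case).
    by rewrite /eps /case_sign; case: (c); [right|right|right|left].
  by move=> u v; move: h_herm; rewrite /eps /case_sign;
     case: (c) => /= ->; rewrite ?mulN1r ?mul1r.
have lamH : trace_character eps d lam.
  split; first by case: lam_prim.
    exact: (d_trace unit2 A_case d_def).
  by move=> x; apply: (trace_primitive pi_gen unit2 A_case d_def lam_prim).
have wH : weil_setting pi eps i lam S' W' by split.
have phi_char : is_lin_char (norm_one star) phi by case: phi_N.
move=> j HU Ht Zt Wt N_.
have Zt0 : Zt <> 0%VS.
  exact: (Zt_neq0 wH n_min Top_quo t_prim phi_char t_Top).
have HtHD := H_tE wH t_prim.
have irrHt : is_irreducible Ht Zt S'.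
  by rewrite /Ht HtHD; apply: (Zt_irreducible_heis_perp wH).
split.
- by apply: (Zt_irreducible_Omega wH).
- split; first exact: (Zt_stabilizer wH n_min Top_quo t_prim phi_char t_Top).
  exact: (Top_induced wH n_min Top_quo t_prim phi_char t_Top).
- split=> //; first by case: irrHt => -[].
  + by rewrite /Ht HtHD; apply: (induced_from_heis_perp wH).
  + by rewrite /Ht HtHD; apply: (stabilizer_heis_perp wH).
  + by rewrite /Ht HtHD; apply: (index_heis_perp wH).
- split.
  + by apply: (Gamma_sub wH).
  + by apply: (Gamma_morph wH).
  + by apply: (index_Gamma wH).
Qed.
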